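(* Let $k\ge 2$ and $n\ge 13k^2$ be integers and let $G$ be a graph of order $n$. (a) If $\mu(G)\ge \mu(S_{n,k})$, then $G$ contains a cycle of length at least $2k+1$, unless $G\cong S_{n,k}$. (b) If $\mu(G)\ge \mu(S_{n,k}^+)$, then $G$ contains a cycle of length at least $2k+2$, unless $G\cong S_{n,k}^+$.
   Context: All graphs are finite and simple. For a graph $G$, $\mu(G)$ denotes the spectral radius of $G$, i.e. the largest eigenvalue of its adjacency matrix. $S_{n,k}=K_k\vee\overline{K_{n-k}}$ is the join of a complete graph on $k$ vertices with an independent set of $n-k$ vertices (every vertex of the $K_k$ is adjacent to every vertex of the independent set). $S_{n,k}^+$ is the graph obtained from $S_{n,k}$ by adding one edge inside the independent set of $n-k$ vertices. *)

(* Defs.v *)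
From HB Require Import structures.
From mathcomp Require Import all_boot all_order all_algebra.
From mathcomp Require Import all_classical all_reals.

Set Implicit Arguments.
Unset Strict Implicit.
Unset Printing Implicit Defensive.

Import Order.TTheory GRing.Theory Num.Theory.

Record sgraph := SGraph {
  vertex :> finType;
  adj : rel vertex;
  adj_sym : symmetric adj;
  adj_irrefl : irreflexive adj }.

Definition graph_iso (G H : sgraph) : Prop :=
  exists f : G -> H, bijective f /\ forall x y : G, adj (f x) (f y) = adj x y.

(* The size condition excludes [:: x; y] with x, y adjacent, which satisfies
   ucycle. *)
Definition is_graph_cycle (G : sgraph) (c : seq G) : bool :=
  (3 <= size c) && ucycleb (@adj G) c.

Definition has_cycle_geq (G : sgraph) (l : nat) : Prop :=
  exists2 c : seq G, is_graph_cycle c & l <= size c.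

Definition complete_adj (m : nat) : rel 'I_m := fun x y => x != y.

Fact complete_sym m : symmetric (@complete_adj m).
Proof. by move=> x y; rewrite /complete_adj eq_sym. Qed.

Fact complete_irrefl m : irreflexive (@complete_adj m).
Proof. by move=> x; rewrite /complete_adj eqxx. Qed.

Definition complete_graph (m : nat) : sgraph :=
  SGraph (@complete_sym m) (@complete_irrefl m).

Definition compl_adj (G : sgraph) : rel G := fun x y => (x != y) && ~~ adj x y.

Fact compl_sym G : symmetric (@compl_adj G).
Proof. by move=> x y; rewrite /compl_adj eq_sym adj_sym. Qed.

Fact compl_irrefl G : irreflexive (@compl_adj G).
Proof. by move=> x; rewrite /compl_adj eqxx. Qed.

Definition compl_graph (G : sgraph) : sgraph :=
  SGraph (@compl_sym G) (@compl_irrefl G).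

Definition join_adj (G H : sgraph) : rel (G + H)%type := fun u v =>
  match u, v with
  | inl x, inl y => adj x y
  | inr x, inr y => adj x y
  | _, _ => true
  end.

Fact join_sym G H : symmetric (@join_adj G H).
Proof. by move=> [x|x] [y|y] //=; rewrite adj_sym. Qed.

Fact join_irrefl G H : irreflexive (@join_adj G H).
Proof. by move=> [x|x] /=; rewrite adj_irrefl. Qed.

Definition join_graph (G H : sgraph) : sgraph :=
  SGraph (@join_sym G H) (@join_irrefl G H).

(* S_{n,k}; it has order n when k <= n. *)
Definition S_graph (n k : nat) : sgraph :=
  join_graph (complete_graph k) (compl_graph (complete_graph (n - k))).

(* S_{n,k}^+; the added edge joins the vertices 0 and 1 of the independent set,
   which exist when k + 2 <= n. *)
Definition S_plus_adj (n k : nat) : rel (S_graph n k) := fun u v =>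
  adj u v ||
  match u, v with
  | inr i, inr j => ((i == 0 :> nat) && (j == 1 :> nat))
                    || ((i == 1 :> nat) && (j == 0 :> nat))
  | _, _ => false
  end.

Fact S_plus_sym n k : symmetric (@S_plus_adj n k).
Proof.
move=> u v; rewrite /S_plus_adj adj_sym; congr (_ || _).
by case: u v => [x|x] [y|y] //; rewrite orbC andbC [X in _ || X]andbC.
Qed.

Fact S_plus_irrefl n k : irreflexive (@S_plus_adj n k).
Proof.
move=> u; rewrite /S_plus_adj adj_irrefl /=.
by case: u => [//|[[|m] lt_m]] /=; rewrite ?andbF.
Qed.

Definition S_plus_graph (n k : nat) : sgraph :=
  SGraph (@S_plus_sym n k) (@S_plus_irrefl n k).

Local Open Scope ring_scope.

Definition adjmx (R : realType) (G : sgraph) : 'M[R]_#|G| :=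
  \matrix_(i, j) (adj (enum_val i) (enum_val j))%:R.

(* Here the set is finite, and nonempty as soon as G is (adjmx R G is symmetric),
   so that its supremum is the largest eigenvalue. *)
Definition spectral_radius (R : realType) (G : sgraph) : R :=
  sup [set a : R | eigenvalue (adjmx R G) a]%classic.

(* Main.v *)
Require Import Defs.
From mathcomp Require Import all_classical all_reals topology normedtype derive.
From mathcomp Require Import all_boot all_order all_algebra.
From mathcomp Require Import zify ring lra.

Set Implicit Arguments.
Unset Strict Implicit.
Unset Printing Implicit Defensive.

Import Order.TTheory GRing.Theory Num.Theory.
Import numFieldNormedType.Exports.

(* Scale the Perron vector [x] of [G] so that its largest entry is [x v = 1], and let
   [mu] be the spectral radius. Testing [S_graph] with vectors constant on both sides
   gives [k (n - k) <= mu (mu - k + 1)]. Without long cycles, a path avoiding [v] with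
   both ends adjacent to [v] is short, so that there are at most about
   [(k - 1) #|N(v)| + k #|S|] edges between the neighbourhood of [v] and any set [S].
   Weighted by [x], this is nearly tight: [v] and [k - 1] further vertices, the hubs,
   have weight close to 1 and are adjacent to almost everything. As any two hubs have
   many common neighbours, a short segment outside the hubs closes up into a cycle
   through all of them, which excludes almost all edges between non-hubs. It follows
   that joining the hubs to all vertices and deleting the other edges (except one, in
   the second part) does not decrease the quadratic form at [x]. The graph obtained is
   [S_graph] or [S_plus_graph], whose spectral radius is at most [mu]; so [x] is an
   eigenvector of both graphs for [mu], and they coincide. *)

(** * Edges between a neighbourhood and a set *)

(** The bound [k (n - k) <= mu (mu - k + 1)] leaves no slack of order [mu]: a vertex of [S] that is
    adjacent to [v] may be charged only [k - 1] edges, while short paths alone allow [k]. A complete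
    graph on [2 k + 1] vertices containing [v] attains the larger value. The sharper count holds in
    those components of the graph without [v] that have more than [2 k] neighbours of [v]. The other
    components are treated apart through their own spectral radius, and contribute at most [4 k / 5]
    per vertex instead of [k]. With [N] and [W] the remaining neighbours and non-neighbours of [v],
    and [F] the vertices of the small components, everything fits into one budget, [#|N| * D + k * E
    + k * #|F| / 5 <= k (k - 1)], where [D] is the sum of [1 - x] over the [k - 1] heaviest vertices
    and [E] the one over [W]. As [n >= 13 k ^ 2], each hub has weight at least [12 / 13], and this
    number has to pay for every deleted edge. *)

Lemma longest_seq (T : finType) (P : pred (seq T)) (p0 : seq T) :
    (forall p, P p -> uniq p) -> P p0 ->
  exists2 p, P p & forall p', P p' -> size p' <= size p.
Proof.
move=> Puniq Pp0.
pose Q n := [exists t : n.-tuple T, P t].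
have exQ : exists n, Q n.
  by exists (size p0); apply/existsP; exists (in_tuple p0).
have ubQ n : Q n -> n <= #|T|.
  case/existsP=> t /Puniq /card_uniqP; rewrite size_tuple => <-.
  exact: max_card.
case: (ex_maxnP exQ ubQ) => m /existsP[t Pt] maxm.
exists t => // p' Pp'; rewrite size_tuple; apply: maxm.
by apply/existsP; exists (in_tuple p').
Qed.

Lemma split_last (T : eqType) (a : pred T) (s : seq T) : has a s ->
  exists s1 z s2, [/\ s = s1 ++ z :: s2, a z & ~~ has a s2].
Proof.
elim: s => //= y s IHs; case: (boolP (has a s)) => [has_s _ | nhas_s].
  case: (IHs has_s) => s1 [z [s2 [-> az nh]]].
  by exists (y :: s1), z, s2.
by rewrite orbF => ay; exists [::], y, s.
Qed.

(** * Closing a path with high end degrees into a cycle *)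

Section Crossing.
Variables (T : finType) (g : rel T).
Hypotheses (gsym : symmetric g) (girr : irreflexive g).

(** If [x] is adjacent to some vertex of the path and the other end [y] to its predecessor, these
    two edges replace the edge between the two vertices and close the path. The index sets [I] and
    [J] of such vertices both lie among [size q] positions, so the hypothesis makes them meet. *)
Lemma crossing_cycle x q : path g x q -> uniq (x :: q) ->
    size q < #|[set u in x :: q | g x u]| + #|[set u in x :: q | g (last x q) u]| ->
  exists2 c, perm_eq c (x :: q) & cycle g c.
Proof.
move=> gq uq big; set y := last x q in big.
pose I := [set i : 'I_(size q) | g x (nth x q i)].
pose J := [set i : 'I_(size q) | g y (nth x (x :: q) i)].
have leI : #|[set u in x :: q | g x u]| <= #|I|.
  apply: leq_trans (leq_imset_card (fun i : 'I_(size q) => nth x q i) (mem I)).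
  apply/subset_leq_card/subsetP => u; rewrite !inE => /andP[/orP[/eqP->|uq1] gxu].
    by rewrite girr in gxu.
  have lt : index u q < size q by rewrite index_mem.
  apply/imsetP; exists (Ordinal lt); last by rewrite /= nth_index.
  by rewrite inE /= nth_index.
have leJ : #|[set u in x :: q | g y u]| <= #|J|.
  apply: leq_trans (leq_imset_card (fun i : 'I_(size q) => nth x (x :: q) i) (mem J)).
  apply/subset_leq_card/subsetP => u; rewrite inE => /andP[uq1 gyu].
  have lt : index u (x :: q) < size (x :: q) by rewrite index_mem.
  have lt' : index u (x :: q) < size q.
    rewrite ltn_neqAle -ltnS lt andbT; apply/eqP => eqi.
    have: nth x (x :: q) (index u (x :: q)) = y by rewrite eqi /y (last_nth x).
    by rewrite nth_index // => eu; rewrite eu girr in gyu.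
  apply/imsetP; exists (Ordinal lt'); last by rewrite [RHS]/= nth_index.
  by rewrite inE [nat_of_ord _]/= nth_index.
have [i] : exists i, i \in I :&: J.
  apply/set0Pn; apply/negP => /eqP IJ0.
  have := cardsUI I J; rewrite IJ0 cards0 addn0 => eqU.
  have := max_card (mem (I :|: J)); rewrite card_ord.
  by rewrite eqU; lia.
rewrite !inE => /andP[gxi gyi].
have lti := ltn_ord i.
move: gxi gyi lti; move: (nat_of_ord i) => {I J leI leJ} {}i gxi gyi lti.
have eqq : q = take i q ++ nth x q i :: drop i.+1 q.
  by rewrite -drop_nth // cat_take_drop.
set b := nth x q i in eqq gxi; set q1 := take i q in eqq; set q2 := drop i.+1 q in eqq.
have eqz : nth x (x :: q) i = last x q1.
  rewrite (last_nth x) /q1 size_take lti.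
  by case: (i) => [//|j] /=; rewrite nth_take.
rewrite eqz in gyi.
have lasty : y = last b q2 by rewrite /y eqq last_cat.
exists ((x :: q1) ++ rev (b :: q2)).
  rewrite [in X in perm_eq _ X]eqq -cat_cons perm_cat2l.
  by rewrite perm_rev.
move: gq; rewrite eqq cat_path /= => /and3P[gq1 _ gq2].
rewrite [b :: q2]lastI rev_rcons -lasty rcons_cat cat_path gq1 /=.
rewrite gsym gyi /= rcons_path.
have -> : path g y (rev (belast b q2)).
  rewrite lasty rev_path.
  by rewrite (eq_path (e' := g)) // => u w; rewrite gsym.
have -> : last y (rev (belast b q2)) = b.
  by rewrite lasty; case: (q2) => [//|c q3] /=; rewrite rev_cons last_rcons.
by rewrite gsym gxi.
Qed.

End Crossing.

Section SetLemma.
Variables (V : finType) (e : rel V).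
Hypotheses (esym : symmetric e) (eirr : irreflexive e).
Variables (k beta : nat) (M N S : {set V}).
Hypotheses (k_gt1 : 1 < k) (le_beta : k.-1 <= beta).
Hypotheses (sNM : N \subset M) (sSM : S \subset M).
Hypothesis short_path : forall x q, path e x q -> uniq (x :: q) ->
  {subset x :: q <= M} -> x \in N -> last x q \in N -> size q < 2 * k.

Definition arc s u := [&& s \in S, u \in N & e s u].
Definition edg : rel V := fun a b => arc a b || arc b a.
Definition arcs (U : {set V}) := \sum_(s in U) \sum_(u in U) arc s u.
(** The price of a vertex. The parameter [beta], paid for an element of [S] that also lies in [N],
    is [k] in the lossy count and [k.-1] in the lossless one. *)
Definition wgt u := (u \in N) * k.-1 + (u \in S) * (if u \in N then beta else k).

Let edg_sym : symmetric edg.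
Proof. by move=> a b; rewrite /edg orbC. Qed.

Let edg_irr : irreflexive edg.
Proof. by move=> a; rewrite /edg /arc eirr !andbF. Qed.

Let edg_e a b : edg a b -> e a b.
Proof. by case/orP=> /and3P[_ _] //; rewrite esym. Qed.

Let edg_NI a b : edg a b -> a \notin N -> b \in N.
Proof. by case/orP=> /and3P[? ? _] // /negP. Qed.

Let edg_M a b : edg a b -> a \in M.
Proof.
by case/orP=> /and3P[sa Nb _]; [exact: (subsetP sSM) | exact: (subsetP sNM)].
Qed.

Lemma edg_short x q : path edg x q -> uniq (x :: q) -> x \in N -> last x q \in N ->
  size q < 2 * k.
Proof.
move=> pq uq xN lN; apply: (@short_path x) => //.
  by apply: sub_path pq => a b; apply: edg_e.
move=> z; rewrite inE => /orP[/eqP-> | ]; first exact: (subsetP sNM).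
have: forall y, path edg y q -> {subset q <= M}.
  elim: (q) => //= b q' IHq y /andP[eyb pq'] w; rewrite inE => /orP[/eqP-> | ].
    by apply: (@edg_M b y); rewrite edg_sym.
  exact: IHq pq' w.
by move/(_ x pq); apply.
Qed.

(** An end outside [N] has its neighbour on the path in [N]. Dropping such ends leaves a path to
    which [edg_short] applies. *)
Lemma edg_trim x q : path edg x q -> uniq (x :: q) ->
  size q < 2 * k + (x \notin N) + (last x q \notin N).
Proof.
move=> pq uq; have [xN|xN] := boolP (x \in N);
  have [yN|yN] := boolP (last x q \in N); rewrite /= ?addn1 ?addn0 ?addn0 ?addn1.
- exact: (edg_short pq uq).
- case/lastP: q pq uq yN => [|q' y'] pq uq; first by rewrite /= xN.
  rewrite /= last_rcons size_rcons ltnS => yN.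
  move: pq uq; rewrite rcons_path -rcons_cons rcons_uniq => /andP[pq' e1] /andP[_ uq'].
  by apply: (edg_short pq' uq') => //; apply: (edg_NI _ yN); rewrite edg_sym.
- case: q pq uq yN => [|x1 q1] /=; first by rewrite (negPf xN).
  move=> /andP[e1 pq1] /andP[_ uq1] yN; rewrite ltnS.
  by apply: (edg_short pq1 uq1) => //; apply: edg_NI xN.
- case: q pq uq yN => [|x1 q1] //=.
  move=> /andP[e1 pq1] /andP[_]; have x1N : x1 \in N by apply: edg_NI xN.
  rewrite -/(uniq (x1 :: q1)).
  case/lastP: q1 pq1 => [|q' y']; first by rewrite /= x1N.
  rewrite last_rcons size_rcons rcons_path -rcons_cons rcons_uniq !ltnS.
  move=> /andP[pq' e2] /andP[_ uq'] yN.
  by apply: (edg_short pq' uq') => //; apply: (edg_NI _ yN); rewrite edg_sym.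
Qed.

(** Kept as a hypothesis because the two values of [beta] need different arguments on short
    cycles. *)
Hypothesis small_cycle : forall (U : {set V}) c, uniq c -> cycle edg c ->
  U =i c -> size c <= 2 * k -> U \subset N :|: S ->
  arcs U <= \sum_(u in U) wgt u.

Let gdeg (U : {set V}) z := #|[set u in U | edg z u]|.

Let cost (U : {set V}) z := \sum_(u in U) arc z u + \sum_(u in U) arc u z.

Lemma arcsD1 (U : {set V}) z : z \in U -> arcs U = arcs (U :\ z) + cost U z.
Proof.
move=> Uz; rewrite /arcs /cost (big_setD1 z) //=.
under [X in _ + X = _]eq_bigr => s _ do rewrite (big_setD1 z) //=.
rewrite big_split /=.
rewrite [in RHS](big_setD1 z Uz) /= [X in _ = _ + (_ + X)](big_setD1 z Uz) /=.
have az : arc z z = false by rewrite /arc eirr !andbF.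
rewrite (big_setD1 z Uz) /= az; lia.
Qed.

Let gdegE (U : {set V}) z : gdeg U z = \sum_(u in U) edg z u.
Proof.
rewrite /gdeg -sum1_card big_mkcond [RHS]big_mkcond /=; apply: eq_bigr => u _.
by rewrite inE; case: (u \in U) => //=; case: (edg z u).
Qed.

(** If [z] lies in both sets, a neighbour counts at most twice in [cost], against a price of at
    least [2 * k.-1]; otherwise it counts once. The additional unit outside [N] offsets the longer
    paths that [edg_trim] allows there, so that [crossing_cycle] applies in every case. *)
Lemma gdeg_ge (U : {set V}) z : wgt z < cost U z ->
  k + (z \notin N) <= gdeg U z.
Proof.
rewrite gdegE /wgt /cost.
have [Nz|Nz] := boolP (z \in N); have [Sz|Sz] := boolP (z \in S) => /=.
- move=> lt; have: \sum_(u in U) arc z u + \sum_(u in U) arc u z <= 2 * \sum_(u in U) edg z u.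
    rewrite -big_split big_distrr /= leq_sum // => u _.
    by rewrite /edg; case: (arc z u); case: (arc u z).
  move: le_beta; lia.
- have -> : \sum_(u in U) arc z u = 0.
    by rewrite big1 // => u _; rewrite /arc (negPf Sz).
  have: \sum_(u in U) arc u z <= \sum_(u in U) edg z u.
    by apply: leq_sum => u _; rewrite /edg; case: (arc u z); rewrite ?orbT.
  lia.
- have -> : \sum_(u in U) arc u z = 0.
    by rewrite big1 // => u _; rewrite /arc (negPf Nz) andbF.
  have: \sum_(u in U) arc z u <= \sum_(u in U) edg z u.
    by apply: leq_sum => u _; rewrite /edg; case: (arc z u).
  lia.
- have -> : \sum_(u in U) arc z u = 0.
    by rewrite big1 // => u _; rewrite /arc (negPf Sz).
  have -> // : \sum_(u in U) arc u z = 0.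
  by rewrite big1 // => u _; rewrite /arc (negPf Nz) andbF.
Qed.

Lemma arcs_closed (U Q : {set V}) : Q \subset U ->
    (forall a b, a \in Q -> b \in U -> b \notin Q -> ~~ edg a b) ->
  arcs U = arcs Q + arcs (U :\: Q).
Proof.
move=> sQU cl; rewrite /arcs (big_setID Q) /= (setIidPr sQU); congr (_ + _).
  apply: eq_bigr => a Qa; rewrite (big_setID Q) /= (setIidPr sQU).
  rewrite [X in _ + X]big1 ?addn0 // => b; rewrite inE => /andP[nQb Ub].
  by have := cl a b Qa Ub nQb; rewrite negb_or => /andP[/negPf->].
apply: eq_bigr => a; rewrite inE => /andP[nQa Ua].
rewrite (big_setID Q) /= (setIidPr sQU) big1 ?add0n // => b Qb.
by have := cl b a Qb Ua nQa; rewrite negb_or => /andP[_ /negPf->].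
Qed.

(* Deleting cheap vertices leaves a graph of minimum degree at least [k] for [edg],
   where a longest path closes up into a cycle spanning a component; such a component
   has at most [2 k] vertices, and satisfies the bound by counting. *)
Theorem arcs_le (U : {set V}) : arcs U <= \sum_(u in U) wgt u.
Proof.
have [m] := ubnP #|U|; elim: m U => // m IHm U; rewrite ltnS => leU.
have [/existsP[z /andP[Uz cheap]] | /existsPn dear] :=
    boolP [exists z, (z \in U) && (cost U z <= wgt z)].
  rewrite (arcsD1 Uz) (big_setD1 z Uz) /= addnC leq_add // IHm //.
  by move: leU; rewrite (cardsD1 z U) Uz.
have deg_ge z : z \in U -> k + (z \notin N) <= gdeg U z.
  move=> Uz; apply: gdeg_ge.
  by have := dear z; rewrite Uz /= -ltnNge.
have sU : U \subset N :|: S.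
  apply/subsetP=> z Uz; rewrite inE.
  have := dear z; rewrite Uz /= -ltnNge /cost.
  apply: contraTT; rewrite negb_or => /andP[/negPf nN /negPf nS].
  rewrite -leqNgt.
  have -> : \sum_(u in U) arc z u = 0 by rewrite big1 // => u _; rewrite /arc nS.
  have -> // : \sum_(u in U) arc u z = 0.
  by rewrite big1 // => u _; rewrite /arc nN andbF.
have [->|[z0 Uz0]] := set_0Vmem U.
  by rewrite /arcs !big_set0.
pose P p := [&& uniq p, sorted edg p & all (mem U) p].
have P1 : P [:: z0] by rewrite /P /= andbT.
have [|p Pp maxp] := longest_seq (P := P) _ P1; first by move=> p /and3P[].
case: p Pp maxp => [_ /(_ _ P1)//|x q].
case/and3P=> uq /= pq /andP[Ux Uq] maxp.
have Up z : z \in x :: q -> z \in U.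
  by rewrite inE => /orP[/eqP->//|]; move/allP: Uq; apply.
set y := last x q.
have yp : y \in x :: q by rewrite /y mem_last.
have le_sz := edg_trim pq uq.
have nbr_x u : u \in U -> edg x u -> u \in x :: q.
  move=> Uu exu; apply: contraT => nu.
  have /maxp : P (u :: x :: q).
    by rewrite /P cons_uniq nu uq /= edg_sym exu pq Uu Ux Uq.
  by rewrite /= ltnn.
have nbr_y u : u \in U -> edg y u -> u \in x :: q.
  move=> Uu eyu; apply: contraT => nu.
  have /maxp : P (rcons (x :: q) u).
    rewrite /P rcons_uniq nu uq [sorted _ _]/= rcons_path pq -/y eyu.
    by apply/allP=> z; rewrite mem_rcons in_cons => /orP[/eqP->|/Up].
  by rewrite /= size_rcons ltnn.
have degx : gdeg U x <= #|[set u in x :: q | edg x u]|.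
  apply/subset_leq_card/subsetP => u; rewrite !inE => /andP[Uu exu].
  by rewrite exu andbT -in_cons nbr_x.
have degy : gdeg U y <= #|[set u in x :: q | edg y u]|.
  apply/subset_leq_card/subsetP => u; rewrite !inE => /andP[Uu exu].
  by rewrite exu andbT -in_cons nbr_y.
have [|c pc cc] := crossing_cycle edg_sym edg_irr pq uq.
  have := deg_ge x Ux; have := deg_ge y (Up _ yp); rewrite -/y.
  move: le_sz degx degy; rewrite -/y; clear.
  by move: (x \notin N : nat) (y \notin N : nat) => /=; lia.
have szc : size c = size (x :: q) by rewrite (perm_size pc).
have uc : uniq c by rewrite (perm_uniq pc).
have mc : c =i x :: q by exact: perm_mem.
pose Q := [set z in c].
have Qc : Q =i c by move=> z; rewrite inE.
have sQU : Q \subset U by apply/subsetP=> z; rewrite inE mc; apply: Up.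
(* An edge leaving the cycle, opened at [a], would give a path longer than the longest one. *)
have clQ a b : a \in Q -> b \in U -> b \notin Q -> ~~ edg a b.
  rewrite !inE => ca Ub nb; apply/negP=> eab.
  case: (rot_to ca) => i c' rc.
  have cc' : cycle edg (a :: c') by rewrite -rc rot_cycle.
  have uc' : uniq (a :: c') by rewrite -rc rot_uniq.
  have mc' : a :: c' =i c by move=> z; rewrite -rc mem_rot.
  have /maxp : P (b :: a :: c').
    rewrite /P cons_uniq mc' nb uc' /= edg_sym eab Ub /=.
    move: cc'; rewrite /= rcons_path => /andP[-> _] /=.
    rewrite (subsetP sQU) ?inE //=.
    by apply/allP=> z zc; apply: Up; rewrite -mc -mc' ?mem_head // in_cons zc orbT.
  have szr : size (a :: c') = size (x :: q) by rewrite -szc -rc size_rot.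
  by move: szr => /= ->; rewrite ltnn.
have cycN a c' : uniq (a :: c') -> cycle edg (a :: c') -> a \notin N ->
    size c' <= 2 * k.
  move=> ua; rewrite /=; case: c' ua => [//|b c'] /= /andP[_ uc'].
  rewrite rcons_path => /and3P[eab pc' ela] aN.
  have bN := edg_NI eab aN.
  have lN : last b c' \in N by apply: (edg_NI _ aN); rewrite edg_sym.
  exact: (edg_short pc').
have le2k : size c <= 2 * k.
  (* A cycle longer than [2 k] has a vertex [w] outside [N]; without [w] it is a path with ends in
     [N], so that it has at most [2 k + 1] vertices. No two consecutive vertices lie in [N], since
     the spanning path between them would be too long. But [w] has [k + 1] neighbours, all in [N],
     which requires [2 k + 2] vertices. *)
  rewrite leqNgt; apply/negP=> lt2k.
  have [w cw wN] : exists2 w, w \in c & w \notin N.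
    have [xN|xN] := boolP (x \in N); last by exists x; rewrite // mc mem_head.
    have [yN|yN] := boolP (y \in N); last by exists y; rewrite // mc.
    by move: le_sz lt2k; rewrite szc -/y xN yN /=; clear; lia.
  have lt_sz : size c <= (2 * k).+1.
    case: (rot_to cw) => i c' rc.
    have := cycN w c'; rewrite -rc rot_uniq rot_cycle => /(_ uc cc wN).
    by rewrite -(size_rot i c) rc.
  have Uw : w \in U by apply: Up; rewrite -mc.
  have cN : k.+1 <= #|[set u in c | u \in N]|.
    apply: leq_trans (_ : gdeg U w <= _); first by have := deg_ge w Uw; rewrite wN addn1.
    apply/subset_leq_card/subsetP => u; rewrite !inE => /andP[Uu ewu].
    rewrite (edg_NI ewu wN) andbT; apply: contraT => nu.
    have := clQ w u; rewrite !inE cw => /(_ isT Uu nu).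
    by rewrite ewu.
  have nextN u : u \in c -> u \in N -> next c u \notin N.
    move=> cu uN; apply/negP=> nN.
    case: (rot_to cu) => i c' rc.
    have ur : uniq (u :: c') by rewrite -rc rot_uniq.
    have cr : cycle edg (u :: c') by rewrite -rc rot_cycle.
    have szr : size (u :: c') = size c by rewrite -rc size_rot.
    move: nN; rewrite -(next_rot i uc) rc.
    case: c' ur cr szr {rc} => [|b c'] ur cr szr; first by move: szr lt2k k_gt1 => /=; clear; lia.
    rewrite /= eqxx => bN.
    move: cr; rewrite /= rcons_path => /and3P[eub pb elu].
    move: ur => /= /andP[uNb ub].
    have pb' : path edg b (rcons c' u) by rewrite rcons_path pb elu.
    have ub' : uniq (b :: rcons c' u) by rewrite -rcons_cons rcons_uniq uNb.
    have := edg_short pb' ub' bN; rewrite last_rcons size_rcons => /(_ uN) lt.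
    by clear -lt szr lt2k; move: lt szr lt2k => /=; lia.
  have : #|[set u in c | u \in N]| <= #|[set u in c | u \notin N]|.
    have <- := card_imset [set u in c | u \in N] (can_inj (prev_next uc)).
    apply/subset_leq_card/subsetP => z /imsetP[u]; rewrite inE => /andP[cu uN] ->.
    by rewrite inE mem_next cu nextN.
  have : #|[set u in c | u \in N]| + #|[set u in c | u \notin N]| = size c.
    rewrite -(card_uniqP uc) -!sum1_card [RHS](bigID (mem N)) /=.
    by congr (_ + _); apply: eq_bigl => u; rewrite inE.
  by move: cN lt2k lt_sz; clear; lia.
have [eqU | neU] := eqVneq U Q.
  apply: (@small_cycle _ c) => // z; by rewrite eqU inE.
have Q0 : 0 < #|Q| by apply/card_gt0P; exists x; rewrite inE mc mem_head.
have ltQ : #|Q| < #|U| by apply: proper_card; rewrite properEneq eq_sym neU.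
have cardD := cardsID Q U; rewrite (setIidPr sQU) in cardD.
rewrite (arcs_closed sQU clQ) (big_setID Q) /= (setIidPr sQU) leq_add // IHm //.
  exact: leq_trans ltQ leU.
by move: cardD Q0 leU; clear; lia.
Qed.

End SetLemma.

Lemma split_first (T : eqType) (a : pred T) (s : seq T) : has a s ->
  exists s1 z s2, [/\ s = s1 ++ z :: s2, a z & ~~ has a s1].
Proof.
elim: s => //= y s IHs; case: (boolP (a y)) => [ay _ | nay /= has_s].
  by exists [::], y, s.
case: (IHs has_s) => s1 [z [s2 [-> az nh]]].
by exists (y :: s1), z, s2; rewrite /= (negPf nay).
Qed.

(** Either [c <= k.-1] or [a <= k], and one term on the right suffices in each case. The three
    numbers stand for the vertices of a short cycle in [N] only, in both sets, and in [S] only. *)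
Lemma small_count a b c k : a + b + c <= 2 * k ->
  c * a <= k.-1 * a + k * c.
Proof.
move=> le; have [lt|ge] := ltnP c k; first by apply: leq_trans (leq_addr _ _); rewrite leq_mul2r; apply/orP; right; lia.
apply: leq_trans (leq_addl _ _); rewrite mulnC leq_mul2r; apply/orP; right; lia.
Qed.

(** The additional [b] is the deficit of the lossless price on a cycle with exactly [2 k] vertices.
    It cannot be afforded for [c < 2], as the case [a = 0] shows. *)
Lemma small_count2 a b c k : a + b + c = 2 * k -> 1 < c -> 0 < k ->
  b + c * a <= k.-1 * a + k * c.
Proof.
move=> eq c2 k0; have [lt|ge] := ltnP c k.
  have : c * a <= k.-1 * a by rewrite leq_mul2r; apply/orP; right; lia.
  have : k * 2 <= k * c by rewrite leq_mul2l; apply/orP; right.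
  lia.
have h1 : (a + b) * (c - k.-1) <= k * c by apply: leq_mul; lia.
have h2 : b <= b * (c - k.-1) by apply: leq_pmulr; lia.
have h3 : c * a = k.-1 * a + a * (c - k.-1).
  by rewrite (mulnC a) -mulnDl subnKC //; lia.
have h4 : (a + b) * (c - k.-1) = a * (c - k.-1) + b * (c - k.-1) by rewrite mulnDl.
lia.
Qed.

Section Counting.
Variables (V : finType) (e : rel V).
Hypotheses (esym : symmetric e) (eirr : irreflexive e).
Variables (k beta : nat) (N S : {set V}).

(** The second term on the left is the diagonal: no vertex is adjacent to itself. *)
Lemma arcs_card (U : {set V}) :
  arcs e N S U + #|U :&: S :&: N| <= #|U :&: S| * #|U :&: N|.
Proof.
have -> : #|U :&: S :&: N| = \sum_(s in U) (s \in S) && (s \in N).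
  rewrite -sum1_card [RHS]big_mkcond [LHS]big_mkcond /=; apply: eq_bigr => s _.
  by rewrite !inE -andbA; case: (s \in U) => //=; case: (_ && _).
have -> : #|U :&: S| * #|U :&: N| = \sum_(s in U) \sum_(u in U) (s \in S) && (u \in N).
  rewrite -!sum1_card big_distrl /= big_mkcond [RHS]big_mkcond /=.
  apply: eq_bigr => s _; rewrite inE; case: (s \in U) => //=; case: (s \in S) => /=.
    rewrite mul1n big_mkcond [RHS]big_mkcond; apply: eq_bigr => u _.
    by rewrite inE; case: (u \in U) => //=; case: (u \in N).
  by rewrite big1.
rewrite -big_split /=; apply: leq_sum => s Us.
rewrite (big_setD1 s Us) /= [X in _ <= X](big_setD1 s Us) /= addnC addnA.
rewrite /arc eirr !andbF addn0 leq_add2l; apply: leq_sum => u _.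
by case: (_ \in S); case: (_ \in N); case: (e s u).
Qed.

Lemma wgt_card (U : {set V}) : U \subset N :|: S ->
  exists a c, let b := #|U :&: S :&: N| in
  [/\ a + b + c = #|U|, c = #|U :\: N|, #|U :&: N| = a + b, #|U :&: S| = b + c &
   \sum_(u in U) wgt k beta N S u = k.-1 * (a + b) + beta * b + k * c].
Proof.
move=> sU; set b := #|_ :&: N|.
pose a := #|U :&: N| - b; pose c := #|U :&: S| - b; exists a, c => /=.
have leb1 : b <= #|U :&: N|.
  by apply/subset_leq_card/subsetP => z; rewrite !inE => /andP[/andP[-> _] ->].
have leb2 : b <= #|U :&: S| by apply/subset_leq_card/subsetIl.
have UN : #|U :&: N| = a + b by rewrite subnK.
have US : #|U :&: S| = b + c by rewrite subnKC.
have cE : c = #|U :\: N|.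
  have <- : #|U :&: S :\: N| = c by rewrite cardsD.
  congr #|pred_of_set _|; apply/setP => z; rewrite !inE.
  case: (boolP (z \in U)) => [Uz | _]; last by rewrite !andbF.
  by have := subsetP sU z Uz; rewrite !inE; case: (z \in N).
split=> //; first by rewrite -UN cE cardsID.
have -> : \sum_(u in U) wgt k beta N S u =
   \sum_(u in U) ((u \in N) * k.-1 + (((u \in S) && (u \in N)) * beta + ((u \in S) && (u \notin N)) * k)).
  by apply: eq_bigr => u _; rewrite /wgt; case: (u \in N); case: (u \in S); rewrite /= ?mul1n ?mul0n ?addn0.
have sumE (P : pred V) (m : nat) (A : {set V}) :
    A =i [pred u | (u \in U) && P u] -> \sum_(u in U) P u * m = m * #|A|.
  move=> AE; rewrite -big_distrl /= mulnC; congr (_ * _).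
  rewrite -sum1_card big_mkcond [RHS]big_mkcond /=; apply: eq_bigr => u _.
  by rewrite AE inE; case: (u \in U) => //=; case: (P u).
rewrite !big_split /= (sumE _ _ (U :&: N)); last by move=> u; rewrite !inE.
rewrite (sumE _ _ (U :&: S :&: N)); last by move=> u; rewrite !inE andbA.
rewrite (sumE _ _ (U :\: N)); last first.
  move=> u; rewrite !inE andbC; case: (boolP (u \in U)) => //= Uu.
  by have := subsetP sU u Uu; rewrite !inE; case: (u \in N); case: (u \in S).
by rewrite UN -cE addnA.
Qed.

Lemma arcsT : arcs e N S setT = \sum_(s in S) \sum_(u in N) e s u.
Proof.
rewrite /arcs [RHS]big_mkcond [LHS]big_mkcond; apply: eq_bigr => s _; rewrite inE.
case: (boolP (s \in S)) => sS; last by rewrite big1 // => u _; rewrite /arc (negPf sS).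
rewrite [RHS]big_mkcond [LHS]big_mkcond; apply: eq_bigr => u _; rewrite inE /arc sS /=.
by case: (u \in N).
Qed.

Lemma wgtT : \sum_(u in setT) wgt k beta N S u =
  k.-1 * #|N| + beta * #|S :&: N| + k * #|S :\: N|.
Proof.
have [a [c [_ cE aE _ sE]]] := wgt_card (subxx (N :|: S)).
have bE : (N :|: S) :&: S :&: N = S :&: N.
  by apply/setP => z; rewrite !inE; case: (z \in N); case: (z \in S).
have nE : (N :|: S) :&: N = N.
  by apply/setP => z; rewrite !inE; case: (z \in N); case: (z \in S).
have dE : (N :|: S) :\: N = S :\: N.
  by apply/setP => z; rewrite !inE; case: (z \in N); case: (z \in S).
have -> : \sum_(u in [set: V]) wgt k beta N S u = \sum_(u in N :|: S) wgt k beta N S u.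
  rewrite big_mkcond [RHS]big_mkcond; apply: eq_bigr => u _; rewrite !inE /wgt.
  by case: (u \in N); case: (u \in S).
by rewrite sE -aE cE bE nE dE.
Qed.

End Counting.

(** * The lossy and the lossless count at a vertex *)

Section Graph.
Variables (V : finType) (e : rel V).
Hypotheses (esym : symmetric e) (eirr : irreflexive e).
Variable (k : nat).
Hypothesis k_gt1 : 1 < k.
Hypothesis circ : forall c, uniq c -> cycle e c -> 2 < size c -> size c <= 2 * k + 1.

Definition nb x := [set u | e x u].

Lemma short_between v x q : path e x q -> uniq (x :: q) -> v \notin x :: q ->
  e v x -> e v (last x q) -> size q < 2 * k.
Proof.
move=> pq uq nv evx evl; rewrite ltnNge; apply/negP=> le.
have := circ (c := v :: x :: q); rewrite cons_uniq nv uq /= rcons_path evx pq /= esym evl.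
by move=> /(_ isT isT); lia.
Qed.

(** A cycle on [U] carries at most [c' * a + b * (#|U| - 1)] arcs. As [#|U| <= 2 * k], the price
    [k.-1 + k] of an element of both sets covers the second term, and [small_count] the first. *)
Lemma arcs_lossy v (N S : {set V}) : N \subset nb v -> v \notin S ->
  \sum_(s in S) \sum_(u in N) e s u <= k.-1 * #|N| + k * #|S|.
Proof.
move=> sN vS; rewrite -arcsT.
have sNM : N \subset [set~ v].
  by apply/subsetP=> u /(subsetP sN); rewrite !inE; apply: contraTneq => ->; rewrite eirr.
have sSM : S \subset [set~ v] by apply/subsetP=> u Su; rewrite !inE; apply: contraNneq vS => <-.
have := @arcs_le V e esym eirr k k _ N S k_gt1 (leq_pred k) sNM sSM _ _ setT.
rewrite wgtT -addnA -mulnDr cardsID; apply.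
  move=> x q pq uq sM xN lN; apply: (@short_between v x) => //.
  - by apply/negP=> /sM; rewrite !inE eqxx.
  - by move/(subsetP sN): xN; rewrite inE.
  - by move/(subsetP sN): lN; rewrite inE.
move=> U c uc _ Uc le2k sU.
have [a [c' [e1 _ e2 e3 ->]]] := wgt_card k k sU.
have := arcs_card eirr N S U.
rewrite e2 e3; move: e1; set b := #|_ :&: N| => e1 le.
have cU : #|U| <= 2 * k by rewrite (eq_card Uc) (card_uniqP uc).
have := @small_count a b c' k; rewrite e1 => /(_ cU) sc.
have : b * #|U| <= b * (2 * k) by rewrite leq_mul2l cU orbT.
rewrite -e1; clear -sc le k_gt1; case: k k_gt1 sc le => // k' _ /=; nia.
Qed.

Definition econ v : rel V := fun a b => [&& e a b, a != v & b != v].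

(* Large components spare the neighbours of [v] in [S] one unit each, compared with
   [arcs_lossy]. *)
Lemma arcs_lossless v (N S : {set V}) : N \subset nb v -> v \notin S ->
    (forall u, u \in N :|: S -> 2 * k < #|[set z in N | connect (econ v) u z]|) ->
  \sum_(s in S) \sum_(u in N) e s u
    <= k.-1 * #|N| + k.-1 * #|S :&: N| + k * #|S :\: N|.
Proof.
move=> sN vS big; rewrite -arcsT.
have sNM : N \subset [set~ v].
  by apply/subsetP=> u /(subsetP sN); rewrite !inE; apply: contraTneq => ->; rewrite eirr.
have sSM : S \subset [set~ v] by apply/subsetP=> u Su; rewrite !inE; apply: contraNneq vS => <-.
have shortN x q : path e x q -> uniq (x :: q) -> v \notin x :: q ->
    x \in N -> last x q \in N -> size q < 2 * k.
  move=> pq uq nv xN lN; apply: (@short_between v x) => //.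
  - by move/(subsetP sN): xN; rewrite inE.
  - by move/(subsetP sN): lN; rewrite inE.
have := @arcs_le V e esym eirr k k.-1 _ N S k_gt1 (leqnn _) sNM sSM _ _ setT.
rewrite wgtT; apply.
  move=> x q pq uq sM xN lN; apply: (shortN x) => //.
  by apply/negP=> /sM; rewrite !inE eqxx.
move=> U c uc cc Uc le2k sU.
have [a [c' [e1 cE e2 e3 ->]]] := wgt_card k k.-1 sU.
have := arcs_card eirr N S U.
rewrite e2 e3; move: e1; set b := #|_ :&: N| => e1 le.
have cU : #|U| <= 2 * k by rewrite (eq_card Uc) (card_uniqP uc).
have := @small_count a b c' k; rewrite e1 => /(_ cU) sc.
have [lt|ge] := ltnP #|U| (2 * k).
  have : b * #|U| <= b * (2 * k).-1 by rewrite leq_mul2l; apply/orP; right; move: lt; clear; lia.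
  rewrite -e1; clear -sc le k_gt1; case: k k_gt1 sc le => // k' _ /=; nia.
have eU : #|U| = 2 * k by apply/eqP; rewrite eqn_leq cU.
(* With exactly [2 k] vertices, one unit per element of [N :&: S] is missing; [small_count2]
   recovers it if two vertices of the cycle lie outside [N]. *)
suff c2 : 1 < c'.
  have := @small_count2 a b c' k; rewrite e1 eU => /(_ erefl c2 (ltnW k_gt1)) sc2.
  have : b * #|U| = b * (2 * k) by rewrite eU.
  rewrite -e1; clear -sc2 le k_gt1; case: k k_gt1 sc2 le => // k' _ /=; nia.
have szc : size c = 2 * k by rewrite -eU (eq_card Uc) (card_uniqP uc).
have [u0 cu0] : exists u0, u0 \in c by case: (c) szc k_gt1 => [|u0 ? ? ?] /=; [lia | exists u0; rewrite mem_head].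
have Uu0 : u0 \in U by rewrite Uc.
have vU : v \notin U.
  by apply/negP=> /(subsetP sU); rewrite inE => /orP[/(subsetP sNM)|/(subsetP sSM)]; rewrite !inE eqxx.
(* By [big], some [z] in [N] off the cycle is connected to it without [v]; let [y] be the first
   vertex of the cycle on a path from [z]. Going on around the cycle, in either direction, ends at a
   cyclic neighbour of [y]; it is not in [N], as the path from [z] has at least [2 k] edges. These
   two neighbours are the vertices sought. *)
have [z] : exists z, z \in [set z in N | connect (econ v) u0 z] :\: U.
  apply/set0Pn; rewrite -card_gt0 cardsD subn_gt0.
  apply: leq_ltn_trans (big u0 (subsetP sU _ Uu0)).
  by rewrite -eU; apply/subset_leq_card/subsetIr.
rewrite !inE => /and3P[zU zN].
have csym : connect_sym (econ v).
  by apply: sym_connect_sym => x y; rewrite /econ esym [(x != v) && _]andbC.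
rewrite csym => /connectP[p0 pp0 lp0].
case/shortenP: pp0 lp0 => p pp up _ lp.
have hasU : has (mem U) p.
  apply/hasP; exists u0 => //; rewrite lp; move: (mem_last z p); rewrite inE.
  by case/orP=> // /eqP lz; move: zU; rewrite -lz -lp Uu0.
have [p1 [y [p2 [pE Uy nh]]]] := split_first hasU.
move: pp; rewrite pE cat_path => /andP[pp1 /= /andP[ey _]].
have up1 : uniq (z :: p1) by move: up; rewrite pE -cat_cons cat_uniq => /and3P[].
have pe1 : path e z p1 by apply: sub_path pp1 => ? ? /and3P[].
have vp1 : v \notin z :: p1.
  rewrite inE negb_or; apply/andP; split.
    by apply: contraTneq zN => <-; apply/negP=> /(subsetP sNM); rewrite !inE eqxx.
  apply/negP; elim: (p1) (z) pp1 => //= w p' IHp z' /andP[/and3P[_ _ wv] pw].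
  by rewrite inE eq_sym (negPf wv) /=; apply: IHp pw.
have nU w : w \in z :: p1 -> w \notin U.
  rewrite inE => /orP[/eqP-> // | wp]; apply/negP=> Uw.
  by move/hasPn: nh => /(_ w wp); rewrite /= Uw.
have ezy : e (last z p1) y by case/and3P: ey.
have cey : cycle e c.
  by apply: sub_cycle cc => ? ?; case/orP=> /and3P[_ _] //; rewrite esym.
have go d : cycle e (y :: d) -> uniq (y :: d) -> y :: d =i c -> size d = (2 * k).-1 ->
    last y d \notin N.
  move=> cd ud dc sd; apply/negP=> lN.
  have pd : path e z (p1 ++ y :: d).
    rewrite cat_path pe1 /= ezy.
    by move: cd; rewrite /= rcons_path => /andP[-> _].
  have u' : uniq (z :: p1 ++ y :: d).
    rewrite -cat_cons cat_uniq up1 ud andbT.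
    by apply/hasP=> -[w]; rewrite dc -Uc => Uw /nU; rewrite Uw.
  have v' : v \notin z :: p1 ++ y :: d.
    by rewrite -cat_cons mem_cat (negPf vp1) dc -Uc (negPf vU).
  have := shortN z _ pd u' v' zN; rewrite last_cat => /(_ lN).
  by rewrite size_cat /= sd; move: k_gt1; clear; lia.
have cy : y \in c by rewrite -Uc.
have [i d rd] := rot_to cy.
have ud : uniq (y :: d) by rewrite -rd rot_uniq.
have cd : cycle e (y :: d) by rewrite -rd rot_cycle.
have dc : y :: d =i c by move=> w; rewrite -rd mem_rot.
have sd : size d = (2 * k).-1 by have := size_rot i c; rewrite rd szc => <-.
have l1 := go d cd ud dc sd.
have l2 : last y (rev d) \notin N.
  apply: go; rewrite ?size_rev //.
  - rewrite -[y :: rev d]/(y :: rev d) -(rot_cycle 1) rot1_cons -rev_cons rev_cycle.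
    by rewrite (eq_cycle (e' := e)) // => ? ?; rewrite esym.
  - by rewrite /= mem_rev rev_uniq.
  - by move=> w; rewrite inE mem_rev -in_cons dc.
rewrite cE; apply/card_gt1P; exists (last y d), (last y (rev d)).
have lastin w : w \in d -> w \in U by move=> wd; rewrite Uc -dc inE wd orbT.
case: d {rd cd go lp} sd ud dc l1 l2 lastin => [|w1 d]; first by move: k_gt1; clear => /=; lia.
case/lastP: d => [|d w2]; first by move: k_gt1; clear => /=; lia.
move=> sd ud dc; rewrite rev_cons rev_rcons /= !last_rcons => l1 l2 lastin.
rewrite !inE l1 l2 !lastin ?mem_head ?inE ?mem_rcons ?mem_head ?orbT //.
split=> //; move: ud => /= /and3P[_ + _]; rewrite mem_rcons inE negb_or eq_sym.
by case/andP.
Qed.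

End Graph.

(** * Cycles through hubs *)

Section Cycles.
Variables (V : finType) (e : rel V).
Hypotheses (esym : symmetric e) (eirr : irreflexive e).
Notation nb := (nb e).

(** All neighbours of the first vertex of a longest path lie on the path, and the last of them
    closes a cycle through all of them. *)
Lemma min_degree_cycle (U : {set V}) d : 1 < d -> U != set0 ->
    (forall u, u \in U -> d <= #|nb u :&: U|) ->
  exists c, [/\ uniq c, cycle e c & d < size c].
Proof.
move=> d1 /set0Pn[z0 Uz0] deg.
pose P p := [&& uniq p, sorted e p & all (mem U) p].
have P1 : P [:: z0] by rewrite /P /= andbT.
have [|p Pp maxp] := longest_seq (P := P) _ P1; first by move=> p /and3P[].
case: p Pp maxp => [_ /(_ _ P1)//|x q].
case/and3P=> uq /= pq /andP[Ux Uq] maxp.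
have nbq u : u \in nb x :&: U -> u \in q.
  rewrite !inE => /andP[exu Uu]; apply: contraT => nu.
  have ux : u != x by apply: contraTneq exu => ->; rewrite eirr.
  have /maxp : P (u :: x :: q).
    by rewrite /P cons_uniq inE negb_or ux nu uq /= esym exu pq Uu Ux Uq.
  by rewrite /= ltnn.
have hasq : has (e x) q.
  have : 0 < #|nb x :&: U| by apply: leq_trans (deg x Ux); exact: ltnW.
  by case/card_gt0P=> u Hu; apply/hasP; exists u; [exact: nbq|move: Hu; rewrite !inE => /andP[]].
have [q1 [z [q2 [qE exz nh]]]] := split_last hasq.
move: pq uq; rewrite qE cat_path -cat_cons => /andP[pq1 /= /andP[elz _]].
rewrite -[_ && _]/(uniq (x :: q1 ++ z :: q2)) -cat_cons -cat_rcons cat_uniq => /andP[u1 _].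
exists (x :: rcons q1 z); split=> //.
  by rewrite /= rcons_path rcons_path pq1 elz last_rcons esym exz.
rewrite /= size_rcons ltnS; apply: leq_trans (deg x Ux) _.
have -> : (size q1).+1 = size (rcons q1 z) by rewrite size_rcons.
apply: leq_trans (card_size (rcons q1 z)); apply/subset_leq_card/subsetP => u Hu.
have := nbq u Hu; rewrite qE mem_cat mem_rcons !inE.
case/or3P=> [->|->|uq2]; rewrite ?orbT //.
by move/hasPn: nh => /(_ u uq2); move: Hu; rewrite !inE => /andP[->].
Qed.

(** By [min_degree_cycle] each larger set contains a vertex of degree at most [D], whose deletion
    lowers the degree sum by at most [2 D]. The term [D * D.+1] comes from stopping at [D]
    vertices. *)
Lemma degenerate_count (D : nat) (U : {set V}) :
    (forall c, uniq c -> cycle e c -> 2 < size c -> size c <= D.+1) ->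
    0 < D -> D <= #|U| ->
  \sum_(u in U) #|nb u :&: U| + D * D.+1 <= 2 * D * #|U|.
Proof.
move=> circ D0; have [m] := ubnP #|U|; elim: m U => // m IHm U; rewrite ltnS => leU.
rewrite leq_eqVlt => /orP[/eqP eD | ltD].
  have : \sum_(u in U) #|nb u :&: U| <= \sum_(u in U) D.-1.
    apply: leq_sum => u Uu.
    have : #|nb u :&: U| <= #|U :\ u|.
      apply/subset_leq_card/subsetP => w; rewrite !inE => /andP[euw ->]; rewrite andbT.
      by apply: contraTneq euw => ->; rewrite eirr.
    by rewrite (cardsD1 u U) Uu in eD; rewrite eD.
  by rewrite sum_nat_const -eD; case: (D) D0 => // d _ /=; nia.
have [/forallP dense | ] := boolP [forall u, (u \in U) ==> (D < #|nb u :&: U|)].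
  have [||c [uc cc lt]] := @min_degree_cycle U D.+1 D0.
  - by rewrite -card_gt0; apply: leq_ltn_trans ltD.
  - by move=> u Uu; have := dense u; rewrite Uu.
  have : size c <= D.+1 by apply: circ => //; apply: leq_ltn_trans lt.
  by rewrite leqNgt lt.
rewrite negb_forall => /existsP[z]; rewrite negb_imply -leqNgt => /andP[Uz lez].
have cU : #|U| = #|U :\ z|.+1 by rewrite (cardsD1 z U) Uz.
have := IHm (U :\ z); rewrite -cU => /(_ leU); rewrite -ltnS -cU => /(_ ltD) IH.
have nbE u : #|nb u :&: U| = e u z + #|nb u :&: (U :\ z)|.
  rewrite (cardsD1 z) !inE Uz andbT; congr (_ + #|pred_of_set _|).
  by apply/setP=> w; rewrite !inE; case: (w == z); rewrite ?andbF.
rewrite (big_setD1 z Uz) /=.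
under eq_bigr => u _ do rewrite nbE.
rewrite big_split /=.
have -> : \sum_(u in U :\ z) (e u z : nat) = #|nb z :&: U|.
  rewrite nbE eirr add0n -sum1_card big_mkcond [RHS]big_mkcond; apply: eq_bigr => u _.
  by rewrite !inE esym; case: (u == z); case: (u \in U); case: (e z u).
rewrite cU mulnS; move: lez IH; clear; lia.
Qed.

Variables (m : nat) (L : {set V}).
Hypothesis common : forall h h', h \in L -> h' \in L -> h != h' -> m <= #|nb h :&: nb h'|.

(** Neither [h] nor [h'] is a common neighbour of the two, so that only [#|L| - 2] hubs have to be
    avoided. *)
Lemma connector h h' (B : {set V}) : h \in L -> h' \in L -> h != h' ->
  #|L| + #|B| <= m.+1 -> exists c, [/\ e h c, e h' c & c \notin L :|: B].
Proof.
move=> Lh Lh' hh' le.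
have [c] : exists c, c \in (nb h :&: nb h') :\: (L :\ h :\ h' :|: B).
  apply/set0Pn; rewrite -card_gt0 cardsD subn_gt0.
  apply: leq_trans (common Lh Lh' hh').
  have c1 : #|(L :\ h :\ h') :|: B| <= #|L :\ h :\ h'| + #|B| by rewrite cardsU leq_subr.
  have c2 : #|L| = #|L :\ h :\ h'|.+2.
    by rewrite (cardsD1 h) Lh (cardsD1 h' (L :\ h)) !inE eq_sym hh' Lh'.
  have c3 : #|nb h :&: nb h' :&: (L :\ h :\ h' :|: B)| <= #|L :\ h :\ h' :|: B|.
    exact/subset_leq_card/subsetIr.
  by move: c1 c2 c3 le; clear; lia.
rewrite !inE => /andP[nc /andP[ehc eh'c]]; exists c; split=> //.
move: nc; rewrite !inE !negb_or !negb_and !negbK => /andP[+ ->]; rewrite andbT.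
case/or3P=> [/eqP cE|/eqP cE|//]; first by rewrite cE eirr in eh'c.
by rewrite cE eirr in ehc.
Qed.

(** Hubs alternate with connectors, collected in [C]. The set [B] reserves vertices for the rest of
    a future cycle. *)
Lemma hub_path h hs (B : {set V}) : uniq (h :: hs) -> {subset h :: hs <= L} ->
    #|L| + #|B| + size hs <= m.+2 ->
  exists p (C : {set V}), [/\ path e h p /\ uniq (h :: p), last h p = last h hs /\
    size p = (size hs).*2, #|C| <= size hs, [disjoint C & L :|: B] &
    forall z, z \in h :: p -> z \in h :: hs \/ z \in C].
Proof.
elim: hs h => [|h2 hs IHhs] h uhs sL le.
  exists [::], set0; split=> //; rewrite ?cards0 ?disjoints0 //.
    by rewrite disjoint_sym disjoints_subset setC0 subsetT.
  by move=> z; left.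
have [|||p [C [[pp up] [lp sp] cC dC inp]]] := IHhs h2.
- by move: uhs => /= /andP[].
- by move=> z zhs; apply: sL; rewrite inE zhs orbT.
- by apply: leq_trans le; rewrite leq_add2l.
have Lh : h \in L by apply: sL; rewrite mem_head.
have Lh2 : h2 \in L by apply: sL; rewrite !inE eqxx orbT.
have hh2 : h != h2 by move: uhs => /= /andP[]; rewrite inE negb_or => /andP[].
have [|c [ehc eh2c nc]] := @connector h h2 (B :|: C) Lh Lh2 hh2.
  have : #|B :|: C| <= #|B| + #|C| by rewrite cardsU leq_subr.
  by move: cC le => /=; clear; lia.
move: nc; rewrite !inE !negb_or => /and3P[ncL ncB ncC].
have dCL z : z \in C -> z \notin L.
  by move=> Cz; have := disjointFr dC Cz; rewrite inE => /norP[].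
exists (c :: h2 :: p), (c |: C); split=> //=.
- rewrite ehc esym eh2c pp; split=> //.
  have nh : h \notin h2 :: p.
    apply/negP=> /inp[hin|Ch]; first by move: uhs => /= /andP[]; rewrite hin.
    by move: (dCL h Ch); rewrite Lh.
  have ncp : c \notin h2 :: p.
    apply/negP=> /inp[hin|Ch]; last by rewrite Ch in ncC.
    by move: ncL; rewrite sL // inE hin orbT.
  have hc : h != c by apply: contraNneq ncL => <-.
  by rewrite inE negb_or hc nh ncp; move: up.
- by rewrite sp doubleS.
- by rewrite cardsU1 ncC add1n ltnS.
- rewrite disjoints_subset; apply/subsetP=> z; rewrite !inE => /orP[/eqP->|Cz].
    by rewrite negb_or ncL.
  by have := disjointFr dC Cz; rewrite inE => ->.
- move=> z; rewrite inE => /orP[/eqP->|]; first by left; rewrite mem_head.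
  rewrite inE => /orP[/eqP->|zp]; first by right; rewrite !inE eqxx.
  case: (inp z zp) => [zh|zC]; last by right; rewrite !inE zC orbT.
  by left; rewrite inE zh orbT.
Qed.

Lemma hub_list h h' : h \in L -> h' \in L -> h != h' ->
  exists hs, [/\ uniq (h :: hs), {subset h :: hs <= L}, size hs = #|L|.-1 & last h hs = h'].
Proof.
move=> Lh Lh' hh'; exists (rcons (enum (L :\ h :\ h')) h').
rewrite last_rcons size_rcons -cardE -rcons_cons rcons_uniq cons_uniq enum_uniq.
rewrite inE !mem_enum !inE !eqxx /= orbF andbF !andbT eq_sym hh'; split=> //.
- move=> z; rewrite !inE mem_rcons inE mem_enum !inE.
  by case/or3P=> [/eqP->|/eqP->|/and3P[]].
- by rewrite [in RHS](cardsD1 h) Lh (cardsD1 h' (L :\ h)) !inE eq_sym hh' Lh'.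
Qed.

(** The length is made up of [#|L|] hubs, [#|L| - 1] connectors and the [size s + 1] vertices of the
    segment. *)
Lemma hub_segment_cycle h h' x s : h \in L -> h' \in L -> h != h' ->
    path e x s -> uniq (x :: s) -> (forall z, z \in x :: s -> z \notin L) ->
    e h' x -> e (last x s) h -> 2 * #|L| + size s <= m.+2 ->
  exists c, [/\ uniq c, cycle e c & size c = 2 * #|L| + size s].
Proof.
move=> Lh Lh' hh' ps us nL ehx ehl le.
have [hs [uhs sL szhs lhs]] := hub_list Lh Lh' hh'.
have L0 : 0 < #|L| by apply/card_gt0P; exists h.
have [|p [C [[pp up] [lp sp] cC dC inp]]] := @hub_path h hs [set z in x :: s] uhs sL.
  rewrite szhs cardsE (card_uniqP us) /=; move: le L0; clear; lia.
exists ((h :: p) ++ x :: s); split.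
- rewrite cat_uniq up us andbT; apply/hasP=> -[z zs /inp[zh|zC]].
    by move: (nL z zs); rewrite sL.
  by have := disjointFr dC zC; rewrite !inE -in_cons zs orbT.
- rewrite /= rcons_cat cat_path pp /= rcons_path ps ehl lp lhs ehx //.
- by rewrite size_cat /= sp szhs; move: L0; clear; lia.
Qed.

Lemma hub_cycle : 1 < #|L| -> 2 * #|L| <= m.+2 ->
  exists c, [/\ uniq c, cycle e c & size c = 2 * #|L|].
Proof.
move=> L1 le; have [h [h' [Lh Lh' hh']]] := card_gt1P L1.
have [hs [uhs sL szhs lhs]] := hub_list Lh Lh' hh'.
have L0 : 0 < #|L| by apply/card_gt0P; exists h.
have [|p [C [[pp up] [lp sp] cC dC inp]]] := @hub_path h hs set0 uhs sL.
  rewrite szhs cards0; move: le L0; clear; lia.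
have [|c [ehc eh'c nc]] := @connector h h' C Lh Lh' hh'.
  by move: cC le L0; rewrite szhs; clear; lia.
exists (c :: h :: p); split.
- rewrite cons_uniq up andbT; apply/negP=> /inp[ch|cC'].
    by move: nc; rewrite inE sL.
  by move: nc; rewrite inE cC' orbT.
- by rewrite /= rcons_path esym ehc pp lp lhs.
- by rewrite /= sp szhs; move: L0; clear; lia.
Qed.

(* The hub [h1] alone separates the two edges on one side. *)
Lemma hub_two_edges_cycle t t' s s' : 1 < #|L| ->
    uniq [:: t; t'; s; s'] -> (forall z, z \in [:: t; t'; s; s'] -> z \notin L) ->
    (forall h z, h \in L -> z \in [:: t; t'; s; s'] -> e h z) ->
    e t t' -> e s s' -> 2 * #|L| + 2 <= m.+2 ->
  exists c, [/\ uniq c, cycle e c & size c = 2 * #|L| + 2].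
Proof.
move=> L1 u4 n4 e4 ett ess le; have [h1 [h2 [Lh1 Lh2 h12]]] := card_gt1P L1.
pose hs := enum (L :\ h1 :\ h2).
have uhs : uniq (h2 :: hs) by rewrite /= enum_uniq mem_enum !inE eqxx.
have sL : {subset h2 :: hs <= L}.
  by move=> z; rewrite inE mem_enum !inE => /orP[/eqP->|/and3P[]].
have nh1 : h1 \notin h2 :: hs by rewrite inE mem_enum !inE eqxx andbF orbF.
have szhs : (size hs).+2 = #|L|.
  by rewrite -cardE (cardsD1 h1 L) Lh1 (cardsD1 h2 (L :\ h1)) !inE eq_sym h12 Lh2.
have [|p [C [[pp up] [lp sp] cC dC inp]]] := @hub_path h2 hs [set z in [:: t; t'; s; s']] uhs sL.
  rewrite cardsE (card_uniqP u4) /=; move: le szhs; clear; lia.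
exists ([:: h1; t; t'] ++ (h2 :: p) ++ [:: s; s']).
have inpL z : z \in h2 :: p -> z \in [:: t; t'; s; s'] -> False.
  move=> /inp[zh z4|zC z4]; first by move: (n4 z z4); rewrite sL.
  by have := disjointFr dC zC; rewrite inE [_ \in [set _ in _]]inE z4 orbT.
have lL : last h2 p \in L by rewrite lp sL // mem_last.
split.
- have h1p : h1 \notin h2 :: p.
    apply/negP=> /inp[h1h|h1C]; first by rewrite h1h in nh1.
    by have := disjointFr dC h1C; rewrite inE Lh1.
  have h14 z : z \in [:: t; t'; s; s'] -> h1 != z.
    by move=> z4; apply: contraTneq Lh1 => ->; apply: n4.
  have in12 z : z \in [:: t; t'] -> z \in [:: t; t'; s; s'].
    by rewrite -[[:: t; _; _; _]]/([:: t; t'] ++ [:: s; s']) mem_cat => ->.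
  have in34 z : z \in [:: s; s'] -> z \in [:: t; t'; s; s'].
    by rewrite -[[:: t; _; _; _]]/([:: t; t'] ++ [:: s; s']) mem_cat orbC => ->.
  move: u4; rewrite -[[:: t; _; _; _]]/([:: t; t'] ++ [:: s; s']) cat_uniq.
  case/and3P=> u12 d1234 u34.
  rewrite cat_uniq; apply/and3P; split.
  + rewrite cons_uniq u12 andbT; apply/negP=> h1t.
    by have := h14 h1 (in12 _ h1t); rewrite eqxx.
  + apply/hasP=> -[z]; rewrite mem_cat inE => zin /orP[/eqP zE|z12].
      move: zin; rewrite zE (negPf h1p) /= => h1s.
      by have := h14 h1 (in34 _ h1s); rewrite eqxx.
    case/orP: zin => [zp|z34]; first exact: inpL zp (in12 _ z12).
    by move/hasPn: d1234 => /(_ z z34) /negP.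
  + rewrite cat_uniq up u34 andbT; apply/hasP=> -[z z34 zp].
    exact: inpL zp (in34 _ z34).
- have m4 : [/\ t \in [:: t; t'; s; s'], t' \in [:: t; t'; s; s'],
      s \in [:: t; t'; s; s'] & s' \in [:: t; t'; s; s']].
    by rewrite !inE !eqxx !orbT.
  case: m4 => m1 m2 m3 m4'.
  rewrite /= rcons_cat cat_path pp /= ett ess (e4 h1 t) // (e4 _ s) //.
  by rewrite (esym t') (esym s') !e4.
- by rewrite /= size_cat sp /=; move: szhs; clear; lia.
Qed.

End Cycles.

Local Open Scope ring_scope.

(** * Perron vectors *)

Section QuadraticForm.
Variables (R : realFieldType) (V : finType) (e : rel V).
Hypothesis esym : symmetric e.

Definition nsum (z : V -> R) u := \sum_(w | e u w) z w.
Definition qform (z : V -> R) := \sum_u z u * nsum z u.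
Definition sqn (z : V -> R) := \sum_u z u ^+ 2.

Lemma nsum_exchange (y z : V -> R) : \sum_u y u * nsum z u = \sum_u z u * nsum y u.
Proof.
rewrite /nsum; under eq_bigr do rewrite big_mkcond big_distrr /=.
rewrite exchange_big /=; apply: eq_bigr => u _.
rewrite [in RHS]big_mkcond big_distrr /=; apply: eq_bigr => w _.
by rewrite esym; case: (e u w); rewrite ?mulr0 // mulrC.
Qed.

Lemma sqn_ge0 z : 0 <= sqn z.
Proof. by apply: sumr_ge0 => u _; exact: sqr_ge0. Qed.

Lemma sqn_eq0 z : sqn z = 0 -> forall u, z u = 0.
Proof.
move=> /eqP; rewrite psumr_eq0 => [/allP z0 u|u _]; last exact: sqr_ge0.
by have := z0 u (mem_index_enum u); rewrite sqrf_eq0 => /eqP.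
Qed.

Lemma qform_abs z : qform z <= qform (fun u => `|z u|).
Proof.
apply: ler_sum => u _; apply: le_trans (ler_norm _) _.
rewrite normrM ler_wpM2l //; exact: ler_norm_sum.
Qed.

Lemma sqn_abs z : sqn (fun u => `|z u|) = sqn z.
Proof. by apply: eq_bigr => u _; rewrite real_normK // num_real. Qed.

Lemma qform_line (y r : V -> R) t :
  qform (fun u => y u + t * r u) =
  qform y + 2 * t * (\sum_u r u * nsum y u) + t ^+ 2 * qform r.
Proof.
have nE u : nsum (fun u => y u + t * r u) u = nsum y u + t * nsum r u.
  by rewrite /nsum big_split /= -big_distrr.
rewrite /qform; under eq_bigr do rewrite nE.
transitivity (\sum_u (y u * nsum y u) + t * \sum_u r u * nsum y u
   + t * \sum_u y u * nsum r u + t ^+ 2 * \sum_u r u * nsum r u).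
  by rewrite !big_distrr -!big_split /=; apply: eq_bigr => u _; ring.
by rewrite (nsum_exchange y r); ring.
Qed.

Lemma sqn_line (y r : V -> R) t :
  sqn (fun u => y u + t * r u) = sqn y + 2 * t * (\sum_u r u * y u) + t ^+ 2 * sqn r.
Proof. by rewrite /sqn !big_distrr -!big_split /=; apply: eq_bigr => u _; ring. Qed.

(** First variation in the direction of the residual [r]: comparing [y + t * r] with [y] gives
    [2 * sqn r <= t * C] for every [t > 0]. The choice [t = sqn r / (C + 1)] contradicts this unless
    [r] vanishes. *)
Lemma qform_max_eigen rho (y : V -> R) : (forall z, qform z <= rho * sqn z) ->
  qform y = rho * sqn y -> forall u, nsum y u = rho * y u.
Proof.
move=> maxq eqy.
pose r u := nsum y u - rho * y u.
suff r0 : sqn r = 0 by move=> u; apply/eqP; rewrite -subr_eq0; apply/eqP/(sqn_eq0 r0).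
pose C := rho * sqn r - qform r.
have key t : 0 < t -> 2 * sqn r <= t * C.
  move=> t0; have := maxq (fun u => y u + t * r u).
  rewrite qform_line sqn_line eqy => le.
  have -> : sqn r = \sum_u r u * nsum y u - rho * \sum_u r u * y u.
    rewrite /sqn big_distrr -sumrB; apply: eq_bigr => u _.
    by rewrite /r /=; ring.
  rewrite -(ler_pM2l t0) /C; move: le.
  set a := \sum_u r u * nsum y u; set b := \sum_u r u * y u; lra.
have s0 := sqn_ge0 r.
have C0 : 0 <= C by have := key 1 ltr01; lra.
have C1 : 0 < C + 1 by lra.
apply/eqP; rewrite eq_le s0 andbT leNgt; apply/negP=> sp.
have := key (sqn r / (C + 1)) (divr_gt0 sp C1).
have -> : (sqn r / (C + 1) * C) = sqn r * (C / (C + 1)) by ring.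
have : C / (C + 1) <= 1 by rewrite ler_pdivrMr // mul1r; lra.
have : 0 <= C / (C + 1) by rewrite divr_ge0 // ltW.
move: (C / (C + 1)) => q; nra.
Qed.

End QuadraticForm.

Section Perron.
Variables (R : realType) (V : finType) (e : rel V).
Hypothesis esym : symmetric e.

(* A maximiser of the quadratic form on the unit sphere, made nonnegative. *)
Lemma perron : (0 < #|V|)%N -> exists rho (y : V -> R),
  [/\ forall u, 0 <= y u, exists u, y u != 0,
      forall u, nsum e y u = rho * y u & forall z, qform e z <= rho * sqn z].
Proof.
move=> V0.
pose z (M : 'rV[R]_#|V|) : V -> R := fun u => M ord0 (enum_rank u).
pose f M := qform e (z M).
pose A := [set M | sqn (z M) = 1]%classic.
have cz u : continuous (fun M => z M u) by exact: coord_continuous.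
have csum (P : pred V) (F : V -> 'rV[R]_#|V| -> R) : (forall u, P u -> continuous (F u)) ->
    continuous (fun M => \sum_(u | P u) F u M).
  by move=> cF; apply: continuous_big => //; exact: add_continuous.
have cf : continuous f.
  apply: (@csum _ _) => u _ M; apply: continuousM; first exact: cz.
  by apply: (@csum _ _) => w _; exact: cz.
have cA : compact A.
  apply: bounded_closed_compact.
    exists 1; split; first exact: num_real.
    move=> c c1 M AM; apply: le_trans (ltW c1).
    rewrite [leLHS]/Num.norm /= mx_normrE; apply: bigmax_le => // -[i j] _ /=.
    rewrite -(@ler_pXn2r _ 2) ?nnegrE // expr1n real_normK ?num_real // -AM.
    rewrite /sqn (bigD1 (enum_val j)) //= /z enum_valK ord1 lerDl.
    by apply: sumr_ge0 => u _; exact: sqr_ge0.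
  have -> : A = ((fun M => sqn (z M)) @^-1` [set 1])%classic by [].
  apply: preimage_closed; last exact: closed_eq.
  move=> M _; apply: (@csum _ _) => u _ {}M.
  have -> : (fun M => z M u ^+ 2) = (fun M => z M u * z M u).
    by apply/funext => N; rewrite expr2.
  by apply: continuousM; exact: cz.
have A0 : (A !=set0)%classic.
  have [u0 _] := card_gt0P V0.
  exists (\row_j (enum_val j == u0)%:R); rewrite /A /= /sqn (bigD1 u0) //= big1 => [|u nu].
    by rewrite /z mxE enum_rankK eqxx expr1n addr0.
  by rewrite /z mxE enum_rankK (negPf nu) expr0n.
have [M] := EVT_max_rV A0 cA (continuous_subspaceT cf).
move=> /set_mem AM maxM; pose rho := f M.
have sA (y : V -> R) : sqn y = 1 -> qform e y <= rho.
  move=> sy; pose N : 'rV[R]_#|V| := \row_j y (enum_val j).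
  have zN : z N =1 y by move=> u; rewrite /z mxE enum_rankK.
  have sqN : sqn (z N) = sqn y by apply: eq_bigr => u _; rewrite zN.
  have qN : f N = qform e y.
    by apply: eq_bigr => u _; rewrite zN; congr (_ * _); apply: eq_bigr => w _; rewrite zN.
  by rewrite -qN; apply/maxM/mem_set; rewrite /A /= sqN.
have maxq y : qform e y <= rho * sqn y.
  have [y0|yn0] := eqVneq (sqn y) 0.
    by rewrite y0 mulr0 /qform big1 // => u _; rewrite (sqn_eq0 y0) mul0r.
  have sp : 0 < sqn y by rewrite lt_neqAle eq_sym yn0 sqn_ge0.
  pose t := Num.sqrt (sqn y); have t0 : 0 < t by rewrite sqrtr_gt0.
  have tt : t ^+ 2 = sqn y by rewrite sqr_sqrtr // ltW.
  have qE : qform e (fun u => y u / t) = qform e y / sqn y.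
    rewrite -tt /qform big_distrl /=; apply: eq_bigr => u _.
    rewrite /nsum -big_distrl /=; field; exact: lt0r_neq0.
  have sE : sqn (fun u => y u / t) = 1.
    rewrite -(divff yn0) -{2}tt /sqn big_distrl /=; apply: eq_bigr => u _.
    by rewrite expr_div_n.
  by have := sA _ sE; rewrite qE ler_pdivrMr.
pose y u := `|z M u|.
have sy : sqn y = 1 by rewrite sqn_abs.
have qy : qform e y = rho * sqn y.
  by apply/eqP; rewrite eq_le maxq sy mulr1 /= /rho /f qform_abs.
exists rho, y; split=> //.
- by move=> u; exact: normr_ge0.
- apply/existsP; rewrite -negb_forall; apply/negP=> /forallP y0.
  have : sqn y = 0 by rewrite /sqn big1 // => u _; rewrite (eqP (y0 u)) expr0n.
  by rewrite sy => /eqP; rewrite oner_eq0.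
- exact: qform_max_eigen.
Qed.

End Perron.

Lemma eigenvalue_adjmxP (R : realType) (G : sgraph) (a : R) :
  eigenvalue (adjmx R G) a <->
  exists2 y : G -> R, exists u, y u != 0 & forall u, nsum (@adj G) y u = a * y u.
Proof.
have nE (v : 'rV[R]_#|G|) (y : G -> R) : (forall u, y u = v ord0 (enum_rank u)) ->
    forall j, (v *m adjmx R G) ord0 j = nsum (@adj G) y (enum_val j).
  move=> yE j; rewrite mxE /nsum [RHS]big_mkcond /=.
  have bij : {on [pred _ | true], bijective (@enum_val G [in G])}.
    by exists enum_rank => u _; [exact: enum_valK | exact: enum_rankK].
  rewrite [RHS](reindex _ bij).
  apply: eq_bigr => i _; rewrite mxE adj_sym yE enum_valK.
  by case: adj; rewrite ?mulr1 ?mulr0.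
split=> [/eigenvalueP[v vA v0] | [y [u yu0] yA]].
  exists (fun u => v ord0 (enum_rank u)).
    apply/existsP; rewrite -negb_forall; apply: contra v0 => /forallP v0.
    by apply/eqP/rowP => j; rewrite mxE; have /eqP := v0 (enum_val j); rewrite enum_valK.
  move=> u; rewrite -{1}(enum_rankK u) -(nE v) // vA mxE //.
pose v : 'rV[R]_#|G| := \row_j y (enum_val j).
have vE w : y w = v ord0 (enum_rank w) by rewrite mxE enum_rankK.
apply/eigenvalueP; exists v.
  by apply/rowP => j; rewrite (nE v y) // yA mxE vE enum_valK.
by apply: contraNneq yu0 => v0; rewrite vE v0 mxE.
Qed.

(** At an eigenvector the quadratic form is the eigenvalue times [sqn], so that the value given by
    [perron] is the largest eigenvalue. *)
Lemma spectral_radiusP (R : realType) (G : sgraph) : (0 < #|G|)%N ->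
  let rho := spectral_radius R G in
  exists y : G -> R, [/\ forall u, 0 <= y u, exists u, y u != 0,
    forall u, nsum (@adj G) y u = rho * y u &
    forall z, qform (@adj G) z <= rho * sqn z].
Proof.
move=> G0; have [mu [y [y0 yn yA maxq]]] := perron R (@adj_sym G) G0.
suff -> : spectral_radius R G = mu by exists y.
have mem : [set a : R | eigenvalue (adjmx R G) a]%classic mu.
  by apply/eigenvalue_adjmxP; exists y.
have ub : ubound [set a : R | eigenvalue (adjmx R G) a]%classic mu.
  move=> a /eigenvalue_adjmxP[z [u zu] zA].
  have := maxq z; rewrite /qform; under eq_bigr do rewrite zA mulrCA -expr2.
  rewrite -big_distrr /= -/(sqn z) ler_pM2r // lt_neqAle sqn_ge0 andbT eq_sym.
  by apply: contraNneq zu => /sqn_eq0 ->.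
apply/eqP; rewrite eq_le ub_le_sup ?andbT //; last by exists mu.
by apply: ge_sup => //; exists mu.
Qed.

(** * Weighted pairs of adjacent vertices, and the graph of the hubs *)

Section Pairs.
Variables (R : realFieldType) (V : finType).
Implicit Types (e : rel V) (x : V -> R) (A B C : {set V}).

(** The pairs are ordered: an edge inside both sets counts twice, as in [qform]. *)
Definition pairs e x A B := \sum_(a in A) x a * \sum_(b in B | e a b) x b.

Lemma pairsT e x : qform e x = pairs e x setT setT.
Proof.
rewrite /qform /pairs big_mkcond [RHS]big_mkcond; apply: eq_bigr => u _.
by rewrite inE; congr (_ * _); apply: eq_bigl => w; rewrite inE.
Qed.

Lemma pairsC e x A B : symmetric e -> pairs e x A B = pairs e x B A.
Proof.
move=> esym; rewrite /pairs; under eq_bigr do rewrite big_distrr big_mkcondr.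
rewrite exchange_big /=; apply: eq_bigr => b _.
rewrite big_distrr big_mkcondr; apply: eq_bigr => a _.
by rewrite esym; case: ifP => // _; rewrite mulrC.
Qed.

Lemma pairs_splitr e x A B C : C \subset B ->
  pairs e x A B = pairs e x A C + pairs e x A (B :\: C).
Proof.
move=> sCB; rewrite -big_split /=; apply: eq_bigr => a _; rewrite -mulrDr; congr (_ * _).
rewrite (bigID (mem C)) /=; congr (_ + _); apply: eq_bigl => b.
  by rewrite andbC; case: (boolP (b \in C)) => // /(subsetP sCB)->.
by rewrite in_setD andbC andbA.
Qed.

Lemma pairs_split e x A C : symmetric e -> C \subset A ->
  pairs e x A A = pairs e x C C + 2 * pairs e x C (A :\: C) + pairs e x (A :\: C) (A :\: C).
Proof.
move=> esym sCA; rewrite (pairs_splitr e x A sCA) ![pairs e x A _]pairsC //.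
rewrite !(pairs_splitr e x _ sCA) (pairsC x _ C esym); ring.
Qed.

Lemma pairs_le e e' x A A' B B' : (forall u, 0 <= x u) -> A \subset A' -> B \subset B' ->
  (forall a b, a \in A -> b \in B -> e a b -> e' a b) -> pairs e x A B <= pairs e' x A' B'.
Proof.
move=> x0 sA sB sub; rewrite /pairs big_mkcond [X in _ <= X]big_mkcond /=.
apply: ler_sum => a _; case: ifP => [aA|_]; last first.
  by case: ifP => // _; apply: mulr_ge0 => //; apply: sumr_ge0.
rewrite (subsetP sA) // ler_wpM2l // big_mkcond [X in _ <= X]big_mkcond /=.
apply: ler_sum => b _; case: ifP => [/andP[bB eab]|_]; last by case: ifP.
by rewrite (subsetP sB) // (sub a b).
Qed.

Lemma pairs_le_mass e x A B m : (forall u, 0 <= x u) ->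
  (forall a, a \in A -> \sum_(b in B | e a b) x b <= m) ->
  pairs e x A B <= m * \sum_(a in A) x a.
Proof.
by move=> x0 hm; rewrite big_distrr; apply: ler_sum => a aA; rewrite mulrC ler_wpM2r // hm.
Qed.

(* For [t = t'] there is no edge outside of [L]. *)
Definition hub_rel (L : {set V}) (t t' : V) : rel V := fun a b =>
  (a != b) && [|| a \in L, b \in L, (a == t) && (b == t') | (a == t') && (b == t)].

Lemma hub_rel_sym L t t' : symmetric (hub_rel L t t').
Proof.
move=> a b; rewrite /hub_rel eq_sym; congr (_ && _).
by rewrite orbCA; congr [|| _, _ | _]; rewrite orbC ![(b == _) && _]andbC.
Qed.

Lemma pairs_hub_rel L t t' x :
  pairs (hub_rel L t t') x L (~: L) = (\sum_(h in L) x h) * \sum_(u in ~: L) x u.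
Proof.
rewrite /pairs big_distrl; apply: eq_bigr => h hL /=; congr (_ * _).
apply: eq_bigl => u; rewrite inE /hub_rel hL /= andbT.
by case: (boolP (u \in L)) => //= uL; apply: contraNneq uL => <-.
Qed.

End Pairs.

(** * Numerical estimates *)

Section Numeric.
Variable R : realFieldType.
Implicit Types k mu n w Y : R.

(** Nearly sharp for [k = 2] and [n = 52], where the hypothesis is [100 <= mu * (mu - 1)] and
    [21 / 2 * (19 / 2)] is [99.75]. *)
Lemma mu_lower k mu n : 2 <= k -> 13 * k ^+ 2 <= n -> 0 <= mu ->
  k * (n - k) <= mu * (mu - k + 1) -> 21 * k <= 4 * mu.
Proof.
move=> k2 hn mu0 hmu; rewrite leNgt; apply/negP=> lt.
have h1 : k * (13 * k ^+ 2 - k) <= k * (n - k) by nra.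
have h2 : mu * (mu - k + 1) <= (21 * k / 4) * (21 * k / 4 - k + 1) by nra.
have h3 : 0 <= k * ((k - 2) * (13 * k + 2)) by rewrite !mulr_ge0 //; lra.
nra.
Qed.

(** Meant for a component of the graph without [v]: [c] vertices, [N] neighbours of [v] of total
    weight [s], sum of squares [Q], spectral radius [l]. The last two hypotheses give
    [(mu - l) * s <= N]. For large [c] the bound [s <= 2 * k] suffices; for small [l] one uses
    [N <= c], and for large [l] one uses [N <= 2 * k] together with the growth of [c] that [l]
    forces. The factor 4 against 5 is the gain that limits such components in [budget]. *)
Lemma piece_bound k mu c N s Q l : 2 <= k -> 21 * k <= 4 * mu -> 0 <= l ->
    l ^+ 2 <= k * l + k * (c - 1) -> N <= 2 * k -> N <= c -> 0 <= s -> s <= N ->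
    (mu - l) * Q <= s -> s ^+ 2 <= N * Q ->
  5 * (mu - k + 1) * s <= 4 * k * c.
Proof.
move=> k2 hmu l0 hl N2k Nc s0 sN hQ hs.
have a0 : 0 < mu - k + 1 by lra.
have [c_big|c_small] := lerP (5 * (mu - k + 1)) (2 * c).
  have : (mu - k + 1) * s <= (mu - k + 1) * (2 * k) by rewrite ler_pM2l //; lra.
  nra.
(* An [l] this close to [mu] forces a large [c], contrary to [c_small]. *)
have [l_big|l_small] := ltrP (mu - 5 / 2) l.
  have h1 : (mu - 5 / 2) * (mu - 5 / 2 - k) <= l * (l - k).
    by apply: ler_pM; lra.
  have h2 : k * (5 * (mu - k + 1)) <= 2 * ((mu - 5 / 2) * (mu - 5 / 2 - k)) by nra.
  nra.
have ml : 0 < mu - l by lra.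
have sE : (mu - l) * s <= N.
  have [->|s_neq0] := eqVneq s 0; first by lra.
  have sp : 0 < s by rewrite lt_neqAle eq_sym s_neq0.
  rewrite -(ler_pM2r sp) -mulrA -expr2.
  apply: le_trans (_ : (mu - l) * (N * Q) <= _); first by rewrite ler_pM2l.
  by rewrite mulrCA; apply: ler_wpM2l => //; lra.
have [lA|lB] := lerP l (2 * k).
  have h1 : 5 * (mu - k + 1) <= 4 * k * (mu - 2 * k) by nra.
  have h2 : (mu - 2 * k) * s <= (mu - l) * s by rewrite ler_wpM2r //; lra.
  have h3 : 5 * (mu - k + 1) * s <= 4 * k * (mu - 2 * k) * s by rewrite ler_wpM2r.
  have h4 : 4 * k * ((mu - 2 * k) * s) <= 4 * k * c by apply: ler_wpM2l; lra.
  lra.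
suff key : 5 * (mu - k + 1) <= 2 * c * (mu - l).
  have h1 : 5 * (mu - k + 1) * s <= 2 * c * (mu - l) * s by rewrite ler_wpM2r.
  have c0 : 0 <= c by lra.
  have h2 : 2 * c * ((mu - l) * s) <= 2 * c * (2 * k) by apply: ler_wpM2l; lra.
  lra.
have kp : 0 < k by lra.
have [l3|l3] := lerP l (mu - 3).
  have cl : 1 + l <= c.
    rewrite -(ler_pM2l kp); have : k * l <= l * (l - k) by rewrite mulrC ler_wpM2l //; lra.
    nra.
  have h1 : (1 + l) * (mu - l) <= c * (mu - l) by rewrite ler_pM2r.
  have h2 : 0 <= (l - 2 * k) * (mu - 3 - l) by apply: mulr_ge0; lra.
  have h3 : 0 <= (k - 1) * (mu - 3 - l) by apply: mulr_ge0; lra.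
  nra.
have cl : 1 + 2 * l <= c.
  rewrite -(ler_pM2l kp); have : l * (2 * k) <= l * (l - k) by rewrite ler_wpM2l //; lra.
  nra.
have h1 : (1 + 2 * l) * (mu - l) <= c * (mu - l) by rewrite ler_pM2r.
have h2 : (1 + 2 * l) * (5 / 2) <= (1 + 2 * l) * (mu - l) by apply: ler_wpM2l; lra.
lra.
Qed.

Lemma mu_upper k mu n : 2 <= k -> 13 * k ^+ 2 <= n ->
  mu * (mu - k + 1) <= k * (n - 1) -> 100 * mu <= 21 * n.
Proof.
move=> k2 hn hmu; rewrite leNgt; apply/negP=> lt.
have k4 : 4 <= k ^+ 2 by nra.
have h1 : (21 / 100 * n) * (21 / 100 * n - k + 1) <= mu * (mu - k + 1).
  by apply: ler_pM; nra.
have h2 : 0 <= n * (n - 13 * k ^+ 2) by apply: mulr_ge0; nra.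
have h3 : 0 <= n * (k - 2) by apply: mulr_ge0; nra.
have h4 : 0 <= n * ((k - 2) * k) by apply: mulr_ge0; nra.
nra.
Qed.

(* From [k = 3] on this is sharper than [mu_lower], which does not suffice for
   [omega_corner]. *)
Definition mu_large k mu := [|| (k == 2) && (21 / 2 <= mu), (k == 3) && (39 / 2 <= mu) |
  (4 <= k) && (15 * k <= 2 * mu)].

(** The thresholds are the positive roots at [k = 2], [3], [4], about [10.51], [19.52] and [30.1],
    rounded down. *)
Lemma mu_cases (k : nat) mu : (2 <= k)%N -> 0 <= mu ->
  k%:R * (13 * k%:R ^+ 2 - k%:R) <= mu * (mu - k%:R + 1) -> mu_large k%:R mu.
Proof.
move=> k2 mu0 h; rewrite /mu_large.
move: k2 h; case: (leqP 4 k) => [k4 _ | ].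
  have kR : 4 <= k%:R :> R by rewrite ler_nat.
  move: (k%:R) kR => q q4 h; rewrite q4 /=; apply/orP; right; apply/orP; right.
  rewrite leNgt; apply/negP=> lt.
  have h1 : mu * (mu - q + 1) <= (15 * q / 2) * (15 * q / 2 - q + 1) by nra.
  have h2 : 0 <= q * ((q - 4) * (13 * q + 2)) by rewrite !mulr_ge0 //; lra.
  nra.
case: k => [|[|[|[|k]]]] //= _ _ h.
  rewrite eqxx /=; apply/orP; left; rewrite leNgt; apply/negP=> lt.
  have : mu * (mu - 2 + 1) <= (21 / 2) * (21 / 2 - 2 + 1) by nra.
  lra.
rewrite eqxx /=; apply/orP; right; apply/orP; left; rewrite leNgt; apply/negP=> lt.
have : mu * (mu - 3 + 1) <= (39 / 2) * (39 / 2 - 3 + 1) by nra.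
lra.
Qed.

(** Each corner joins the least [w] of one of the ranges from [4/5], [3/5] and [1/2] upwards with an
    upper bound for [Y] there. The factors [5] and [5 / 2] are [1 / (1 - w)] at the upper ends [4/5]
    and [3/5]; in the first range [4 * k - 1] is the general bound. *)
Lemma omega_corner k mu w y : mu_large k mu ->
    k * (13 * k ^+ 2 - k) <= mu * (mu - k + 1) ->
    [\/ w = 4 / 5 /\ y = 4 * k - 1, w = 3 / 5 /\ y = 5 * (k - 1) | w = 1 / 2 /\ y = 5 / 2 * (k - 1)] ->
  (w + k - 1) * (3 * k ^+ 2 + mu + k * y + 17 / 10 * k ^+ 2 * (k - 1)) <=
    k * (mu ^+ 2 * w - k * (1 + mu + y - w)).
Proof.
move=> hl hmu hwy.
case/or3P: hl => [/andP[/eqP kE h]|/andP[/eqP kE h]|/andP[k4 h]].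
- have hsq : 21 / 2 * mu <= mu ^+ 2 by rewrite expr2 ler_wpM2r //; lra.
  by subst k; case: hwy => -[-> ->]; lra.
- have hsq : 39 / 2 * mu <= mu ^+ 2 by rewrite expr2 ler_wpM2r //; lra.
  by subst k; case: hwy => -[-> ->]; lra.
have km : 0 <= (2 * mu - 15 * k) * (k * mu) by rewrite !mulr_ge0 //; lra.
have hk := ler_wpM2l (_ : 0 <= k) hmu; have {}hk := hk ltac:(lra).
have m1 : 0 <= (k - 4) * mu by rewrite mulr_ge0 //; lra.
have m2 : 0 <= (k - 4) * (k * mu) by rewrite !mulr_ge0 //; lra.
have k2 : 0 <= (k - 4) * k by rewrite mulr_ge0 //; lra.
have k3 : 0 <= (k - 4) * k ^+ 2 by rewrite mulr_ge0 ?sqr_ge0 //; lra.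
have k5 : 0 <= (k - 4) * k ^+ 3 by rewrite mulr_ge0 ?exprn_ge0 //; lra.
by case: hwy => -[-> ->]; lra.
Qed.

(* The difference of the two sides increases with [w] and decreases with [Y], so
   that it is enough to consider three corners. *)
Lemma omega_numeric k mu w Y : mu_large k mu ->
    k * (13 * k ^+ 2 - k) <= mu * (mu - k + 1) ->
    1 / 2 <= w -> w <= 1 -> 0 <= Y -> Y <= 4 * k - 1 -> (1 - w) * Y <= k - 1 ->
  (w + k - 1) * (3 * k ^+ 2 + mu + k * Y + 17 / 10 * k ^+ 2 * (k - 1)) <=
    k * (mu ^+ 2 * w - k * (1 + mu + Y - w)).
Proof.
move=> hl hmu w2 w1 Y0 Y4 hY.
have [k2 km] : 2 <= k /\ 5 * k <= mu.
  by case/or3P: hl => [/andP[/eqP-> h]|/andP[/eqP-> h]|/andP[k4 h]]; lra.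
have k0 : 0 <= k by lra.
(* This is the monotonicity in [w]: the two sides are the slopes in [w] of the two sides of the
   goal. *)
have hA : 3 * k ^+ 2 + mu + k * Y + 17 / 10 * k ^+ 2 * (k - 1) <= k * mu ^+ 2 + k ^+ 2.
  have h1 : k * Y <= k * (4 * k - 1) by rewrite ler_wpM2l.
  have h2 : 0 <= (mu - 5 * k) * mu by rewrite mulr_ge0 //; lra.
  have h3 : 0 <= (mu - 5 * k) * k by rewrite mulr_ge0 //; lra.
  have h4 : 0 <= k * ((mu - 5 * k) * mu) by rewrite mulr_ge0.
  have h5 : 0 <= k * ((mu - 5 * k) * k) by rewrite mulr_ge0.
  have h6 : 0 <= (k - 2) * k ^+ 2 by rewrite mulr_ge0 ?sqr_ge0 //; lra.
  have h7 : 0 <= (k - 2) * mu by rewrite mulr_ge0 //; lra.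
  have h8 : 0 <= k * ((k - 2) * mu) by rewrite mulr_ge0.
  lra.
suff [w0 [y [w0p w0w Yy key]]] : exists w0 y, [/\ 0 <= w0, w0 <= w, Y <= y &
    (w0 + k - 1) * (3 * k ^+ 2 + mu + k * y + 17 / 10 * k ^+ 2 * (k - 1)) <=
    k * (mu ^+ 2 * w0 - k * (1 + mu + y - w0))].
  have := ler_wpM2l (_ : 0 <= w - w0) hA; rewrite subr_ge0 => /(_ w0w).
  have : k * (w0 + k - 1) * Y <= k * (w0 + k - 1) * y.
    by rewrite ler_wpM2l // mulr_ge0 //; lra.
  have : k ^+ 2 * Y <= k ^+ 2 * y by rewrite ler_wpM2l // sqr_ge0.
  lra.
have [w8|w8] := lerP (4 / 5) w.
  exists (4 / 5), (4 * k - 1); split=> //; first by lra.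
  by apply: omega_corner => //; constructor 1.
have [w6|w6] := lerP (3 / 5) w.
  exists (3 / 5), (5 * (k - 1)); split=> //; [lra|nra|].
  by apply: omega_corner => //; constructor 2.
exists (1 / 2), (5 / 2 * (k - 1)); split=> //; [lra|nra|].
by apply: omega_corner => //; constructor 3.
Qed.

End Numeric.

(** * The weight carried by the hubs *)

Section Weights.
Variables (R : realFieldType) (V : finType).

(** A linear form in weights between 0 and 1 is largest at the indicator of its positive
    coefficients. This turns counts of edges from a set into weighted ones. *)
Lemma ler_sum_cond (A P : {set V}) (x g : V -> R) :
    (forall s, s \in A -> 0 <= x s) -> (forall s, s \in A -> x s <= 1) ->
    {in A, forall s, (s \in P) = (0 < g s)} ->
  \sum_(s in A) x s * g s <= \sum_(s in A :&: P) g s.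
Proof.
move=> x0 x1 gP; rewrite [X in _ <= X]big_mkcond [X in X <= _]big_mkcond /=.
apply: ler_sum => s _; rewrite inE; have [As /=|//] := boolP (s \in A).
have := gP s As; case: (s \in P) => [/esym g0|/esym/negbT]; rewrite -?leNgt.
  by rewrite ger_pMl // x1.
by move=> g0; rewrite mulr_ge0_le0 // x0.
Qed.

(* The positive excess of [g] outside [T] fits into the room left by [c - g] on the
   heavier set [T]. *)
Lemma top_weight (D T : {set V}) (x g : V -> R) (c m : R) : T \subset D ->
    (forall S : {set V}, S \subset D -> \sum_(s in S) g s <= #|T|%:R * c) ->
    {in D, forall s, g s <= c} -> 0 <= m ->
    {in T, forall s, m <= x s} -> {in D :\: T, forall s, 0 <= x s <= m} ->
  \sum_(s in D) x s * g s <= c * \sum_(t in T) x t.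
Proof.
move=> sTD hS hc m0 hT hD.
pose P := [set s in D :\: T | 0 < g s].
have sTPD : T :|: P \subset D.
  by apply/subsetP=> s; rewrite !inE => /orP[/(subsetP sTD)//|/andP[/andP[]]].
have TPT : (T :|: P) :&: T = T by apply/setIidPr; exact: subsetUl.
have TPP : (T :|: P) :\: T = P.
  apply/setP=> s; rewrite 3!inE; case: (boolP (s \in T)) => Ts //=.
  by symmetry; rewrite !inE Ts.
have := hS _ sTPD; rewrite (big_setID T) /= TPT TPP => hTP.
rewrite (big_setID T) /= (setIidPr sTD).
have h1 : \sum_(s in D :\: T) x s * g s <= m * \sum_(s in P) g s.
  rewrite big_distrr /= [X in _ <= X]big_mkcond [X in X <= _]big_mkcond /=.
  apply: ler_sum => s _; rewrite [s \in P]inE.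
  have [Ds /=|//] := boolP (s \in D :\: T); have /andP[xs xm] := hD s Ds.
  by case: ltP => g0; [rewrite ler_wpM2r // ltW | rewrite mulr_ge0_le0].
have h2 : m * \sum_(s in P) g s <= m * \sum_(t in T) (c - g t).
  by apply: ler_wpM2l => //; rewrite sumrB sumr_const -mulr_natl; lra.
have h3 : m * \sum_(t in T) (c - g t) <= \sum_(t in T) x t * (c - g t).
  rewrite big_distrr /=; apply: ler_sum => t Tt; rewrite ler_wpM2r ?hT //.
  by rewrite subr_ge0 hc // (subsetP sTD).
apply: le_trans (_ : \sum_(t in T) x t * g t + \sum_(t in T) x t * (c - g t) <= _); first by lra.
rewrite -big_split big_distrr /=; apply: ler_sum => t _; lra.
Qed.

End Weights.

Section Spectral.
Variables (R : realType) (V : finType) (e : rel V).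
Hypotheses (esym : symmetric e) (eirr : irreflexive e).
Variable k : nat.
Hypothesis k_gt1 : (1 < k)%N.
Hypothesis circ : forall c, uniq c -> cycle e c -> (2 < size c)%N -> (size c <= 2 * k + 1)%N.
Notation nb := (nb e).
Notation deg u := (#|nb u|).

Lemma nsumE (x : V -> R) u : nsum e x u = \sum_(w in nb u) x w.
Proof. by apply: eq_bigl => w; rewrite inE. Qed.

Lemma card_nbI (A : {set V}) s : \sum_(u in A) (e s u : nat) = #|A :&: nb s|.
Proof.
rewrite -sum1_card big_mkcond [RHS]big_mkcond; apply: eq_bigr => u _.
by rewrite !inE; case: (u \in A) => //=; case: (e s u).
Qed.

(** Walks of length two from [c] with middle vertex in [N], sorted by their end; the first term
    counts the returns to [c]. *)
Lemma two_walks (x : V -> R) (c : V) (B N : {set V}) : N \subset nb c -> c \notin B ->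
    (forall u s, u \in N -> e u s -> s != c -> s \in B) ->
  \sum_(u in N) nsum e x u = #|N|%:R * x c + \sum_(s in B) x s * #|N :&: nb s|%:R.
Proof.
move=> sN cB hB.
have -> : \sum_(s in B) x s * #|N :&: nb s|%:R = \sum_(u in N) \sum_(s in B) x s * (e u s)%:R.
  rewrite exchange_big /=; apply: eq_bigr => s _.
  rewrite -card_nbI natr_sum big_distrr /=; apply: eq_bigr => u _.
  by rewrite esym.
have -> : #|N|%:R * x c = \sum_(u in N) x c by rewrite sumr_const mulr_natl.
rewrite -big_split /=; apply: eq_bigr => u Nu.
have ecu : e u c by rewrite esym; move/(subsetP sN): Nu; rewrite inE.
rewrite /nsum (bigD1 c) //=; congr (_ + _).
rewrite big_mkcond [RHS]big_mkcond /=; apply: eq_bigr => s _.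
case: (boolP (s \in B)) => [Bs|nBs].
  have -> : s != c by apply: contraNneq cB => <-.
  by case: (e u s); rewrite /= ?mulr1 ?mulr0.
case: ifP => // /andP[eus sc]; by rewrite (hB u s) in nBs.
Qed.

Variables (mu : R) (x : V -> R).
Hypotheses (x0 : forall u, 0 <= x u) (x1 : forall u, x u <= 1).
Hypothesis eig : forall u, nsum e x u = mu * x u.

Lemma lossy_weight (c : V) (B N : {set V}) : N \subset nb c -> c \notin B ->
  \sum_(s in B) x s * #|N :&: nb s|%:R <= (k.-1)%:R * #|N|%:R + k%:R * \sum_(s in B) x s.
Proof.
move=> sN cB.
pose g s : R := #|N :&: nb s|%:R - k%:R; pose P := [set s | 0 < g s].
have := @ler_sum_cond R V B P x g (fun s _ => x0 s) (fun s _ => x1 s) _.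
have -> : \sum_(s in B) x s * g s =
    \sum_(s in B) x s * #|N :&: nb s|%:R - k%:R * \sum_(s in B) x s.
  by rewrite big_distrr -sumrB /=; apply: eq_bigr => s _; rewrite /g; ring.
move=> h; have {}h := h (fun s _ => in_set _ _).
rewrite -lerBlDr; apply: le_trans h _.
rewrite /g sumrB sumr_const -natr_sum.
have cBP : c \notin B :&: P by rewrite inE (negPf cB).
have := arcs_lossy esym eirr k_gt1 circ sN cBP.
under eq_bigr => s _ do rewrite card_nbI.
move=> le; rewrite lerBlDr -[k%:R *+ _]mulr_natl -!natrM -natrD ler_nat.
by rewrite (mulnC _ k).
Qed.

(** The left side is the weight of all walks of length two from [c], by the eigenvector equation
    used twice; [lossy_weight] bounds those that do not return. *)
Lemma center_bound (c : V) (B : {set V}) : c \notin B ->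
    (forall u s, e c u -> e u s -> s != c -> s \in B) ->
  mu ^+ 2 * x c <= (deg c)%:R * (x c + (k.-1)%:R) + k%:R * \sum_(s in B) x s.
Proof.
move=> cB hB.
have -> : mu ^+ 2 * x c = \sum_(u in nb c) nsum e x u.
  under eq_bigr => u _ do rewrite eig.
  by rewrite -big_distrr /= -nsumE eig; ring.
rewrite (two_walks x (subxx _) cB) => [|u s]; last by rewrite inE; apply: hB.
rewrite mulrDr -addrA lerD2l [_ * (k.-1)%:R]mulrC.
exact: lossy_weight.
Qed.

End Spectral.

(** * Pieces of the graph without the centre *)

Section Pieces.
Variables (R : realType) (V : finType) (e : rel V).
Hypotheses (esym : symmetric e) (eirr : irreflexive e).
Variable k : nat.
Hypothesis k_gt1 : (1 < k)%N.
Hypothesis circ : forall c, uniq c -> cycle e c -> (2 < size c)%N -> (size c <= 2 * k + 1)%N.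

Definition induced (K : {set V}) : rel V := fun a b => [&& e a b, a \in K & b \in K].

(** This is [center_bound] at a largest entry of the Perron vector of [K], scaled to 1: its
    neighbours have total weight [l], and each other vertex of [K] at most 1. *)
Lemma induced_perron (K : {set V}) : (0 < #|K|)%N ->
  exists l : R, [/\ 0 <= l, l ^+ 2 <= k%:R * l + k%:R * (#|K|%:R - 1) &
    forall z : V -> R, qform (induced K) z <= l * sqn z].
Proof.
move=> K0.
have isym : symmetric (induced K) by move=> a b; rewrite /induced esym [(_ \in K) && _]andbC.
have iirr : irreflexive (induced K) by move=> a; rewrite /induced eirr.
have icirc c : uniq c -> cycle (induced K) c -> (2 < size c)%N -> (size c <= 2 * k + 1)%N.
  by move=> uc cc; apply: circ => //; apply: sub_cycle cc => a b /and3P[].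
have [u0 Ku0] := card_gt0P K0.
have V0 : (0 < #|V|)%N by apply/card_gt0P; exists u0.
have [l [y [y0 [u yu0] yA maxq]]] := perron R isym V0.
have yu : 0 < y u by rewrite lt_neqAle eq_sym yu0 y0.
have l0 : 0 <= l.
  rewrite -(pmulr_lge0 l yu) -yA; apply: sumr_ge0 => w _; exact: y0.
exists l; split=> //.
(* Vertices outside [K] are isolated, so for [l = 0] a largest entry may lie outside [K]; the bound
   is then immediate. *)
have [->|lneq0] := eqVneq l 0.
  by rewrite expr0n mulr0 add0r mulr_ge0 ?ler0n // subr_ge0 ler1n.
have [w _ maxw] := @arg_maxP _ _ V u0 xpredT y isT.
have yw : 0 < y w by apply: lt_le_trans yu (maxw u isT).
pose z s := y s / y w.
have z0 s : 0 <= z s by rewrite divr_ge0.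
have z1 s : z s <= 1 by rewrite ler_pdivrMr // mul1r; exact: maxw.
have zw : z w = 1 by rewrite /z divff // lt0r_neq0.
have zA s : nsum (induced K) z s = l * z s.
  by rewrite /nsum -big_distrl /= mulrA -yA.
have Kw : w \in K.
  apply: contraT => nKw; have := zA w; rewrite zw mulr1 /nsum big1 ?(negPf lneq0).
    by move=> /eqP; rewrite eq_sym (negPf lneq0).
  by move=> s /and3P[_]; rewrite (negPf nKw).
pose D := nb (induced K) w.
have sD : D \subset K :\ w.
  apply/subsetP=> s; rewrite !inE => iws; case/and3P: (iws) => _ _ ->; rewrite andbT.
  by apply: contraTneq iws => ->; rewrite iirr.
have hB a s : induced K w a -> induced K a s -> s != w -> s \in K :\ w.
  by move=> _ /and3P[_ _ Ks] sw; rewrite !inE sw.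
have := @center_bound R V _ isym iirr k k_gt1 icirc l z z0 z1 zA w (K :\ w).
rewrite !inE eqxx => /(_ isT hB); rewrite zw mulr1 -/D => le.
have sumK : \sum_(s in K :\ w) z s <= l + (#|K|%:R - 1 - #|D|%:R).
  rewrite (big_setID D) /= (setIidPr sD); apply: lerD.
    by rewrite -nsumE zA zw mulr1.
  apply: le_trans (_ : \sum_(s in K :\ w :\: D) 1 <= _).
    by apply: ler_sum => s _; exact: z1.
  have cK : (#|K :\ w :\: D| + #|D|).+1 = #|K|.
    by rewrite (cardsD1 w K) Kw add1n -(cardsID D (K :\ w)) (setIidPr sD) addnC.
  by rewrite sumr_const -cK -addn1 !natrD; lra.
have kk : (k.-1)%:R = k%:R - 1 :> R.
  by rewrite -subn1 natrB // ltnW.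
apply: le_trans le _; rewrite kk.
have k0 : 0 <= k%:R :> R by exact: ler0n.
have := ler_wpM2l k0 sumK; lra.
Qed.

(* A piece is a union of components of the graph without [v]. *)
Variables (mu : R) (x : V -> R) (v : V).
Hypotheses (x0 : forall u, 0 <= x u) (x1 : forall u, x u <= 1).
Hypothesis eig : forall u, nsum e x u = mu * x u.
Hypothesis xv : x v = 1.

(** A vertex of [K] has no neighbour outside [K] except possibly [v], of weight 1. Hence the
    eigenvector equation restricted to [K] loses exactly 1 at each neighbour of [v]. The last
    inequality is that of Cauchy and Schwarz. *)
Lemma piece_perron (K : {set V}) : (0 < #|K|)%N -> v \notin K ->
    (forall w s, w \in K -> e w s -> s != v -> s \in K) ->
  let s := \sum_(u in nb e v :&: K) x u in let Q := \sum_(u in K) x u ^+ 2 in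
  \sum_(u in K) x u * (\sum_(w in K | e u w) x w) = mu * Q - s /\
  exists l : R, [/\ 0 <= l, l ^+ 2 <= k%:R * l + k%:R * (#|K|%:R - 1),
    (mu - l) * Q <= s & s ^+ 2 <= #|nb e v :&: K|%:R * Q].
Proof.
move=> K0 vK hK s Q.
have qE : \sum_(u in K) x u * (\sum_(w in K | e u w) x w) = mu * Q - s.
  rewrite /Q /s big_distrr /= [\sum_(u in nb e v :&: K) _]big_mkcond [X in _ - X](bigID (mem K)) /=.
  rewrite [X in _ - (_ + X)]big1 => [|u nKu]; last by rewrite inE (negPf nKu) andbF.
  rewrite addr0 -sumrB; apply: eq_bigr => u Ku; rewrite !inE Ku andbT.
  have -> : \sum_(w in K | e u w) x w = mu * x u - (if e v u then 1 else 0).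
    rewrite -eig /nsum; case: (boolP (e v u)) => [evu|nevu].
      rewrite [in RHS](bigD1 v) /=; last by rewrite esym.
      rewrite xv addrC addrK; apply: eq_bigl => w; apply/andP/andP => -[].
        by move=> Kw ->; split=> //; apply: contraNneq vK => <-.
      by move=> euw wv; split=> //; apply: (hK u).
    rewrite subr0; apply: eq_bigl => w; apply/andP/idP => [[]//|euw]; split=> //.
    by apply: (hK u) => //; apply: contraNneq nevu => <-; rewrite esym.
  by case: (e v u); ring.
split=> //; have [l [l0 hl maxq]] := induced_perron K0.
exists l; split=> //.
  pose z u := if u \in K then x u else 0.
  have := maxq z; have -> : sqn z = Q.
    rewrite /sqn /Q [RHS]big_mkcond; apply: eq_bigr => u _.
    by rewrite /z; case: ifP => // _; rewrite expr0n.
  have -> : qform (induced K) z = mu * Q - s.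
    rewrite -qE /qform [RHS]big_mkcond; apply: eq_bigr => u _; rewrite /z.
    case: ifP => Ku; last by rewrite mul0r.
    congr (_ * _); rewrite /nsum big_mkcond [RHS]big_mkcond; apply: eq_bigr => w _.
    by rewrite /induced Ku /=; case: (w \in K); rewrite ?andbT ?andbF.
  lra.
have sq0 : 0 <= \sum_(u in nb e v :&: K) (x u * #|nb e v :&: K|%:R - s) ^+ 2.
  by apply: sumr_ge0 => u _; exact: sqr_ge0.
set c : R := #|nb e v :&: K|%:R in sq0 *.
have sqE : \sum_(u in nb e v :&: K) (x u * c - s) ^+ 2 =
    c * (c * (\sum_(u in nb e v :&: K) x u ^+ 2) - s ^+ 2).
  rewrite (eq_bigr (fun u => c ^+ 2 * x u ^+ 2 - 2 * c * s * x u + s ^+ 2)) => [|u _]; last by ring.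
  rewrite big_split sumrB -!big_distrr /= -/s sumr_const -mulr_natl -/c; ring.
have Qle : \sum_(u in nb e v :&: K) x u ^+ 2 <= Q.
  rewrite /Q [X in _ <= X](big_setID (nb e v)) /= setIC lerDl.
  by apply: sumr_ge0 => u _; exact: sqr_ge0.
have c0 : 0 <= c by exact: ler0n.
have [c_eq0|c_neq0] := eqVneq c 0.
  have -> : s = 0.
    rewrite /s big1 // => u; move/eqP: c_eq0; rewrite pnatr_eq0 cards_eq0 => /eqP->.
    by rewrite inE.
  by rewrite c_eq0 mul0r expr0n.
have cp : 0 < c by rewrite lt_neqAle eq_sym c_neq0.
move: sq0; rewrite sqE pmulr_rge0 // subr_ge0 => h.
by apply: le_trans h _; rewrite ler_wpM2l.
Qed.

End Pieces.

(** Here [w] stands for [#|hnon|]. From [w >= 4 * k] it would follow that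
    [(k + 1) * mu <= 8 * k ^+ 2 - k], which is too small for a [mu ^+ 2] of order [13 * k ^+ 3]. *)
Lemma nonadjacent_numeric (R : realFieldType) (k mu w : R) : 2 <= k -> 21 * k <= 4 * mu ->
    13 * k ^+ 3 - k ^+ 2 <= mu * (mu - k + 1) ->
    mu * (w - (k - 1)) <= (k - 1) * mu + 5 * k * w - 2 * k * (2 * k + 1) ->
  w < 4 * k.
Proof.
move=> k2 hmu h3 h; rewrite ltNge; apply/negP=> w4.
have h1 : (mu - 5 * k) * (4 * k) <= (mu - 5 * k) * w by rewrite ler_wpM2l //; lra.
have h2 : (k + 1) * mu <= 8 * k ^+ 2 - k by nra.
have h4 : (k + 1) * (mu - k + 1) <= 7 * k ^+ 2 - k + 1 by nra.
have h5 : ((k + 1) * mu) * ((k + 1) * (mu - k + 1)) <=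
    (8 * k ^+ 2 - k) * (7 * k ^+ 2 - k + 1).
  by apply: ler_pM => //; apply: mulr_ge0; lra.
have h6 : (k + 1) ^+ 2 * (13 * k ^+ 3 - k ^+ 2) <=
    ((k + 1) * mu) * ((k + 1) * (mu - k + 1)).
  have -> : ((k + 1) * mu) * ((k + 1) * (mu - k + 1)) = (k + 1) ^+ 2 * (mu * (mu - k + 1)) by ring.
  by rewrite ler_wpM2l // sqr_ge0.
(* As a polynomial in [q] the relevant factor has positive coefficients only. *)
pose q := k - 2; have q0 : 0 <= q by rewrite /q; lra.
have kE : k = q + 2 by rewrite /q; ring.
have : 0 < k * (13 * k ^+ 4 - 31 * k ^+ 3 + 26 * k ^+ 2 - 10 * k + 1).
  have -> : 13 * k ^+ 4 - 31 * k ^+ 3 + 26 * k ^+ 2 - 10 * k + 1 =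
    13 * q ^+ 4 + 73 * q ^+ 3 + 152 * q ^+ 2 + 138 * q + 45 by rewrite kE; ring.
  apply: mulr_gt0; first lra.
  have := exprn_ge0 4 q0; have := exprn_ge0 3 q0; have := exprn_ge0 2 q0; lra.
lra.
Qed.

Lemma top_set (R : realFieldType) (V : finType) (D : {set V}) (f : V -> R) r :
  (r <= #|D|)%N -> exists T : {set V}, [/\ T \subset D, #|T| = r &
    forall t u, t \in T -> u \in D :\: T -> f u <= f t].
Proof.
elim: r => [|r IHr] le; first by exists set0; split; rewrite ?sub0set ?cards0 // => t u; rewrite inE.
have [T [sTD cT hT]] := IHr (ltnW le).
have [w Dw] : exists w, w \in D :\: T.
  by apply/set0Pn; rewrite -card_gt0 cardsD (setIidPr sTD) subn_gt0 cT.
have [z Dz maxz] := @arg_maxP _ _ V w [in D :\: T] f Dw.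
have zT : z \notin T by move: Dz; rewrite /= inE => /andP[].
exists (z |: T); split.
- by apply/subsetP=> u; rewrite !inE => /orP[/eqP->|/(subsetP sTD)//]; move: Dz; rewrite /= inE => /andP[].
- by rewrite cardsU1 zT cT.
- move=> t u; rewrite !inE negb_or => /orP[/eqP->|Tt] /andP[/andP[uz uT] Du].
    by apply: maxz; rewrite /= inE uT.
  by apply: hT; rewrite // inE uT.
Qed.

(** * Light and heavy components, and the budget *)

Section Setup.
Variables (R : realType) (V : finType) (e : rel V).
Hypotheses (esym : symmetric e) (eirr : irreflexive e).
Variable k : nat.
Hypothesis k_gt1 : (1 < k)%N.
Hypothesis circ : forall c, uniq c -> cycle e c -> (2 < size c)%N -> (size c <= 2 * k + 1)%N.
Notation nb := (nb e).
Notation n := #|V|.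
Hypothesis n_ge : (13 * k ^ 2 <= n)%N.
Variables (mu : R) (x : V -> R) (v : V).
Hypotheses (x0 : forall u, 0 <= x u) (x1 : forall u, x u <= 1).
Hypothesis eig : forall u, nsum e x u = mu * x u.
Hypothesis xv : x v = 1.
Hypothesis mu_ge : k%:R * (n%:R - k%:R) <= mu * (mu - k%:R + 1).
Local Notation kR := (k%:R : R).

Lemma kR_ge2 : 2 <= kR. Proof. by rewrite ler_nat. Qed.
Lemma predkR : (k.-1)%:R = kR - 1. Proof. by rewrite -subn1 natrB // ltnW. Qed.
Lemma nR_ge : 13 * kR ^+ 2 <= n%:R.
Proof. by rewrite -natrX -natrM ler_nat. Qed.

Lemma mu_ge0 : 0 <= mu.
Proof. by rewrite -[mu]mulr1 -xv -eig; apply: sumr_ge0 => u _; exact: x0. Qed.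

Lemma mu_ge21 : 21 * kR <= 4 * mu.
Proof. exact: mu_lower kR_ge2 nR_ge mu_ge0 mu_ge. Qed.

(* [light] is the union of the components of the graph without [v] that contain at most
   [2 k] neighbours of [v]: [arcs_lossless] does not apply to them, but they carry
   little weight. [hnbr] and [hnon] are the other neighbours and non-neighbours of [v]. *)
Definition comp u := [set w | connect (econ e v) u w].
Definition light := [set u | (u != v) && (#|nb v :&: comp u| <= 2 * k)%N].
Definition heavy := ~: (v |: light).
Definition hnbr := nb v :&: heavy.
Definition hnon := heavy :\: nb v.

Lemma csym : connect_sym (econ e v).
Proof. by apply: sym_connect_sym => a b; rewrite /econ esym [(a != v) && _]andbC. Qed.

Lemma comp_eq u w : w \in comp u -> comp w = comp u.
Proof.
rewrite inE => uw; apply/setP=> z; rewrite !inE.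
by rewrite (same_connect csym uw).
Qed.

Lemma comp_neq u w : u != v -> w \in comp u -> w != v.
Proof.
move=> uv; rewrite inE csym => /connectP[p pp up].
apply/negP=> /eqP wv; case: p pp up => [_ /= uw|z p /= /andP[/and3P[_]]].
  by rewrite uw wv eqxx in uv.
by rewrite wv eqxx.
Qed.

Lemma comp_nbr u s : u != v -> s != v -> e u s -> s \in comp u.
Proof. by move=> uv sv eus; rewrite inE connect1 // /econ eus uv. Qed.

Lemma lightE u : (u \in light) = (u != v) && (#|nb v :&: comp u| <= 2 * k)%N.
Proof. by rewrite inE. Qed.

Lemma light_comp u w : u \in light -> w \in comp u -> w \in light.
Proof.
by rewrite !lightE => /andP[uv le] cw; rewrite (comp_neq uv cw) (comp_eq cw).
Qed.

Lemma heavyE u : (u \in heavy) = (u != v) && (2 * k < #|nb v :&: comp u|)%N.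
Proof. by rewrite !inE negb_or negb_and negbK -ltnNge; case: (u == v). Qed.

Lemma heavy_comp u w : u \in heavy -> w \in comp u -> w \in heavy.
Proof.
by rewrite !heavyE => /andP[uv le] cw; rewrite (comp_neq uv cw) (comp_eq cw).
Qed.

Lemma light_nbr u s : u \in light -> e u s -> s != v -> s \in light.
Proof.
move=> lu eus sv; apply: (light_comp lu); apply: comp_nbr => //.
by move: lu; rewrite inE => /andP[].
Qed.

Lemma heavy_nbr u s : u \in heavy -> e u s -> s != v -> s \in heavy.
Proof.
move=> lu eus sv; apply: (heavy_comp lu); apply: comp_nbr => //.
by move: lu; rewrite heavyE => /andP[].
Qed.

Lemma v_light : v \notin light. Proof. by rewrite inE eqxx. Qed.
Lemma v_heavy : v \notin heavy. Proof. by rewrite heavyE eqxx. Qed.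
Lemma v_nb : v \notin nb v. Proof. by rewrite inE eirr. Qed.

Lemma card_split : (#|hnbr| + #|hnon| + #|light|).+1 = n.
Proof.
rewrite -[X in (X + _ + _)%N]/(#|nb v :&: heavy|) setIC cardsID.
have cl : #|v |: light| = #|light|.+1 by rewrite cardsU1 v_light.
by rewrite /heavy -addnS -cl addnC cardsC.
Qed.

Lemma sum_nbr (y : V -> R) :
  \sum_(u in nb v) y u = \sum_(u in hnbr) y u + \sum_(u in nb v :&: light) y u.
Proof.
rewrite (big_setID heavy) /=; congr (_ + _); apply: eq_bigl => u.
rewrite in_setD in_setI andbC; case: (boolP (u \in nb v)) => //= Nu.
rewrite !inE negbK; case: eqP => // uv.
by move: Nu; rewrite uv inE eirr.
Qed.

(** The sum of [piece_bound] over the components in [light], which are indexed by their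
    representative [r]. *)
Lemma light_mass :
  5 * (mu - kR + 1) * (\sum_(u in nb v :&: light) x u) <= 4 * kR * #|light|%:R.
Proof.
pose r := fingraph.root (econ e v).
have -> : #|light|%:R = \sum_(u in light) 1 :> R by rewrite sumr_const.
rewrite (partition_big r xpredT) //= [X in _ <= _ * X](partition_big r xpredT) //=.
rewrite !big_distrr /=; apply: ler_sum => z _.
have [/existsP[u /andP[lu /eqP ru]] | /existsPn none] := boolP [exists u, (u \in light) && (r u == z)]; last first.
  rewrite !big1 ?mulr0 // => u /andP[].
    by move=> lu rz; have := none u; rewrite lu rz.
  by rewrite inE => /andP[_ lu] rz; have := none u; rewrite lu rz.
have compE w : (w \in comp u) = (w \in light) && (r w == z).
  apply/idP/andP => [cw | [lw /eqP rw]].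
    split; first exact: light_comp lu cw.
    by move: cw; rewrite inE -(root_connect csym) -ru eq_sym.
  by rewrite inE -(root_connect csym) -/r ru rw.
have uv : u != v by move: lu; rewrite inE => /andP[].
have K0 : (0 < #|comp u|)%N by apply/card_gt0P; exists u; rewrite inE connect0.
have vK : v \notin comp u by apply/negP=> /(comp_neq uv); rewrite eqxx.
have clK w s : w \in comp u -> e w s -> s != v -> s \in comp u.
  move=> cw ews sv; rewrite -(comp_eq cw); apply: comp_nbr => //.
  exact: comp_neq cw.
have [_ [l [l0 hl hQ hs]]] := piece_perron esym eirr k_gt1 circ eig xv K0 vK clK.
have -> : \sum_(w in light | r w == z) 1 = #|comp u|%:R :> R.
  by rewrite -sumr_const; apply: eq_bigl => w; rewrite compE.
have -> : \sum_(w in nb v :&: light | r w == z) x w = \sum_(w in nb v :&: comp u) x w.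
  by apply: eq_bigl => w; rewrite in_setI [RHS]in_setI compE andbA.
apply: (piece_bound kR_ge2 mu_ge21 l0 hl _ _ _ _ hQ hs).
- by rewrite -natrM ler_nat; move: lu; rewrite inE => /andP[].
- by rewrite ler_nat; apply/subset_leq_card/subsetIr.
- by apply: sumr_ge0 => w _; exact: x0.
- by rewrite -sumr_const; apply: ler_sum => w _; exact: x1.
Qed.

(** Walks of length two from [v] through [hnbr]. The number [g s] is the excess of the neighbours of
    [s] in [hnbr] over the amount charged to [s] by [arcs_lossless]. Over any set of heavy vertices
    these excesses sum to at most [k.-1] times [#|hnbr|], which also bounds each of them up to that
    factor, so [top_weight] moves them to the heaviest vertices. The alternative [T = heavy] serves
    the case of too few heavy vertices, which [budget] refutes. *)
Lemma heavy_weight (T : {set V}) : T \subset heavy ->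
    (#|T| = k.-1)%N \/ T = heavy ->
    (forall t u, t \in T -> u \in heavy :\: T -> x u <= x t) ->
  (mu - kR + 1) * (\sum_(u in hnbr) x u) <=
    #|hnbr|%:R * (1 + \sum_(t in T) x t) + kR * \sum_(u in hnon) x u.
Proof.
move=> sT cT topT.
pose g s : R := #|hnbr :&: nb s|%:R - (if s \in nb v then kR - 1 else kR).
have sN : hnbr \subset nb v by apply: subsetIl.
have g_le s : g s <= #|hnbr|%:R.
  have : #|hnbr :&: nb s|%:R <= #|hnbr|%:R :> R by rewrite ler_nat; apply/subset_leq_card/subsetIl.
  by have := kR_ge2; rewrite /g; case: ifP => _; lra.
have hS (S : {set V}) : S \subset heavy -> \sum_(s in S) g s <= #|T|%:R * #|hnbr|%:R.
  move=> sS; case: cT => [-> | TE]; last first.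
    apply: le_trans (_ : \sum_(s in S) #|hnbr|%:R <= _); first by apply: ler_sum.
    rewrite sumr_const -[X in X <= _]mulr_natl ler_wpM2r // ler_nat TE; exact: subset_leq_card.
  have vS : v \notin S by apply/negP=> /(subsetP sS); rewrite (negPf v_heavy).
  have big u : u \in hnbr :|: S -> (2 * k < #|[set z in hnbr | connect (econ e v) u z]|)%N.
    move=> Su; have hu : u \in heavy.
      by move: Su; rewrite inE => /orP[/setIP[]//|/(subsetP sS)].
    have := hu; rewrite heavyE => /andP[_ /leq_trans]; apply.
    apply/subset_leq_card/subsetP => z /setIP[Nz cz].
    rewrite inE in_setI Nz /= (heavy_comp hu cz).
    by move: cz; rewrite inE.
  have := arcs_lossless esym eirr k_gt1 circ sN vS big.
  under eq_bigr => s _ do rewrite card_nbI.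
  rewrite /g sumrB -natr_sum => le.
  have -> : \sum_(s in S) (if s \in nb v then kR - 1 else kR) =
      (kR - 1) * #|S :&: hnbr|%:R + kR * #|S :\: hnbr|%:R.
    rewrite (big_setID hnbr) /= -!sumr_const !big_distrr /=; congr (_ + _).
      by apply: eq_bigr => s /setIP[_ /setIP[-> _]]; rewrite mulr1.
    apply: eq_bigr => s /setDP[Ss]; rewrite in_setI (subsetP sS s Ss) andbT => /negPf->.
    by rewrite mulr1.
  rewrite lerBlDr; move: le; rewrite -(ler_nat R) !natrD !natrM predkR; lra.
have m_ex : exists2 m : R, 0 <= m & {in T, forall s, m <= x s} /\ {in heavy :\: T, forall s, 0 <= x s <= m}.
  have [D0|[w Dw]] := set_0Vmem (heavy :\: T).
    exists 0 => //; split=> [s _|s]; first exact: x0.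
    by rewrite D0 inE.
  have [z Dz maxz] := @arg_maxP _ _ V w [in heavy :\: T] x Dw.
  exists (x z); first exact: x0.
  split=> [s Ts|s Ds]; first exact: topT.
  by rewrite x0; apply: maxz.
have [m m0 [hT hD]] := m_ex.
have := top_weight sT hS (fun s _ => g_le s) m0 hT hD.
have hB u s : u \in hnbr -> e u s -> s != v -> s \in heavy.
  by move=> /setIP[_ hu]; apply: heavy_nbr.
have := two_walks esym x sN v_heavy hB.
under eq_bigr => u _ do rewrite eig.
rewrite -big_distrr xv mulr1 /= => eqn le.
have gE : \sum_(s in heavy) x s * #|hnbr :&: nb s|%:R = \sum_(s in heavy) x s * g s +
    ((kR - 1) * (\sum_(s in hnbr) x s) + kR * \sum_(s in hnon) x s).
  have -> : (kR - 1) * (\sum_(s in hnbr) x s) + kR * (\sum_(s in hnon) x s) =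
      \sum_(s in heavy) x s * (if s \in nb v then kR - 1 else kR).
    rewrite [RHS](big_setID (nb v)) /= !big_distrr /= setIC; congr (_ + _).
      by apply: eq_bigr => s /setIP[-> _]; rewrite mulrC.
    by apply: eq_bigr => s /setDP[_ /negPf->]; rewrite mulrC.
  by rewrite -big_split /=; apply: eq_bigr => s _; rewrite /g; case: (s \in nb v); ring.
rewrite gE in eqn; lra.
Qed.

(** As [x v = 1], the neighbourhood of [v] has weight [mu]. So [heavy_weight] and [light_mass] bound
    [mu * (mu - kR + 1)] by [kR * (n%:R - 1)] minus the deficits, while [mu_ge] bounds it below by
    [kR * (n%:R - kR)]. The difference of these two bounds is [kR * (kR - 1)]. *)
Lemma budget : exists T : {set V}, [/\ T \subset heavy, #|T| = k.-1,
  (forall t u, t \in T -> u \in heavy :\: T -> x u <= x t),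
  mu * (mu - kR + 1) <= kR * (n%:R - 1) &
  5 * (#|hnbr|%:R * (\sum_(t in T) (1 - x t)) + kR * (\sum_(u in hnon) (1 - x u)))
    + kR * #|light|%:R <= 5 * kR * (kR - 1)].
Proof.
have [T [sT cT topT]] := top_set x (geq_minr k.-1 #|heavy|).
have cT' : (#|T| = k.-1)%N \/ T = heavy.
  case: (leqP k.-1 #|heavy|) => le; first by left; rewrite cT (minn_idPl le).
  right; apply/eqP; rewrite eqEcard sT cT leq_min leqnn ltnW //.
have hw := heavy_weight sT cT' topT.
have lm := light_mass.
have eqv := eig v; rewrite nsumE sum_nbr xv mulr1 in eqv.
have nE : n%:R = #|hnbr|%:R + #|hnon|%:R + #|light|%:R + 1 :> R.
  by rewrite -card_split -addn1 !natrD.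
have xT : \sum_(t in T) x t <= #|T|%:R.
  by rewrite -sumr_const; apply: ler_sum => t _; exact: x1.
have xW : \sum_(u in hnon) x u <= #|hnon|%:R.
  by rewrite -sumr_const; apply: ler_sum => t _; exact: x1.
have h1 : 5 * (mu * (mu - kR + 1)) <= 5 * (#|hnbr|%:R * (1 + \sum_(t in T) x t) +
    kR * \sum_(u in hnon) x u) + 4 * kR * #|light|%:R.
  by rewrite -{1}eqv; lra.
have k2 := kR_ge2; have n2 := nR_ge.
have N0 : 0 <= #|hnbr|%:R :> R by exact: ler0n.
have F0 : 0 <= #|light|%:R :> R by exact: ler0n.
have kF : 0 <= kR * #|light|%:R by rewrite mulr_ge0 // ler0n.
(* Otherwise almost all vertices are light and contribute only [4 / 5 * kR] each, too little for
   [mu_ge]. *)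
have cTk : #|T| = k.-1.
  case: cT' => // TE; apply/eqP; rewrite eqn_leq; apply/andP; split.
    by rewrite cT geq_minl.
  rewrite leqNgt; apply/negP=> lt.
  have Tle : #|T|%:R <= kR - 2.
    have : #|T|.+1%:R <= (k.-1)%:R :> R by rewrite ler_nat.
    by rewrite predkR -addn1 natrD; lra.
  have NW : #|hnbr|%:R + #|hnon|%:R <= kR - 2.
    apply: le_trans Tle; rewrite TE -natrD ler_nat.
    by rewrite -[X in (X + _ <= _)%N]/(#|nb v :&: heavy|) setIC cardsID.
  have h2 : #|hnbr|%:R * (1 + \sum_(t in T) x t) <= #|hnbr|%:R * kR.
    by apply: ler_wpM2l => //; lra.
  have h3 : kR * (\sum_(u in hnon) x u) <= kR * #|hnon|%:R by apply: ler_wpM2l; lra.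
  have h4 : kR * (#|hnbr|%:R + #|hnon|%:R) <= kR * (kR - 2) by apply: ler_wpM2l; lra.
  have h5 : 13 * kR ^+ 2 * kR <= n%:R * kR by apply: ler_wpM2r; lra.
  have h6 : 2 * kR ^+ 2 <= kR ^+ 3 by rewrite exprS; apply: ler_wpM2r; rewrite ?sqr_ge0.
  have h7 : 0 <= kR ^+ 2 by exact: sqr_ge0.
  move: mu_ge h1; rewrite nE => mg h1; rewrite nE in h5; clear lt TE cT topT sT; nra.
have NT : #|hnbr|%:R * (\sum_(t in T) (1 - x t)) =
    #|hnbr|%:R * (kR - 1) - #|hnbr|%:R * (\sum_(t in T) x t).
  by rewrite sumrB sumr_const cTk predkR mulrBr.
have NW : \sum_(u in hnon) (1 - x u) = #|hnon|%:R - \sum_(u in hnon) x u.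
  by rewrite sumrB sumr_const.
exists T; split=> //.
  have h2 : #|hnbr|%:R * (1 + \sum_(t in T) x t) <= #|hnbr|%:R * kR.
    by apply: ler_wpM2l => //; move: xT; rewrite cTk predkR; lra.
  have h3 : kR * (\sum_(u in hnon) x u) <= kR * #|hnon|%:R by apply: ler_wpM2l; lra.
  rewrite nE; lra.
by rewrite NT NW; move: mu_ge; rewrite nE; lra.
Qed.

(** The analogue of [lossy_weight] with the weights on the side of the neighbours of [v]. *)
Lemma hnon_nbr_mass :
  \sum_(u in hnbr) x u * #|hnon :&: nb u|%:R <=
    (kR - 1) * (\sum_(u in hnbr) x u) + kR * #|hnon|%:R.
Proof.
pose g u : R := #|hnon :&: nb u|%:R - (kR - 1); pose P := [set u | 0 < g u].
have := @ler_sum_cond R V hnbr P x g (fun s _ => x0 s) (fun s _ => x1 s) (fun s _ => in_set _ _).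
have -> : \sum_(s in hnbr) x s * g s =
    \sum_(s in hnbr) x s * #|hnon :&: nb s|%:R - (kR - 1) * \sum_(s in hnbr) x s.
  by rewrite big_distrr -sumrB /=; apply: eq_bigr => s _; rewrite /g; ring.
have sN : hnbr :&: P \subset nb v by apply/subsetP=> u /setIP[/setIP[]].
have vW : v \notin hnon by apply/negP=> /setDP[]; rewrite (negPf v_heavy).
have := arcs_lossy esym eirr k_gt1 circ sN vW.
rewrite exchange_big /=.
have -> : (\sum_(u in hnbr :&: P) \sum_(s in hnon) e s u =
    \sum_(u in hnbr :&: P) #|hnon :&: nb u|)%N.
  by apply: eq_bigr => u _; rewrite -card_nbI; apply: eq_bigr => s _; rewrite esym.
rewrite -(ler_nat R) natr_sum natrD !natrM predkR.
rewrite /g sumrB sumr_const -[(kR - 1) *+ _]mulr_natl; lra.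
Qed.

(** The eigenvector equation is summed over [hnon]. Its vertices, of weight almost 1, require nearly
    [mu] each; they receive little from [hnbr] by [hnon_nbr_mass], and at most [4 k] each from
    within by [degenerate_count]. *)
Lemma hnon_small : \sum_(u in hnon) (1 - x u) <= kR - 1 -> (#|hnon| < 4 * k)%N.
Proof.
move=> def; rewrite ltnNge; apply/negP=> big.
have circ' c : uniq c -> cycle e c -> (2 < size c)%N -> (size c <= (2 * k).+1)%N.
  by move=> *; rewrite -addn1; apply: circ.
have := degenerate_count esym eirr (D := 2 * k) (U := hnon) circ'.
have k0 : (0 < 2 * k)%N by rewrite muln_gt0 /= ltnW.
have le2k : (2 * k <= #|hnon|)%N by apply: leq_trans big; rewrite leq_mul2r orbT.
move=> /(_ k0 le2k); rewrite -(ler_nat R) natrD !natrM natr_sum => dg.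
have vW : v \notin hnon by apply/negP=> /setDP[]; rewrite (negPf v_heavy).
have eqW : mu * (\sum_(w in hnon) x w) =
    \sum_(u in hnbr) x u * #|hnon :&: nb u|%:R + \sum_(u in hnon) x u * #|hnon :&: nb u|%:R.
  rewrite big_distrr /=; under eq_bigr => w _ do rewrite -eig.
  transitivity (\sum_(w in hnon) \sum_(u in heavy | e w u) x u).
    apply: eq_bigr => w /setDP[hw nw]; apply: eq_bigl => u.
    apply/idP/andP => [ewu|[]//]; split=> //; apply: (heavy_nbr hw) => //.
    by apply: contraNneq nw => <-; rewrite inE esym.
  rewrite -[hnbr]/(nb v :&: heavy) setIC -[X in _ = _ + X]/(\sum_(u in heavy :\: nb v) _).
  transitivity (\sum_(u in heavy) x u * #|hnon :&: nb u|%:R); last by rewrite [LHS](big_setID (nb v)).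
  under eq_bigr => w _ do rewrite big_mkcondr.
  rewrite exchange_big /=; apply: eq_bigr => u hu.
  rewrite -card_nbI natr_sum big_distrr /=; apply: eq_bigr => w _.
  by rewrite esym; case: (e u w); rewrite ?mulr1 ?mulr0.
have h1 : \sum_(u in hnon) x u * #|hnon :&: nb u|%:R <= \sum_(u in hnon) #|nb u :&: hnon|%:R.
  by apply: ler_sum => u _; rewrite setIC ler_piMl // ler0n.
have h2 := hnon_nbr_mass.
have h3 : \sum_(u in hnbr) x u <= mu.
  rewrite -[mu]mulr1 -xv -eig nsumE sum_nbr lerDl; apply: sumr_ge0 => u _; exact: x0.
have h4 : #|hnon|%:R - (kR - 1) <= \sum_(w in hnon) x w.
  by move: def; rewrite sumrB sumr_const; lra.
have h5 := ler_wpM2l mu_ge0 h4.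
have k2 := kR_ge2.
have h6 : (kR - 1) * (\sum_(u in hnbr) x u) <= (kR - 1) * mu by apply: ler_wpM2l; lra.
have h7 : 13 * kR ^+ 3 - kR ^+ 2 <= mu * (mu - kR + 1).
  apply: le_trans mu_ge; have k0' : 0 <= kR by lra.
  have := ler_wpM2l k0' nR_ge; rewrite !exprS; lra.
have h8 : mu * (#|hnon|%:R - (kR - 1)) <=
    (kR - 1) * mu + 5 * kR * #|hnon|%:R - 2 * kR * (2 * kR + 1).
  have e1 : (2 * k).+1%:R = 2 * kR + 1 :> R by rewrite -addn1 natrD natrM.
  rewrite e1 in dg; lra.
have := nonadjacent_numeric k2 mu_ge21 h7 h8.
by rewrite -natrM ltr_nat ltnNge big.
Qed.

End Setup.

(** * The structure outside the hubs *)

Section HubNumeric.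
Variable R : realFieldType.
Implicit Types k mu n N W F D E Y : R.

(** [N], [W], [F] are the sizes of [hnbr], [hnon], [light], and [D], [E] the deficits of [T] and
    [hnon]. The budget gives [F <= 5 * (k - 1)], hence [9 * k - 5], which is
    [(4 * k - 1) + 5 * (k - 1) + 1]. The last bound holds because [N >= 13 * k * (k - 1)]. *)
Lemma hub_budget k mu n N W F D E : 2 <= k -> 13 * k ^+ 2 <= n -> 100 * mu <= 21 * n ->
    n = N + W + F + 1 -> W <= 4 * k - 1 -> 0 <= N -> 0 <= F -> 0 <= D -> 0 <= E ->
    5 * (N * D + k * E) + k * F <= 5 * k * (k - 1) ->
  [/\ n - N <= 9 * k - 5, 5 * (1 + mu) <= 2 * N, 10 * (n + mu) <= 17 * N,
    N * D + k * E <= k * (k - 1) & 13 * D <= 1].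
Proof.
move=> k2 hn hmu nE hW N0 F0 D0 E0 bud.
have k0 : 0 < k by lra.
have kk : 0 <= (k - 2) * k by rewrite mulr_ge0 //; lra.
have k22 : 0 <= (k - 2) ^+ 2 by exact: sqr_ge0.
have ND : 0 <= N * D by exact: mulr_ge0.
have kE : 0 <= k * E by rewrite mulr_ge0 //; lra.
have kF : 0 <= k * F by rewrite mulr_ge0 //; lra.
have F5 : F <= 5 * (k - 1) by rewrite -(ler_pM2l k0); lra.
have nN : n - N <= 9 * k - 5 by lra.
split; [by []|lra|lra|lra|].
rewrite leNgt; apply/negP=> lt.
have : N * 1 < N * (13 * D) by rewrite ltr_pM2l //; lra.
lra.
Qed.

Lemma hub_pair_numeric k mu n d d' Y : 2 <= k -> 13 * k ^+ 2 <= n -> 100 * mu <= 21 * n ->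
    Y <= 4 * k - 1 ->
    k * (n - d) <= k ^+ 2 + mu + k * Y + 17 / 10 * k ^+ 2 * (k - 1) ->
    k * (n - d') <= k ^+ 2 + mu + k * Y + 17 / 10 * k ^+ 2 * (k - 1) ->
  2 * k <= d + d' - n.
Proof.
move=> k2 hn hmu hY hd hd'.
have k0 : 0 < k by lra.
rewrite -(ler_pM2l k0).
have h1 : k * Y <= k * (4 * k - 1) by rewrite ler_pM2l.
have h2 : 0 <= (k - 21 / 50) * (n - 13 * k ^+ 2) by rewrite mulr_ge0 //; lra.
have h3 : 0 <= (k - 2) * k ^+ 2 by rewrite mulr_ge0 ?sqr_ge0 //; lra.
have h4 : 0 <= (k - 2) * k by rewrite mulr_ge0 //; lra.
lra.
Qed.

Lemma hub_center_numeric k mu n d N Y : 2 <= k -> 13 * k ^+ 2 <= n -> 100 * mu <= 21 * n ->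
    Y <= 4 * k - 1 ->
    k * (n - d) <= k ^+ 2 + mu + k * Y + 17 / 10 * k ^+ 2 * (k - 1) ->
    n - N <= 9 * k - 5 ->
  2 * k <= d + N - n.
Proof.
move=> k2 hn hmu hY hd hN.
have k0 : 0 < k by lra.
rewrite -(ler_pM2l k0).
have h0 : k * (n - N) <= k * (9 * k - 5) by rewrite ler_pM2l.
have h1 : k * Y <= k * (4 * k - 1) by rewrite ler_pM2l.
have h2 : 0 <= (k - 21 / 100) * (n - 13 * k ^+ 2) by rewrite mulr_ge0 //; lra.
have h3 : 0 <= (k - 2) * k ^+ 2 by rewrite mulr_ge0 ?sqr_ge0 //; lra.
have h4 : 0 <= (k - 2) * k by rewrite mulr_ge0 //; lra.
lra.
Qed.

(* [z] and [w] bound the weights of the non-hubs having at least two hub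
   neighbours, resp. of the other non-neighbours of the centre; a first bound on
   them is fed back into the estimate of [L]. *)
Lemma bootstrap_numeric k mu L z w N : mu_large k mu -> 5 * (1 + mu) <= 2 * N ->
    0 <= z -> 0 <= w -> 2 * w < 1 ->
    (forall t, w <= t * (1 - w) -> 1 + mu <= t * N -> L <= k - 2 + k * t) ->
    mu * z <= k + z + L -> mu * w <= k - 1 + z + L ->
  13 * (L + 2 * z) <= 24 * (k - 1) /\ 13 * z <= 12.
Proof.
move=> hl hN z0 w0 w2 hL hz hw.
have [k2 km] : 2 <= k /\ 5 * k <= mu.
  by case/or3P: hl => [/andP[/eqP-> h]|/andP[/eqP-> h]|/andP[k4 h]]; lra.
(* The value [t = 1] is admissible because [2 * w < 1]. The later values of [t] are [w / (1 - w)],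
   rounded up, for the improved bounds on [w]. *)
have L1 : L <= 2 * k - 2 by have := hL 1; lra.
case/or3P: hl => [/andP[/eqP kE h]|/andP[/eqP kE h]|/andP[k4 h]].
- subst k; have z1 : z <= 422 / 1000.
    have : (21 / 2 - 1) * z <= (mu - 1) * z by rewrite ler_wpM2r //; lra.
    lra.
  have w1 : w <= 326 / 1000.
    have : (21 / 2) * w <= mu * w by rewrite ler_wpM2r //; lra.
    lra.
  have L2 : L <= 968 / 1000 by have := hL (484 / 1000); lra.
  have : (21 / 2 - 1) * z <= (mu - 1) * z by rewrite ler_wpM2r //; lra.
  lra.
- subst k; have z1 : z <= 379 / 1000.
    have : (39 / 2 - 1) * z <= (mu - 1) * z by rewrite ler_wpM2r //; lra.
    lra.
  have w1 : w <= 328 / 1000.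
    have : (39 / 2) * w <= mu * w by rewrite ler_wpM2r //; lra.
    lra.
  have L2 : L <= 1 + 3 * (489 / 1000) by have := hL (489 / 1000); lra.
  have : (39 / 2 - 1) * z <= (mu - 1) * z by rewrite ler_wpM2r //; lra.
  lra.
have zz : (15 / 2 * k - 1) * z <= (mu - 1) * z by rewrite ler_wpM2r //; lra.
have ww : (15 / 2 * k) * w <= mu * w by rewrite ler_wpM2r //; lra.
have z1 : z <= 2 / 5.
  rewrite leNgt; apply/negP=> lt.
  have : (15 / 2 * k - 1) * (2 / 5) < (15 / 2 * k - 1) * z by rewrite ltr_pM2l //; lra.
  lra.
have w1 : w <= 2 / 5.
  rewrite leNgt; apply/negP=> lt.
  have : (15 / 2 * k) * (2 / 5) < (15 / 2 * k) * w by rewrite ltr_pM2l //; lra.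
  lra.
have L2 : L <= k - 2 + k * (2 / 3) by have := hL (2 / 3); lra.
have z2 : z <= 37 / 100.
  rewrite leNgt; apply/negP=> lt.
  have : (15 / 2 * k - 1) * (37 / 100) < (15 / 2 * k - 1) * z by rewrite ltr_pM2l //; lra.
  lra.
lra.
Qed.

End HubNumeric.

Section Hubs.
Variables (R : realType) (V : finType) (e : rel V).
Hypotheses (esym : symmetric e) (eirr : irreflexive e).
Variable k : nat.
Hypothesis k_gt1 : (1 < k)%N.
Hypothesis circ : forall c, uniq c -> cycle e c -> (2 < size c)%N -> (size c <= 2 * k + 1)%N.
Notation nb := (nb e).
Notation n := #|V|.
Hypothesis n_ge : (13 * k ^ 2 <= n)%N.
Variables (mu : R) (x : V -> R) (v : V).
Hypotheses (x0 : forall u, 0 <= x u) (x1 : forall u, x u <= 1).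
Hypothesis eig : forall u, nsum e x u = mu * x u.
Hypothesis xv : x v = 1.
Hypothesis mu_ge : k%:R * (n%:R - k%:R) <= mu * (mu - k%:R + 1).
Local Notation kR := (k%:R : R).
Local Notation light := (light e k v).
Local Notation heavy := (heavy e k v).
Local Notation hnbr := (hnbr e k v).
Local Notation hnon := (hnon e k v).
Variable T : {set V}.
Hypotheses (sT : T \subset heavy) (cT : #|T| = k.-1).
Hypothesis topT : forall t u, t \in T -> u \in heavy :\: T -> x u <= x t.
Hypothesis mu_le : mu * (mu - kR + 1) <= kR * (n%:R - 1).
Hypothesis bud : 5 * (#|hnbr|%:R * (\sum_(t in T) (1 - x t)) +
  kR * (\sum_(u in hnon) (1 - x u))) + kR * #|light|%:R <= 5 * kR * (kR - 1).
Let k2 : 2 <= kR. Proof. exact: kR_ge2. Qed.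
Let n_geR : 13 * kR ^+ 2 <= n%:R. Proof. exact: nR_ge. Qed.
Let m0 : 0 <= mu. Proof. exact: mu_ge0 x0 eig xv. Qed.

Local Notation DT := (\sum_(t in T) (1 - x t)).
Local Notation EW := (\sum_(u in hnon) (1 - x u)).
Local Notation Y1 := (\sum_(u in hnon) x u).

Let defT_ge0 : 0 <= DT. Proof. by apply: sumr_ge0 => u _; rewrite subr_ge0. Qed.
Let defW_ge0 : 0 <= EW. Proof. by apply: sumr_ge0 => u _; rewrite subr_ge0. Qed.

Lemma mu_le_n : 100 * mu <= 21 * n%:R.
Proof. exact: mu_upper k2 n_geR mu_le. Qed.

Lemma mu_is_large : mu_large kR mu.
Proof.
apply: mu_cases => //; apply: le_trans mu_ge; rewrite ler_wpM2l ?ler0n //.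
by rewrite lerB.
Qed.

Lemma nR_split : n%:R = #|hnbr|%:R + #|hnon|%:R + #|light|%:R + 1 :> R.
Proof. by rewrite -(card_split e k v) -addn1 !natrD. Qed.

Lemma hnon_le : #|hnon|%:R <= 4 * kR - 1.
Proof.
have def : EW <= kR - 1.
  have kp : 0 < kR by rewrite ltr0n ltnW.
  rewrite -(ler_pM2l kp).
  have : 0 <= #|hnbr|%:R * DT by rewrite mulr_ge0 // ler0n.
  have : 0 <= kR * #|light|%:R by rewrite mulr_ge0 ?ler0n.
  move: bud; lra.
have := hnon_small esym eirr k_gt1 circ n_ge x0 x1 eig xv mu_ge def.
by rewrite -(ltr_nat R) natrM => lt; rewrite lerBrDr -natrM natr1 ler_nat -(ltr_nat R) natrM.
Qed.

Lemma hub_facts :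
  [/\ n%:R - #|hnbr|%:R <= 9 * kR - 5, 5 * (1 + mu) <= 2 * #|hnbr|%:R,
    10 * (n%:R + mu) <= 17 * #|hnbr|%:R,
    #|hnbr|%:R * DT + kR * EW <= kR * (kR - 1) & 13 * DT <= 1].
Proof.
exact: hub_budget k2 n_geR mu_le_n nR_split hnon_le _ _ defT_ge0 defW_ge0 bud.
Qed.

Lemma nonneighbour_mass_le : Y1 <= 4 * kR - 1.
Proof.
by apply: le_trans hnon_le; rewrite -sumr_const; apply: ler_sum => u _; exact: x1.
Qed.

Lemma nonneighbour_mass_ge0 : 0 <= Y1.
Proof. by apply: sumr_ge0 => u _; exact: x0. Qed.

(** A walk of length two from a heavy [c] can reach [light] only through [v], so only at neighbours
    of [v]. Hence [B] omits the light non-neighbours; what remains, [c] included, is [v], its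
    neighbours and [hnon], of weight [1 + mu + Y1]. *)
Lemma heavy_degree c : c \in heavy ->
  mu ^+ 2 * x c <= #|nb c|%:R * (x c + (kR - 1)) + kR * (1 + mu + Y1 - x c).
Proof.
move=> hc; pose B := ~: (c |: (light :\: nb v)).
have cB : c \notin B by rewrite !inE eqxx.
have cv : c != v by apply: contraTneq hc => ->; exact: v_heavy.
have hB u s : e c u -> e u s -> s != c -> s \in B.
  move=> ecu eus sc; rewrite in_setC in_setU1 in_setD negb_or sc /= negb_and negbK.
  case: (eqVneq u v) => [uv|uv]; first by rewrite inE -uv eus.
  have hu := heavy_nbr esym hc ecu uv.
  case: (eqVneq s v) => [->|sv]; first by rewrite v_light orbT.
  have := heavy_nbr esym hu eus sv; rewrite heavyE lightE => /andP[_].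
  by rewrite ltnNge => /negPf->; rewrite andbF orbT.
have := center_bound esym eirr k_gt1 circ x0 x1 eig cB hB.
rewrite predkR //; suff -> : \sum_(s in B) x s = 1 + mu + Y1 - x c by [].
have cl : c \notin light :\: nb v.
  by move: hc; rewrite !inE !negb_or => /andP[_ /negPf->]; rewrite andbF.
have tot : \sum_u x u = \sum_(u in B) x u + (x c + \sum_(u in light :\: nb v) x u).
  rewrite (bigID (mem B)) /=; congr (_ + _).
  by rewrite -big_setU1 //=; apply: eq_bigl => u; rewrite in_setC negbK.
have tot' : \sum_u x u = 1 + mu + Y1 + \sum_(u in light :\: nb v) x u.
  have vE : mu = \sum_(u in nb v) x u by rewrite -nsumE eig xv mulr1.
  rewrite vE (sum_nbr eirr k v) (bigD1 v) //= xv.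
  have -> : \sum_(u | u != v) x u = \sum_(u in heavy) x u + \sum_(u in light) x u.
    rewrite (bigID (mem light)) addrC /=; congr (_ + _); apply: eq_bigl => u.
      by rewrite lightE; case: (u == v).
    by rewrite -[heavy]/(~: (v |: light)) in_setC in_setU1 negb_or.
  rewrite (big_setID (nb v)) [\sum_(u in light) _](big_setID (nb v)) /=.
  by rewrite ![_ :&: nb v]setIC -!addrA; congr (_ + (_ + _)); rewrite addrCA.
lra.
Qed.

(** The deficit [1 - x t] costs at most [kR * (n%:R + mu)] times itself in [heavy_degree]. With
    [10 * (n%:R + mu) <= 17 * #|hnbr|%:R] and the budget this gives the term with [17 / 10]. *)
Lemma hub_degree t : t \in T ->
  kR * (n%:R - #|nb t|%:R) <= kR ^+ 2 + mu + kR * Y1 + 17 / 10 * kR ^+ 2 * (kR - 1).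
Proof.
move=> Tt; have kk := k2; have mm := m0; have hd := heavy_degree (subsetP sT t Tt).
have [_ _ h3 h4 _] := hub_facts.
have d0 : 0 <= 1 - x t by rewrite subr_ge0.
have dD : 1 - x t <= DT.
  rewrite (bigD1 t) //= lerDl; apply: sumr_ge0 => u _; by rewrite subr_ge0.
have Nt : #|hnbr|%:R * (1 - x t) <= kR * (kR - 1).
  have : #|hnbr|%:R * (1 - x t) <= #|hnbr|%:R * DT by rewrite ler_wpM2l ?ler0n.
  have : 0 <= kR * EW by rewrite mulr_ge0 ?ler0n.
  lra.
have dt0 : 0 <= #|nb t|%:R :> R by exact: ler0n.
move: (x t) (#|nb t|%:R : R) d0 Nt dt0 hd => y d d0 Nt dt0 hd.
have h5 : (mu ^+ 2 + kR) * (1 - y) <= kR * (n%:R + mu) * (1 - y).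
  by rewrite ler_wpM2r //; move: mu_le; lra.
have h6 : kR * ((1 - y) * (10 * (n%:R + mu))) <= kR * ((1 - y) * (17 * #|hnbr|%:R)).
  by rewrite ler_wpM2l ?ler0n // ler_wpM2l.
have h7 : kR * (#|hnbr|%:R * (1 - y)) <= kR * (kR * (kR - 1)) by rewrite ler_wpM2l ?ler0n.
have h8 : 0 <= (1 - y) * d by exact: mulr_ge0.
move: mu_ge; lra.
Qed.

Definition hubs := v |: T.

Lemma card_hubs : #|hubs| = k.
Proof.
have vT : v \notin T by apply: contra (v_heavy e k v); exact: subsetP.
by rewrite cardsU1 vT cT add1n prednK // ltnW.
Qed.

Lemma card_common a b : #|nb a|%:R + #|nb b|%:R - n%:R <= #|nb a :&: nb b|%:R :> R.
Proof.
rewrite lerBlDr -!natrD ler_nat -cardsUI addnC leq_add2l; exact: max_card.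
Qed.

Lemma center_degree : #|hnbr|%:R <= #|nb v|%:R :> R.
Proof. by rewrite ler_nat; apply/subset_leq_card/subsetIl. Qed.

Lemma hub_common h h' : h \in hubs -> h' \in hubs -> h != h' ->
  (2 * k <= #|nb h :&: nb h'|)%N.
Proof.
have kk := k2; have nn := n_geR; have hY := nonneighbour_mass_le.
have [hN _ _ _ _] := hub_facts; have hv := center_degree.
have cen t : t \in T -> (2 * k <= #|nb v :&: nb t|)%N.
  move=> Tt; rewrite -(ler_nat R) natrM setIC; apply: le_trans (card_common t v).
  have := hub_center_numeric kk nn mu_le_n hY (hub_degree Tt) hN; lra.
rewrite !in_setU1 => /orP[/eqP->|Th] /orP[/eqP->|Th']; rewrite ?eqxx // => _.
- exact: cen.
- by rewrite setIC; exact: cen.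
rewrite -(ler_nat R) natrM; apply: le_trans (card_common h h').
exact: hub_pair_numeric kk nn mu_le_n hY (hub_degree Th) (hub_degree Th').
Qed.

(* Otherwise [hubs] together with the heaviest such vertex lie on a cycle of length
   [2 k + 2]. *)
Lemma nonneighbour_weight_lt w : w \in hnon :\: T -> 2 * x w < 1.
Proof.
move=> Ww; rewrite ltNge; apply/negP=> xw.
have [z Wz maxz] := @arg_maxP _ _ V w [in hnon :\: T] x Ww.
have {w Ww xw}xz : 1 <= 2 * x z.
  by apply: le_trans xw _; rewrite ler_pM2l //; exact: maxz.
move: Wz; rewrite /= => Wz; have [zW zT] := setDP Wz; have [hz nz] := setDP zW.
have kk := k2; have [hN _ _ h4 _] := hub_facts.
(* By the choice of [z], the deficit of [hnon] is at least [1 - x z] for each element outside [T];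
   at most [k.-1] elements lie in [T], and count with weight 1. *)
have hYz : (1 - x z) * Y1 <= kR - 1.
  have sW : \sum_(u in hnon :\: T) (1 - x z) <= EW.
    rewrite [X in _ <= X](big_setID T) /= -[X in X <= _]add0r; apply: lerD.
      by apply: sumr_ge0 => u _; rewrite subr_ge0.
    by apply: ler_sum => u Wu; rewrite lerD2l lerN2; apply: maxz.
  rewrite sumr_const -[_ *+ _]mulr_natr in sW.
  have hYT : Y1 <= kR - 1 + x z * #|hnon :\: T|%:R.
    rewrite (big_setID T) /=; apply: lerD.
      apply: le_trans (_ : \sum_(u in hnon :&: T) 1 <= _); first exact: ler_sum.
      rewrite sumr_const -predkR // ler_nat -cT; exact/subset_leq_card/subsetIr.
    apply: le_trans (_ : \sum_(u in hnon :\: T) x z <= _); first by apply: ler_sum.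
    by rewrite sumr_const -[_ *+ _]mulr_natr.
  have z1 := x1 z; have z0 := x0 z.
  have h5 : (1 - x z) * Y1 <= (1 - x z) * (kR - 1 + x z * #|hnon :\: T|%:R).
    by rewrite ler_wpM2l // subr_ge0.
  have h6 : x z * ((1 - x z) * #|hnon :\: T|%:R) <= x z * (kR - 1).
    rewrite ler_wpM2l //; apply: le_trans sW _.
    have kp : 0 < kR by rewrite ltr0n ltnW.
    rewrite -(ler_pM2l kp).
    have : 0 <= #|hnbr|%:R * DT by rewrite mulr_ge0 // ler0n.
    lra.
  lra.
have hom := omega_numeric mu_is_large _ (_ : 1 / 2 <= x z) (x1 z)
  nonneighbour_mass_ge0 nonneighbour_mass_le hYz.
(* The left side exceeds the bound of [hub_degree] by [2 * kR ^+ 2], so that [z] shares [2 k]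
   neighbours with every element of [T]. *)
have {}hom : 3 * kR ^+ 2 + mu + kR * Y1 + 17 / 10 * kR ^+ 2 * (kR - 1) <= kR * #|nb z|%:R.
  have xk : 0 < x z + kR - 1 by lra.
  rewrite -(ler_pM2l xk); apply: le_trans (hom _ _) _; last first.
  - have := ler_wpM2l (_ : 0 <= kR) (heavy_degree hz); rewrite ler0n => /(_ isT); lra.
  - lra.
  apply: le_trans mu_ge; rewrite ler_wpM2l ?ler0n // lerB //.
have kp : 0 < kR by lra.
have com t : t \in T -> (2 * k <= #|nb z :&: nb t|)%N.
  move=> Tt; rewrite -(ler_nat R) natrM; apply: le_trans (card_common z t).
  rewrite -(ler_pM2l kp); have := hub_degree Tt; lra.
(* Neighbours of [z] that are not neighbours of [v] lie in [hnon], which is small. *)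
have comv : (2 * k <= #|nb z :&: nb v|)%N.
  have sz : nb z \subset (nb z :&: nb v) :|: (hnon :\ z).
    apply/subsetP=> u; rewrite inE => ezu; have uz : u != z.
      by apply: contraTneq ezu => ->; rewrite eirr.
    have uv : u != v by apply: contraNneq nz => <-; rewrite inE esym.
    have hu := heavy_nbr esym hz ezu uv.
    by rewrite in_setU in_setI in_setD1 in_setD hu uz inE ezu /= andbT; case: (u \in nb v).
  have := subset_leq_card sz; rewrite -(ler_nat R) => le.
  have cU : #|(nb z :&: nb v) :|: (hnon :\ z)|%:R <= #|nb z :&: nb v|%:R + #|hnon :\ z|%:R :> R.
    by rewrite -natrD ler_nat cardsU leq_subr.
  have cz : #|hnon|%:R = 1 + #|hnon :\ z|%:R :> R by rewrite (cardsD1 z hnon) zW natrD.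
  rewrite -(ler_nat R) natrM -(ler_pM2l kp).
  have hW := hnon_le; have Y0 := nonneighbour_mass_ge0.
  have m21 := mu_ge21 k_gt1 n_ge x0 eig xv mu_ge.
  have kY : 0 <= kR * Y1 by rewrite mulr_ge0 // ler0n.
  have k3 : 0 <= (kR - 2) ^+ 2 * kR by rewrite mulr_ge0 ?sqr_ge0 ?ler0n.
  have h5 : kR * #|nb z|%:R <= kR * (#|nb z :&: nb v|%:R + (4 * kR - 2)).
    by rewrite ler_wpM2l ?ler0n //; lra.
  have k4 : 0 <= (kR - 2) * kR by rewrite mulr_ge0 ?ler0n // subr_ge0.
  lra.
have cL : #|z |: hubs| = k.+1.
  rewrite cardsU1 card_hubs in_setU1 negb_or zT; case: eqVneq => [zv|//].
  by move: hz; rewrite zv (negPf (v_heavy e k v)).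
have com' h h' : h \in z |: hubs -> h' \in z |: hubs -> h != h' ->
    (2 * k <= #|nb h :&: nb h'|)%N.
  have comz h0 : h0 \in hubs -> (2 * k <= #|nb z :&: nb h0|)%N.
    by rewrite in_setU1 => /orP[/eqP->|/com].
  rewrite !(in_setU1 _ z) => /orP[/eqP->|Lh] /orP[/eqP->|Lh']; rewrite ?eqxx // => hh'.
  - exact: comz.
  - by rewrite setIC; exact: comz.
  - exact: hub_common.
have [||c [uc cc sc]] := hub_cycle esym eirr com'.
- by rewrite cL ltnS ltnW.
- by rewrite cL; clear; lia.
by have := circ uc cc; rewrite sc cL; move: k_gt1; clear; lia.
Qed.

(** A cycle can enter and leave a vertex of [multi] through different hubs. The construction with
    two separate edges needs [full]. The vertices of [sparse] are incompatible with such cycles, but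
    miss at least [k - 1] hubs. *)
Definition multi := [set u in ~: hubs | (1 < #|hubs :&: nb u|)%N].
Definition full := [set u in multi | hubs \subset nb u].
Definition sparse := heavy :\: (hubs :|: multi).
Local Notation Lam := (\sum_(u in sparse) x u).

Lemma multiP u : reflect (u \notin hubs /\ exists h h', [/\ h \in hubs, h' \in hubs, h != h', e u h & e u h'])
  (u \in multi).
Proof.
rewrite [u \in multi]in_set in_setC; apply: (iffP andP) => -[uL].
  case/card_gt1P=> h [h' []]; rewrite !in_setI ![_ \in nb _]inE => /andP[hL uh] /andP[hL' uh'] hh'.
  by split=> //; exists h, h'.
case=> h [h' [hL hL' hh' uh uh']]; split=> //; apply/card_gt1P; exists h, h'.
by rewrite !in_setI ![_ \in nb _]inE hL hL' uh uh'.
Qed.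

Lemma v_hub : v \in hubs. Proof. exact: setU11. Qed.

Lemma multi_heavy u : u \in multi -> u \in heavy.
Proof.
case/multiP=> uL [h [h' [hL hL' hh' uh uh']]].
have uv : u != v by apply: contraNneq uL => ->; exact: v_hub.
have key t : t \in T -> e u t -> u \in heavy.
  by move=> Tt ut; apply: (heavy_nbr esym (subsetP sT t Tt)); rewrite // esym.
move: hL hL' hh'; rewrite !in_setU1 => /orP[/eqP->|Th _ _]; last exact: key uh.
by case/orP=> [/eqP->|Th' _]; [rewrite eqxx | exact: key uh'].
Qed.

Lemma segment_ends a b : a \in multi -> b \in multi ->
  exists h h', [/\ h \in hubs, h' \in hubs, h != h', e h' a & e b h].
Proof.
case/multiP=> _ [h1 [h2 [h1L h2L h12 ah1 ah2]]] /multiP[_ [h [_ [hL _ _ bh _]]]].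
have [hh1|hh1] := eqVneq h h1; last by exists h, h1; rewrite (esym h1).
by exists h, h2; rewrite (esym h2) hh1; split=> //; rewrite -hh1.
Qed.

(** Otherwise [a], [y], [b] form a segment that the hubs close into a cycle of length [2 k + 2]. *)
Lemma multi_neighbour y a b : y \notin hubs -> a \in multi -> b \in multi ->
  e y a -> e y b -> a = b.
Proof.
move=> yL aM bM ya yb; apply/eqP; apply: contraT => ab.
have [h [h' [hL hL' hh' ha hb]]] := segment_ends aM bM.
have [aL _] := multiP _ aM; have [bL _] := multiP _ bM.
have [||||c [uc cc sc]] := @hub_segment_cycle _ _ esym eirr _ _ hub_common h h' a [:: y; b] hL hL' hh' _ _ _ ha hb.
- by rewrite /= esym ya yb.
- rewrite /= !inE negb_or ab !andbT; apply/andP; split.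
    by apply: contraTneq ya => ->; rewrite eirr.
  by apply: contraTneq yb => ->; rewrite eirr.
- by move=> z; rewrite 2!in_cons mem_seq1 => /or3P[]/eqP->.
- by rewrite card_hubs /=; clear; lia.
have := circ uc cc; rewrite sc card_hubs /=; move: k_gt1; clear; lia.
Qed.

Lemma full_edge_cycle a b : a \in full -> b \in full -> e a b ->
  exists c, [/\ uniq c, cycle e c & size c = (2 * k).+1].
Proof.
rewrite [a \in full]in_set [b \in full]in_set => /andP[aM _] /andP[bM _] ab.
have [h [h' [hL hL' hh' ha hb]]] := segment_ends aM bM.
have [aL _] := multiP _ aM; have [bL _] := multiP _ bM.
have [||||c [uc cc sc]] := @hub_segment_cycle _ _ esym eirr _ _ hub_common h h' a [:: b] hL hL' hh' _ _ _ ha hb.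
- by rewrite /= ab.
- by rewrite /= !inE andbT; apply: contraTneq ab => ->; rewrite eirr.
- by move=> z; rewrite in_cons mem_seq1 => /orP[]/eqP->.
- by rewrite card_hubs /=; clear; lia.
by exists c; rewrite sc card_hubs /= addn1.
Qed.

(** Two edges with a common end contradict [multi_neighbour], and two disjoint ones give the cycle
    of [hub_two_edges_cycle], of length [2 k + 2]. *)
Lemma full_edge_unique a b a' b' : a \in full -> b \in full -> a' \in full -> b' \in full ->
  e a b -> e a' b' -> (a' == a) && (b' == b) || (a' == b) && (b' == a).
Proof.
have fullP u : u \in full -> [/\ u \in multi, u \notin hubs & hubs \subset nb u].
  by rewrite [u \in full]in_set => /andP[uM uL]; have [] := multiP _ uM.
move=> /fullP[aM aL aH] /fullP[bM bL bH] /fullP[aM' aL' aH'] /fullP[bM' bL' bH'] ab ab'.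
have [E|na] := eqVneq a' a; first by rewrite E in ab'; rewrite (multi_neighbour aL bM bM' ab ab') eqxx.
have [E|nb'] := eqVneq a' b.
  by rewrite E in ab'; rewrite (multi_neighbour bL aM bM' _ ab') ?eqxx //= esym.
have [E|nc] := eqVneq b' a.
  by rewrite E esym in ab'; rewrite (multi_neighbour aL aM' bM ab' ab) eqxx in nb'.
have [E|nd] := eqVneq b' b.
  by rewrite E esym in ab'; rewrite (multi_neighbour bL aM' aM ab') ?eqxx // esym in na.
have u4 : uniq [:: a; b; a'; b'].
  rewrite /= !inE !negb_or !andbT ![a == _]eq_sym ![b == _]eq_sym na nb' nc nd !andbT /=.
  apply/andP; split; [apply: contraTneq ab => ->|apply: contraTneq ab' => ->]; by rewrite eirr.
have [||||c [uc cc sc]] := @hub_two_edges_cycle _ _ esym eirr _ _ hub_common a b a' b' _ u4 _ _ ab ab'.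
- by rewrite card_hubs.
- by move=> z; rewrite 3!in_cons mem_seq1 => /or4P[]/eqP->.
- have adj u h : hubs \subset nb u -> h \in hubs -> e h u.
    by move=> /subsetP uH /uH; rewrite inE esym.
  by move=> h z hL; rewrite 3!in_cons mem_seq1 => /or4P[]/eqP->; exact: adj.
- by rewrite card_hubs; clear; lia.
have := circ uc cc; rewrite sc card_hubs /=; move: k_gt1; clear; lia.
Qed.

Lemma sum_indicator (A : {set V}) (f : V -> R) :
  \sum_(u in A) f u = \sum_u f u * (u \in A)%:R.
Proof. by rewrite big_mkcond; apply: eq_bigr => u _; case: ifP; rewrite ?mulr1 ?mulr0. Qed.

(** A sparse neighbour of [v] is not adjacent to [t], as [v] is its only hub neighbour. So its
    weight, counted in [mu], is missing in [mu * x t], and can be made up only by neighbours of [t]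
    in [hnon] or [T]. *)
Lemma hub_missed_mass t : t \in T ->
  \sum_(u in sparse :&: nb v) x u <= (1 + mu) * (1 - x t) + \sum_(u in (hnon :\: T) :&: nb t) x u + (kR - 2).
Proof.
move=> Tt; have ht := subsetP sT t Tt.
have tv : t != v by apply: contraTneq ht => ->; exact: v_heavy.
have tL : t \in hubs by rewrite in_setU1 Tt orbT.
pose b : R := (e v t)%:R.
(* If [v] and [t] are adjacent, then [v] is a neighbour of [t] outside [hnbr], and [t] is in [hnbr]
   without being its own neighbour; the terms with [e v t] record this. *)
have pt u : (e t u + (u \in sparse :&: nb v) + (u == t) * e v t <=
   (u == v) * e v t + (u \in hnbr) + (u \in (hnon :\: T) :&: nb t) + (u \in T :\ t))%N.
  have sN : u \in sparse :&: nb v -> [/\ u \in hnbr, ~~ e t u & u != t].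
    rewrite in_setI in_setD in_setU negb_or => /andP[/andP[/andP[uL uM] hu] nu].
    rewrite in_setI nu hu; split=> //; last by apply: contraNneq uL => ->.
    apply: contra uM => etu; apply/multiP; split=> //; exists v, t.
    by split; rewrite ?v_hub // 1?eq_sym // esym //; move: nu; rewrite inE.
  have [uv|uv] := eqVneq u v.
    have -> : (u \in sparse :&: nb v) = false by rewrite uv in_setI (negPf (v_nb eirr v)) andbF.
    by rewrite uv eq_sym (negPf tv) /= mul0n mul1n !addn0 esym -!addnA leq_addr.
  rewrite mul0n add0n.
  have [etu|netu] := boolP (e t u).
    have ut : (u == t) = false by apply: contraTF etu => /eqP->; rewrite eirr.
    have hu := heavy_nbr esym ht etu uv.
    have -> : (u \in sparse :&: nb v) = false by apply/negP=> /sN[_ /negP].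
    rewrite ut mul0n !addn0 in_setI in_setI !in_setD in_set1 hu ut (_ : u \in nb t); last by rewrite inE.
    by case: (u \in nb v); case: (u \in T).
  rewrite add0n; have [ut|ut] := eqVneq u t.
    have -> : (u \in sparse :&: nb v) = false.
      by apply/negP=> /sN[_ _]; rewrite ut eqxx.
    rewrite ut mul1n add0n [_ \in hnbr]in_setI ht andbT [t \in nb v]inE -!addnA leq_addr //.
  rewrite mul0n addn0; have [/sN[-> _ _]|//] := boolP (u \in sparse :&: nb v).
  by rewrite -addnA leq_addr.
have : \sum_u x u * ((e t u)%:R + (u \in sparse :&: nb v)%:R + (u == t)%:R * b) <=
  \sum_u x u * ((u == v)%:R * b + (u \in hnbr)%:R + (u \in (hnon :\: T) :&: nb t)%:R + (u \in T :\ t)%:R).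
  by apply: ler_sum => u _; rewrite ler_wpM2l // /b -!natrM -!natrD ler_nat.
have one (w : V) : \sum_u x u * ((u == w)%:R * b) = x w * b.
  rewrite (bigD1 w) //= eqxx mul1r big1 ?addr0 // => u /negPf->.
  by rewrite mul0r mulr0.
under eq_bigr => u _ do rewrite !mulrDr.
under [X in _ <= X]eq_bigr => u _ do rewrite !mulrDr.
rewrite !big_split /= !one -!sum_indicator xv.
have -> : \sum_u x u * (e t u)%:R = mu * x t.
  by rewrite -eig /nsum [RHS]big_mkcond; apply: eq_bigr => u _; case: (e t u); rewrite ?mulr1 ?mulr0.
have hT : \sum_(u in T :\ t) x u <= kR - 2.
  apply: le_trans (_ : \sum_(u in T :\ t) 1 <= _); first exact: ler_sum.
  have := cardsD1 t T; rewrite Tt cT => /(congr1 (fun m => m%:R : R)).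
  by rewrite /= add1n -natr1 predkR // sumr_const; lra.
have hN : \sum_(u in hnbr) x u <= mu.
  by rewrite -[mu]mulr1 -xv -eig nsumE (sum_nbr eirr k v) lerDl; apply: sumr_ge0.
have b01 : b * (1 - x t) <= 1 - x t.
  by rewrite ler_piMl ?subr_ge0 // /b lern1; case: (e v t).
lra.
Qed.

(** The average of [hub_missed_mass] over [T], plus the sparse non-neighbours of [v], each of which
    has at most one neighbour in [T]. The hypotheses on [t] turn all remaining terms into [t] times
    the deficits, which the budget bounds by [kR * (kR - 1)]. *)
Lemma sparse_mass t : 0 <= t -> (forall u, u \in hnon :\: T -> x u <= t * (1 - x u)) ->
  1 + mu <= t * #|hnbr|%:R -> Lam <= kR - 2 + kR * t.
Proof.
move=> t0 ht tN.
have kk := k2; have [_ _ _ h4 _] := hub_facts.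
have h1 : (kR - 1) * (\sum_(u in sparse :&: nb v) x u) <= (1 + mu) * DT +
    \sum_(u in hnon :\: T) x u * #|T :&: nb u|%:R + (kR - 1) * (kR - 2).
  have -> : (kR - 1) * (\sum_(u in sparse :&: nb v) x u) =
      \sum_(s in T) \sum_(u in sparse :&: nb v) x u.
    by rewrite sumr_const cT -predkR // mulr_natl.
  apply: le_trans (ler_sum _ (fun s Ts => hub_missed_mass Ts)) _.
  rewrite [leLHS]big_split [X in X + _ <= _]big_split /= -big_distrr /= sumr_const cT -(mulr_natl _ k.-1) predkR // lerD2r lerD2l.
  rewrite le_eqVlt; apply/orP; left; apply/eqP.
  under eq_bigr => s _ do rewrite sum_indicator.
  rewrite exchange_big /= [RHS]sum_indicator; apply: eq_bigr => u _.
  rewrite -big_distrr /= -mulrA; congr (_ * _).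
  rewrite -natr_sum -natrM; congr (_%:R).
  rewrite -sum1_card big_distrl /= [LHS]big_mkcond [RHS]big_mkcond /=.
  by apply: eq_bigr => s _; rewrite !in_setI ![_ \in nb _]inE esym; case: (s \in T); case: (u \in _); case: (e u s).
have h2 : (kR - 1) * (\sum_(u in sparse :\: nb v) x u) +
    \sum_(u in hnon :\: T) x u * #|T :&: nb u|%:R <= kR * \sum_(u in hnon :\: T) x u.
  have -> : \sum_(u in sparse :\: nb v) x u = \sum_(u in hnon :\: T) x u * (u \in sparse)%:R.
    rewrite [RHS]big_mkcond [LHS]big_mkcond; apply: eq_bigr => u _.
    rewrite !in_setD !in_setU negb_or in_set1.
    case: (u \in nb v); case: (u \in T); rewrite /= ?andbF ?orbT //= ?orbF.
    case hu: (u \in heavy); rewrite ?andbF ?andbT /= ?mulr0 //.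
    have -> : (u == v) = false by apply: contraTF hu => /eqP->; exact: v_heavy.
    by case: (u \in multi); rewrite ?mulr0 ?mulr1.
  rewrite !big_distrr -big_split /=; apply: ler_sum => u /setDP[_ uT].
  rewrite mulrCA -mulrDr [kR * _]mulrC ler_wpM2l // -predkR // -natrM -natrD ler_nat.
  have cTu : (#|T :&: nb u| <= #|hubs :&: nb u|)%N.
    by apply/subset_leq_card/setSI/subsetUr.
  have cTk : (#|T :&: nb u| <= k.-1)%N by rewrite -cT; apply/subset_leq_card/subsetIl.
  have [us|_] := boolP (u \in sparse); last by rewrite muln0 add0n (leq_trans cTk) ?leq_pred.
  move: us; rewrite in_setD in_setU negb_or => /andP[/andP[uL uM] _].
  have : (#|hubs :&: nb u| <= 1)%N.
    by rewrite leqNgt; apply: contra uM => ?; rewrite [u \in multi]in_set in_setC uL.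
  by move: cTu k_gt1; clear; lia.
have h3 : \sum_(u in hnon :\: T) x u <= t * EW.
  apply: le_trans (_ : \sum_(u in hnon :\: T) t * (1 - x u) <= _); first exact: ler_sum.
  rewrite -big_distrr /= ler_wpM2l // [X in _ <= X](big_setID T) /= lerDr.
  by apply: sumr_ge0 => u _; rewrite subr_ge0.
have LE : Lam = \sum_(u in sparse :&: nb v) x u + \sum_(u in sparse :\: nb v) x u.
  by rewrite (big_setID (nb v)).
have h5 : kR * (\sum_(u in hnon :\: T) x u) <= kR * (t * EW) by rewrite ler_wpM2l ?ler0n.
have h6 : (1 + mu) * DT <= t * #|hnbr|%:R * DT by rewrite ler_wpM2r.
have h7 : t * (#|hnbr|%:R * DT + kR * EW) <= t * (kR * (kR - 1)) by rewrite ler_wpM2l.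
have k1 : 0 < kR - 1 by lra.
rewrite -(ler_pM2l k1) LE; lra.
Qed.

Lemma nsum_heavy u : u \in heavy -> nsum e x u =
  \sum_(w in hubs | e u w) x w + \sum_(w in multi | e u w) x w + \sum_(w in sparse | e u w) x w.
Proof.
move=> hu; rewrite /nsum (bigID (mem hubs)) [X in _ + X = _](bigID (mem multi)) /= addrA.
congr (_ + _ + _); apply: eq_bigl => w; first by rewrite andbC.
  have [wM|] := boolP (w \in multi); rewrite ?andbF ?andbT //=.
  by have [/negPf-> _] := multiP _ wM; rewrite andbT.
rewrite in_setD in_setU negb_or -!andbA; case: (boolP (w \in hubs)) => wL; rewrite ?andbF //=.
case: (boolP (e u w)) => euw; rewrite ?andbF ?andbT //= (heavy_nbr esym hu euw) ?andbT //.
by apply: contraNneq wL => ->; exact: v_hub.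
Qed.

Lemma multi_nbr_mass y z (A : {set V}) : A \subset multi -> (forall u, u \in multi -> x u <= z) -> 0 <= z ->
  y \notin hubs -> \sum_(w in A | e y w) x w <= z.
Proof.
move=> sA hz z0 yL.
have [a /andP[aA ya]|none] := pickP (fun w => (w \in A) && e y w); last first.
  by rewrite big_pred0 // => w; exact: none.
have aM := subsetP sA a aA.
rewrite (big_pred1 a) ?hz // => w; apply/andP/eqP => [[wA yw]|->//].
exact: multi_neighbour yL (subsetP sA w wA) aM yw ya.
Qed.

Lemma sparse_nbr_mass y : \sum_(w in sparse | e y w) x w <= Lam.
Proof.
rewrite [X in _ <= X](bigID (e y)) /= lerDl; exact: sumr_ge0.
Qed.

Lemma hub_nbr_mass (A : {set V}) : \sum_(h in hubs | h \in A) x h <= #|hubs :&: A|%:R.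
Proof.
rewrite -sumr_const [X in _ <= X](eq_bigl (fun h => (h \in hubs) && (h \in A))) => [|h]; last by rewrite in_setI.
exact: ler_sum.
Qed.

Lemma max_weight (A : {set V}) : exists z, [/\ 0 <= z, forall u, u \in A -> x u <= z &
  z = 0 \/ exists2 u, u \in A & z = x u].
Proof.
have [->|[w Aw]] := set_0Vmem A; first by exists 0; split; [| move=> u; rewrite inE | left].
have [z Az maxz] := @arg_maxP _ _ V w [in A] x Aw.
by exists (x z); split=> //; right; exists z.
Qed.

(** The eigenvector equation at the heaviest vertices of [multi] and of [hnon :\: T] bounds their
    weights through [Lam], and [sparse_mass] bounds [Lam] in return. The two final inequalities are
    those needed for sparse and for [multi :\: full] vertices in [qform_hub_rel]. *)
Lemma structure_weights : exists z, [/\ 0 <= z, forall u, u \in multi -> x u <= z,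
  13 * (Lam + 2 * z) <= 24 * (kR - 1) & 13 * z <= 12].
Proof.
have [z [z0 hz zE]] := max_weight multi; have [w [w0 hw wE]] := max_weight (hnon :\: T).
have kk := k2; have mm := m0; have [_ hN _ _ _] := hub_facts.
have L0 : 0 <= Lam by apply: sumr_ge0.
have w2 : 2 * w < 1.
  by case: wE => [->|[u uW ->]]; [rewrite mulr0 | exact: nonneighbour_weight_lt].
have hZ : mu * z <= kR + z + Lam.
  case: zE => [->|[u uM zE]]; first by rewrite mulr0; lra.
  have [uL _] := multiP _ uM.
  rewrite {1}zE -eig (nsum_heavy (multi_heavy uM)).
  apply: lerD (sparse_nbr_mass u); apply: lerD (multi_nbr_mass (subxx _) hz z0 uL).
  have := hub_nbr_mass (nb u); under eq_bigl => h do rewrite [h \in nb u]inE.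
  move/le_trans; apply; rewrite ler_nat -card_hubs; exact/subset_leq_card/subsetIl.
have hW : mu * w <= kR - 1 + z + Lam.
  case: wE => [->|[u uW wE]]; first by rewrite mulr0; lra.
  have [/setDP[hu nu] uT] := setDP uW.
  have uL : u \notin hubs.
    by rewrite in_setU1 negb_or uT andbT; apply: contraTneq hu => ->; exact: v_heavy.
  rewrite {1}wE -eig (nsum_heavy hu).
  apply: lerD (sparse_nbr_mass u); apply: lerD (multi_nbr_mass (subxx _) hz z0 uL).
  have := hub_nbr_mass (nb u); under eq_bigl => h do rewrite [h \in nb u]inE.
  move/le_trans; apply; rewrite -predkR // ler_nat -cT; apply/subset_leq_card/subsetP=> h.
  rewrite in_setI in_setU1 inE => /andP[/orP[/eqP->|//]]; rewrite esym => evu.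
  by move: nu; rewrite inE evu.
have hL t : w <= t * (1 - w) -> 1 + mu <= t * #|hnbr|%:R -> Lam <= kR - 2 + kR * t.
  move=> wt tN; have t0 : 0 <= t.
    rewrite leNgt; apply/negP=> tlt.
    have : t * #|hnbr|%:R <= 0 by rewrite mulr_le0_ge0 ?ler0n // ltW.
    lra.
  apply: sparse_mass => // u uW; apply: le_trans (hw u uW) _; apply: le_trans wt _.
  by rewrite ler_wpM2l // lerD2l lerN2 hw.
have [h1 h2] := bootstrap_numeric mu_is_large hN z0 w0 w2 hL hZ hW.
by exists z.
Qed.

(** By [piece_perron] for all of [light], the left side is [s + mu * Q]. As [#|light| <= 5 (k - 1)],
    one has [5 * l <= 14 * kR], so [15 * l <= 8 * mu] and [mu * Q <= 15 / 7 * s]. *)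
Lemma light_pairs : 2 * (\sum_(u in nb v :&: light) x u) + pairs e x light light <=
  22 / 7 * \sum_(u in light) x u.
Proof.
have sg : \sum_(u in nb v :&: light) x u <= \sum_(u in light) x u.
  by rewrite [X in _ <= X](big_setID (nb v)) /= setIC lerDl; apply: sumr_ge0.
have s0 : 0 <= \sum_(u in nb v :&: light) x u by apply: sumr_ge0.
have [l0|lpos] := posnP #|light|.
  move/eqP: l0; rewrite cards_eq0 => /eqP l0.
  by rewrite /pairs l0 setI0 !big_set0 addr0 !mulr0.
have cl w s : w \in light -> e w s -> s != v -> s \in light by exact: light_nbr.
have [pE [l [l0 hl hQ _]]] := piece_perron esym eirr k_gt1 circ eig xv lpos (v_light e k v) cl.
rewrite /pairs pE; move: hQ sg s0.
set s := (\sum_(u in nb v :&: light) x u); set Q := (\sum_(u in light) x u ^+ 2).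
have Q0 : 0 <= Q by apply: sumr_ge0 => u _; exact: sqr_ge0.
have kk := k2; have m21 := mu_ge21 k_gt1 n_ge x0 eig xv mu_ge.
have F5 : kR * #|light|%:R <= kR * (5 * (kR - 1)).
  have : 0 <= #|hnbr|%:R * DT by rewrite mulr_ge0 // ler0n.
  have : 0 <= kR * EW by rewrite mulr_ge0 // ler0n.
  move: bud; lra.
have l28 : 5 * l <= 14 * kR.
  rewrite leNgt; apply/negP=> lt.
  have : 14 / 5 * kR * (14 / 5 * kR - kR) <= l * (l - kR) by apply: ler_pM; lra.
  have : 0 <= (kR - 2) * kR by rewrite mulr_ge0 ?ler0n // subr_ge0.
  lra.
have h1 : 7 * mu * Q <= 15 * (mu - l) * Q by rewrite ler_wpM2r //; lra.
lra.
Qed.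

Lemma hub_weight h : h \in hubs -> 12 <= 13 * x h.
Proof.
rewrite in_setU1 => /orP[/eqP->|Th]; first by rewrite xv; lra.
have [_ _ _ _ hD] := hub_facts; move: hD; rewrite (bigD1 h) //=.
have : 0 <= \sum_(t in T | t != h) (1 - x t) by apply: sumr_ge0 => u _; rewrite subr_ge0.
lra.
Qed.

Lemma hub_rest_mass u r : (r <= #|hubs :\: nb u|)%N ->
  13 * (\sum_(h in hubs | e u h) x h) + 12 * r%:R <= 13 * \sum_(h in hubs) x h.
Proof.
move=> hr; rewrite [X in _ <= _ * X](bigID (e u)) /= mulrDr lerD2l.
apply: le_trans (_ : 12 * #|hubs :\: nb u|%:R <= _); first by rewrite ler_pM2l // ler_nat.
rewrite -sumr_const !big_distrr /= [X in _ <= X](eq_bigl (fun h => h \in hubs :\: nb u)).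
  by apply: ler_sum => h /setDP[/hub_weight]; rewrite mulr1.
by move=> h; rewrite in_setD [h \in nb u]inE andbC.
Qed.

(** Per unit of weight, with [z] from [structure_weights]: a vertex of [sparse] gains at least
    [24 / 13 * (kR - 1)] at the hubs and loses at most [Lam + 2 * z]; one of [multi :\: full] gains
    [24 / 13] and loses [2 * z]; in [light] the new pairs weigh at least [24 / 13 * kR], the old
    ones at most [22 / 7]. Pairs among hubs and inside [full] persist. *)
Lemma qform_hub_rel t t' :
    (forall a b, a \in full -> b \in full -> e a b -> (a == t) && (b == t') || (a == t') && (b == t)) ->
  qform e x <= qform (hub_rel hubs t t') x.
Proof.
move=> hfull.
have [z [z0 hz hLz hz12]] := structure_weights.
have kk := k2; have L0 : 0 <= Lam by apply: sumr_ge0.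
have hsym := @hub_rel_sym V hubs t t'.
rewrite !pairsT !(pairs_split x _ (subsetT hubs)) // setTD pairs_hub_rel.
pose M := ~: hubs; rewrite -/M.
have hLL : pairs e x hubs hubs <= pairs (hub_rel hubs t t') x hubs hubs.
  apply: pairs_le => // a b aL _ eab; rewrite /hub_rel aL andbT.
  by apply: contraTneq eab => ->; rewrite eirr.
have fM : full \subset multi by apply/subsetP=> u; rewrite [u \in full]in_set => /andP[].
have mM : multi \subset M.
  by apply/subsetP=> u /multiP[uL _]; rewrite in_setC.
have hCC : pairs e x full full <= pairs (hub_rel hubs t t') x M M.
  have fM' := subset_trans fM mM; apply: pairs_le => // a b aF bF eab.
  rewrite /hub_rel hfull // !orbT andbT; apply: contraTneq eab => ->; by rewrite eirr.
have lM : light \subset M.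
  apply/subsetP=> u ul; rewrite in_setC in_setU1 negb_or; apply/andP; split.
    by apply: contraTneq ul => ->; exact: v_light.
  apply: contraTN ul => /(subsetP sT); rewrite -[heavy]/(~: (v |: light)) in_setC in_setU1 negb_or.
  by case/andP.
have ME : M :\: light = heavy :\: hubs.
  apply/setP=> u; rewrite !in_setD in_setC -[heavy]/(~: (v |: light)) in_setC in_setU1 negb_or.
  rewrite andbC; case: (boolP (u \in hubs)) => //= uL.
  by case: eqVneq uL => // ->; rewrite v_hub.
have sH : sparse \subset heavy :\: hubs by apply/setDS/subsetUl.
have HE : (heavy :\: hubs) :\: sparse = multi.
  apply/setP=> u; rewrite !in_setD in_setU negb_or !negb_and !negbK.
  case: (boolP (u \in multi)) => uM /=.
    by have [-> _] := multiP _ uM; rewrite multi_heavy // orbT.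
  by case: (u \in hubs); case: (u \in heavy).
have hMM : pairs e x M M = pairs e x light light + (pairs e x sparse sparse +
    2 * pairs e x sparse multi + (pairs e x full full + 2 * pairs e x (multi :\: full) full +
    pairs e x (multi :\: full) (multi :\: full))).
  rewrite (pairs_split x esym lM) ME (pairs_split x esym sH) HE (pairs_split x esym fM).
  rewrite (pairsC _ full) //; suff -> : pairs e x light (heavy :\: hubs) = 0 by ring.
  apply: big1 => u ul; rewrite big_pred0 ?mulr0 // => w.
  apply/negP=> /andP[/setDP[hw wL] euw].
  have wv : w != v by apply: contraNneq wL => ->; exact: v_hub.
  have := light_nbr esym ul euw wv; move: hw.
  by rewrite -[heavy]/(~: (v |: light)) in_setC in_setU1 negb_or => /andP[_ /negPf->].
have hss : pairs e x sparse sparse <= Lam * Lam.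
  by apply: pairs_le_mass => // a _; exact: sparse_nbr_mass.
have nL a : a \in heavy :\: hubs -> a \notin hubs by case/setDP.
have hsm : pairs e x sparse multi <= z * Lam.
  by apply: pairs_le_mass => // a /(subsetP sH)/nL; exact: multi_nbr_mass.
have hDf : pairs e x (multi :\: full) full <= z * \sum_(u in multi :\: full) x u.
  by apply: pairs_le_mass => // a /setDP[/multiP[aL _] _]; exact: multi_nbr_mass.
have hDm : pairs e x (multi :\: full) full + pairs e x (multi :\: full) (multi :\: full) <=
    z * \sum_(u in multi :\: full) x u.
  rewrite -pairs_splitr //.
  by apply: pairs_le_mass => // a /setDP[/multiP[aL _] _]; exact: multi_nbr_mass.
set X := (\sum_(h in hubs) x h).
have X0 : 12 * kR <= 13 * X.
  have -> : 12 * kR = \sum_(h in hubs) 12 by rewrite sumr_const card_hubs mulr_natr.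
  by rewrite big_distrr; apply: ler_sum => h; exact: hub_weight.
have sub0 (A : {set V}) : 0 <= \sum_(u in A) x u by apply: sumr_ge0.
have hLM : 13 * pairs e x hubs M <= 13 * (\sum_(u in nb v :&: light) x u) +
   (13 * X - 12 * (kR - 1)) * Lam + (13 * X - 12) * (\sum_(u in multi :\: full) x u) +
   13 * X * (\sum_(u in full) x u).
  rewrite (pairs_splitr _ _ _ lM) ME (pairs_splitr _ _ _ sH) HE (pairs_splitr _ _ _ fM).
  rewrite ![pairs e x hubs _]pairsC //.
  have -> : pairs e x light hubs = \sum_(u in nb v :&: light) x u.
    rewrite [RHS]big_mkcond [LHS]big_mkcond; apply: eq_bigr => u _ /=.
    rewrite in_setI [u \in nb v]inE andbC; case: ifP => //= ul.
    have -> : \sum_(h in hubs | e u h) x h = if e v u then 1 else 0.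
      have uh : u \notin heavy.
        by rewrite -[heavy]/(~: (v |: light)) in_setC in_setU1 negb_or ul andbF.
      have huv h : (h \in hubs) && e u h -> h = v.
        case/andP; rewrite in_setU1 => /orP[/eqP//|Th euh].
        case: (eqVneq u v) ul => [->|uv _]; first by rewrite (negPf (v_light e k v)).
        by case/negP: uh; apply: (heavy_nbr esym (subsetP sT h Th)); rewrite // esym.
      case: ifP => evu.
        rewrite (big_pred1 v) ?xv // => h; apply/idP/eqP => [/huv//|->].
        by rewrite v_hub esym evu.
      by rewrite big_pred0 // => h; apply/negP=> hh; move: hh (huv h hh) => /andP[_ uh'] E; rewrite -E esym uh' in evu.
    by case: (e v u); rewrite ?mulr1 ?mulr0.
  have hs : pairs e x sparse hubs <= (X - 12 / 13 * (kR - 1)) * Lam.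
    apply: pairs_le_mass => // u us; have := @hub_rest_mass u k.-1; rewrite predkR //.
    suff -> : (k.-1 <= #|hubs :\: nb u|)%N by move/(_ isT); rewrite -/X; lra.
    move: us; rewrite in_setD in_setU negb_or => /andP[/andP[uL uM] _].
    have : (#|hubs :&: nb u| <= 1)%N.
      by rewrite leqNgt; apply: contra uM => ?; rewrite [u \in multi]in_set in_setC uL.
    by have := cardsID (nb u) hubs; rewrite card_hubs; move: k_gt1; clear; lia.
  have hD : pairs e x (multi :\: full) hubs <= (X - 12 / 13) * \sum_(u in multi :\: full) x u.
    apply: pairs_le_mass => // u /setDP[uM uf]; have := @hub_rest_mass u 1.
    suff -> : (1 <= #|hubs :\: nb u|)%N by move/(_ isT); rewrite -/X; lra.
    rewrite lt0n cards_eq0; apply: contra uf; rewrite setD_eq0 => sub.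
    by rewrite [u \in full]in_set uM.
  have hf : pairs e x full hubs <= X * \sum_(u in full) x u.
    apply: pairs_le_mass => // u _; rewrite /X [X in _ <= X](bigID (e u)) /= lerDl.
    exact: sumr_ge0.
  lra.
have sM : \sum_(u in M) x u = \sum_(u in light) x u + (Lam + (\sum_(u in full) x u + \sum_(u in multi :\: full) x u)).
  rewrite (big_setID light) /= (setIidPr lM) ME; congr (_ + _).
  rewrite (big_setID sparse) /= (setIidPr sH) HE; congr (_ + _).
  by rewrite (big_setID full) /= (setIidPr fM).
have hlp := light_pairs.
rewrite hMM sM; move: hlp hLM hDm hDf hsm hss hCC hLL.
move: (sub0 light) (sub0 full) (sub0 (multi :\: full)) L0.
set S := \sum_(u in nb v :&: light) _; set xl := \sum_(u in light) _; set xf := \sum_(u in full) _.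
set xd := \sum_(u in _ :\: _) _; set xs := \sum_(u in sparse) _.
move=> l0 f0 d0 s0 h1 h2 h3 h4 h5 h6 h7 h8.
have p1 : 0 <= xs * (24 * (kR - 1) - 13 * (xs + 2 * z)) by rewrite mulr_ge0 // subr_ge0.
have p2 : 0 <= xd * (12 - 13 * z) by rewrite mulr_ge0 // subr_ge0.
have p3 : 0 <= xl * (13 * X - 12 * kR) by rewrite mulr_ge0 // subr_ge0.
have p4 : 0 <= xl * (kR - 2) by rewrite mulr_ge0 // subr_ge0.
lra.
Qed.

End Hubs.

(** * Comparison with the extremal graphs *)

Lemma hub_rel_dominates (R : realType) (V : finType) (e : rel V) (k : nat) (mu : R) (x : V -> R) (v : V) :
    symmetric e -> irreflexive e -> (1 < k)%N ->
    (forall c, uniq c -> cycle e c -> (2 < size c)%N -> (size c <= 2 * k + 1)%N) ->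
    (13 * k ^ 2 <= #|V|)%N -> (forall u, 0 <= x u) -> (forall u, x u <= 1) ->
    (forall u, nsum e x u = mu * x u) -> x v = 1 ->
    k%:R * (#|V|%:R - k%:R) <= mu * (mu - k%:R + 1) ->
  exists L : {set V}, [/\ v \in L, #|L| = k,
    exists t t', [/\ t \notin L, t' \notin L, t != t' & qform e x <= qform (hub_rel L t t') x] &
    (forall c, uniq c -> cycle e c -> (2 < size c)%N -> (size c <= 2 * k)%N) ->
      qform e x <= qform (hub_rel L v v) x].
Proof.
move=> esym eirr k1 circ n_ge x0 x1 eig xv mu_ge.
have [T [sT cT topT mu_le bud]] := budget esym eirr k1 circ n_ge x0 x1 eig xv mu_ge.
have cL := card_hubs k1 sT cT.
have dom := qform_hub_rel esym eirr k1 circ n_ge x0 x1 eig xv mu_ge sT cT mu_le bud.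
exists (hubs v T); split=> //; first exact: v_hub.
  have uniqe := full_edge_unique esym eirr k1 circ n_ge x0 x1 eig xv mu_ge sT cT mu_le bud.
  set F := full e v T in dom uniqe.
  have [/existsP[a /existsP[b /and3P[aF bF ab]]] | none] :=
      boolP [exists a, exists b, [&& a \in F, b \in F & e a b]].
    have nh u : u \in F -> u \notin hubs v T.
      by rewrite inE => /andP[/multiP[]].
    exists a, b; split; rewrite ?nh //.
      by apply: contraTneq ab => ->; rewrite eirr.
    by apply: dom => a' b' a'F b'F ab'; apply: uniqe ab ab'.
  (* With no edge inside [full], the condition on [t] and [t'] is vacuous, and any two non-hubs
     serve. *)
  have : (1 < #|~: hubs v T|)%N.
    by have := cardsC (hubs v T); rewrite cL; move: n_ge k1; clear; rewrite expnS expn1; nia.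
  case/card_gt1P=> t [t' []]; rewrite !in_setC => tL t'L tt'; exists t, t'; split=> //.
  apply: dom => a b aF bF ab; case/negP: none.
  by apply/existsP; exists a; apply/existsP; exists b; rewrite aF bF.
move=> circ2; apply: dom => a b aF bF ab.
have [c [uc cc sc]] := full_edge_cycle esym eirr k1 circ n_ge x0 x1 eig xv mu_ge sT cT mu_le bud aF bF ab.
by have := circ2 c uc cc; rewrite sc; move: k1; clear; lia.
Qed.

(* [x] also maximises the quadratic form of [hub_rel], so that it is an eigenvector of
   both graphs, and positive; every vertex has neighbourhoods of the same weight. *)
Lemma hub_rel_rigid (R : realType) (V : finType) (e : rel V) (mu : R) (x : V -> R) (v t t' : V) (L : {set V}) :
    symmetric e -> irreflexive e -> (forall u, 0 <= x u) ->
    (forall u, nsum e x u = mu * x u) -> x v = 1 -> v \in L ->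
    qform e x <= qform (hub_rel L t t') x ->
    (forall z, qform (hub_rel L t t') z <= mu * sqn z) ->
  e =2 hub_rel L t t'.
Proof.
move=> esym eirr x0 eig xv vL le max; set e' := hub_rel L t t'.
have e'sym : symmetric e' by exact: hub_rel_sym.
have qx : qform e' x = mu * sqn x.
  apply/eqP; rewrite eq_le max /=; apply: le_trans le.
  rewrite le_eqVlt; apply/orP; left; apply/eqP; rewrite /qform /sqn big_distrr.
  by apply: eq_bigr => u _; rewrite eig expr2 mulrCA.
have eig' := qform_max_eigen e'sym max qx.
have xpos u : 0 < x u.
  have [->|uv] := eqVneq u v; first by rewrite xv.
  rewrite lt_neqAle x0 andbT eq_sym; apply: contra_eq_neq (eig' u) => ->.
  rewrite mulr0 gt_eqF // /nsum (bigD1 v) /=; last by rewrite /e' /hub_rel uv vL orbT.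
  by rewrite xv ltr_pwDl // sumr_ge0.
have nsE u : \sum_(w | e u w) x w = \sum_(w | e' u w) x w by rewrite -!/(nsum _ _ _) eig eig'.
(* At a hub, [e] is contained in [e']; equal weights with positive entries leave no room for a
   further neighbour. *)
have hubE h w : h \in L -> e h w = e' h w.
  move=> hL; have sub u : e h u -> e' h u.
    by move=> ehu; rewrite /e' /hub_rel hL andbT; apply: contraTneq ehu => <-; rewrite eirr.
  apply/idP/idP => [/sub//|e'hw]; apply: contraT => nehw.
  have := nsE h; rewrite [RHS](bigID (e h)) /=.
  have -> : \sum_(i | e' h i && e h i) x i = \sum_(i | e h i) x i.
    by apply: eq_bigl => i; case: (boolP (e h i)) => [/sub->|]; rewrite ?andbF.
  move/eqP; rewrite -subr_eq0 opprD addrA subrr sub0r oppr_eq0 gt_eqF //.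
  by rewrite (bigD1 w) ?e'hw ?nehw //= ltr_pwDl // sumr_ge0.
have outE u : u \notin L -> \sum_(w in ~: L | e u w) x w = \sum_(w in ~: L | e' u w) x w.
  move=> uL; have := nsE u; rewrite (bigID (mem L)) [RHS](bigID (mem L)) /=.
  have -> : \sum_(i | e u i && (i \in L)) x i = \sum_(i | e' u i && (i \in L)) x i.
    apply: eq_bigl => i; case: (boolP (i \in L)) => iL; rewrite ?andbF // !andbT.
    by rewrite esym hubE // e'sym.
  move/addrI; under eq_bigl => i do rewrite andbC -in_setC.
  by under [RHS]eq_bigl => i do rewrite andbC -in_setC.
have e'out a b : a \notin L -> b \notin L ->
    e' a b = (a != b) && ((a == t) && (b == t') || (a == t') && (b == t)).
  by move=> /negPf aL /negPf bL; rewrite /e' /hub_rel aL bL.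
have mem_tt a b : a \notin L -> b \notin L -> e a b -> (a == t) || (a == t').
  move=> aL bL ab; apply: contraT; rewrite negb_or => /andP[/negPf at1 /negPf at2].
  have := outE a aL; rewrite [RHS]big_pred0 => [|w]; last first.
    rewrite in_setC; case: (boolP (w \in L)) => //= wL.
    by rewrite e'out // at1 at2 andbF.
  rewrite (bigD1 b) ?in_setC ?bL //= => /eqP; rewrite gt_eqF //.
  by rewrite ltr_pwDl // sumr_ge0.
have sub a b : a \notin L -> b \notin L -> e a b -> e' a b.
  move=> aL bL ab; rewrite e'out //; have nab : a != b by apply: contraTneq ab => ->; rewrite eirr.
  have ta := mem_tt a b aL bL ab; have tb : (b == t) || (b == t').
    by apply: mem_tt bL aL _; rewrite esym.
  rewrite nab /=; move: ta tb nab.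
  case/orP=> /eqP->; case/orP=> /eqP->; rewrite ?eqxx //= ?orbT //.
move=> a b; have [aL|aL] := boolP (a \in L); first exact: hubE.
have [bL|bL] := boolP (b \in L); first by rewrite esym e'sym hubE.
apply/idP/idP => [|e'ab]; first exact: sub.
(* Equal weights give [a] some neighbour for [e] outside [L]. It is also a neighbour for [e'], where
   [b] is the only one. *)
have [c /andP[cL eac]|none] := pickP (fun w => (w \in ~: L) && e a w); last first.
  have := outE a aL; rewrite big_pred0 // (bigD1 b) /= ?in_setC ?bL // => /eqP.
  by rewrite lt_eqF // ltr_pwDl // sumr_ge0.
rewrite in_setC in cL; have := sub a c aL cL eac; move: e'ab; rewrite !e'out //.
case/andP=> nab h1 /andP[nac h2]; suff <- : c = b by [].
move: h1 h2 nab nac.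
by case/orP=> /andP[/eqP-> /eqP->]; case/orP=> /andP[/eqP E1 /eqP->] //; rewrite ?E1 ?eqxx.
Qed.

(** * Transfer to [S_graph] and [S_plus_graph] *)

Section Transport.
Variables (R : realFieldType) (V W : finType) (g : W -> V).
Hypothesis bij_g : bijective g.
Variables (e : rel V) (e' : rel W).
Hypothesis eg : forall a b, e' a b = e (g a) (g b).

Lemma sqn_transport (z : V -> R) : sqn (fun a => z (g a)) = sqn z.
Proof. by rewrite /sqn [RHS](reindex g) //; exact: onW_bij. Qed.

Lemma qform_transport (z : V -> R) : qform e' (fun a => z (g a)) = qform e z.
Proof.
rewrite /qform [RHS](reindex g) /=; last exact: onW_bij.
apply: eq_bigr => a _; congr (_ * _); rewrite /nsum [RHS](reindex g) /=; last exact: onW_bij.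
by apply: eq_bigl => b; rewrite eg.
Qed.
End Transport.

Lemma S_graph_adj n k (a b : S_graph n k) : adj a b =
  match a, b with inl i, inl j => i != j | inr _, inr _ => false | _, _ => true end.
Proof.
by case: a b => [i|i] [j|j] //=; rewrite /compl_adj /= /complete_adj; case: (i != j).
Qed.

(** The numbering of the independent side begins with [t] and [t'], the ends of the edge added in
    [S_plus_graph]. *)
Lemma S_numbering (V : finType) n k (L : {set V}) t t' : #|V| = n -> #|L| = k ->
    t \notin L -> t' \notin L -> t != t' ->
  exists g : 'I_k + 'I_(n - k) -> V, [/\ bijective g, forall i, g (inl i) \in L,
    forall j, g (inr j) \notin L & forall j : 'I_(n - k),
    (g (inr j) == t) = (j == 0 :> nat) /\ (g (inr j) == t') = (j == 1 :> nat)].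
Proof.
move=> cV cL tL t'L tt'.
pose s := [:: t, t' & enum (~: L :\ t :\ t')].
have us : uniq s by rewrite /= inE !mem_enum !inE !eqxx /= andbF orbF tt' enum_uniq.
have ms u : (u \in s) = (u \notin L).
  rewrite !inE mem_enum !inE; case: eqVneq => [->|_]; first by rewrite tL.
  by case: eqVneq => [->|_]; rewrite ?t'L ?andbT.
have szs : size s = (n - k)%N.
  rewrite -(card_uniqP us) -cV -cL -(cardsC L) addKn; apply: eq_card => u.
  by rewrite ms inE.
pose g (a : 'I_k + 'I_(n - k)) := match a with inl i => nth t (enum L) i | inr j => nth t s j end.
have gl i : g (inl i) \in L by rewrite -mem_enum mem_nth // -cardE cL.
have gr j : g (inr j) \notin L by rewrite -ms mem_nth // szs.
exists g; split=> //; last first.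
  move=> j; have jt (l : nat) : (l < size s)%N -> (nth t s j == nth t s l) = (j == l :> nat).
    by move=> ls; rewrite nth_uniq // szs.
  by rewrite -(jt 0%N) // -(jt 1%N).
apply: inj_card_bij; last first.
  by rewrite card_sum !card_ord cV subnKC // -cV -cL max_card.
move=> [i|i] [j|j] /= E.
- congr inl; apply/val_inj/eqP; have szL : size (enum L) = k by rewrite -cardE.
  by rewrite -(nth_uniq t _ _ (enum_uniq L)) ?szL ?(ltn_ord i) ?(ltn_ord j) //; exact/eqP.
- by have := gl i; rewrite /= E (negPf (gr j)).
- by have := gl j; rewrite /= -E (negPf (gr i)).
- by congr inr; apply/val_inj/eqP; rewrite -(nth_uniq t _ _ us) ?szs ?(ltn_ord i) ?(ltn_ord j) //; exact/eqP.
Qed.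

(** The test vector is [rho] on the clique and [k] on the independent side, where it satisfies the
    eigenvector equation of [S_graph]. The second conclusion places [rho] where
    [rho * (rho - k%:R + 1)] increases, so that the bound passes on to a larger spectral radius. *)
Lemma S_radius_lower (R : realType) n k (e : rel ('I_k + 'I_(n - k))%type) (rho : R) : (1 < k)%N -> (k < n)%N ->
    (forall a b, @adj (S_graph n k) a b -> e a b) -> (forall z, qform e z <= rho * sqn z) ->
  k%:R * (n%:R - k%:R) <= rho * (rho - k%:R + 1) /\ k%:R - 1 <= rho.
Proof.
move=> k1 kn sub maxq.
have key (s q : R) : 0 <= s -> 0 <= q ->
    k%:R * (s * ((k%:R - 1) * s + (n%:R - k%:R) * q)) + (n%:R - k%:R) * (q * (k%:R * s)) <=
    rho * (k%:R * s ^+ 2 + (n%:R - k%:R) * q ^+ 2).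
  move=> s0 q0; pose z (a : 'I_k + 'I_(n - k)) := match a with inl _ => s | inr _ => q end.
  have z0 a : 0 <= z a by case: a.
  have nkR : n%:R - k%:R = (n - k)%:R :> R by rewrite natrB // ltnW.
  have sE : sqn z = k%:R * s ^+ 2 + (n%:R - k%:R) * q ^+ 2.
    by rewrite /sqn big_sumType /= !sumr_const !card_ord nkR !mulr_natl.
  rewrite -sE; apply: le_trans (maxq z); rewrite /qform big_sumType /= nkR !mulr_natl.
  have ns a : \sum_(b | @adj (S_graph n k) a b) z b <= nsum e z a.
    rewrite /nsum big_mkcond [X in _ <= X]big_mkcond; apply: ler_sum => b _.
    by case: ifP => [/sub->//|_]; case: ifP.
  apply: lerD.
    rewrite -[X in _ *+ X]card_ord -sumr_const; apply: ler_sum => i _.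
    rewrite ler_wpM2l //; apply: le_trans (ns _); rewrite big_sumType /=.
    apply: lerD.
      rewrite sumr_const (_ : #|_| = k.-1); last first.
        by rewrite -[in RHS](card_ord k) -(cardC1 i); apply: fintype.eq_card => j; rewrite !inE eq_sym.
      by rewrite -(mulr_natl s k.-1) -subn1 natrB // ltnW.
    by rewrite sumr_const card_ord.
  rewrite -[X in _ *+ X](card_ord (n - k)) -sumr_const; apply: ler_sum => i _.
  rewrite ler_wpM2l //; apply: le_trans (ns _); rewrite big_sumType /=.
  rewrite sumr_const card_ord lerDl; exact: sumr_ge0.
have k2 : 2 <= k%:R :> R by rewrite ler_nat.
have nk : 1 <= n%:R - k%:R :> R by rewrite lerBrDr nat1r ler_nat.
have rho0 : 0 < rho.
  have kp : 0 < k%:R * (k%:R - 1) :> R by rewrite mulr_gt0 //; lra.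
  rewrite ltNge; apply/negP=> rho0; have := key 1 0 ler01 (lexx _).
  have : rho * k%:R <= 0 by rewrite mulr_le0_ge0 ?ler0n.
  lra.
have main : k%:R * (n%:R - k%:R) <= rho * (rho - k%:R + 1).
  have kp : 0 < k%:R :> R by lra.
  have kr : 0 < k%:R * rho by rewrite mulr_gt0.
  by rewrite -(ler_pM2l kr); have := key rho k%:R (ltW rho0) (ltW kp); lra.
split=> //; rewrite leNgt; apply/negP=> lt.
have : rho * (rho - k%:R + 1) <= 0 by rewrite mulr_ge0_le0 //; lra.
have : 0 < k%:R * (n%:R - k%:R) :> R by rewrite mulr_gt0 //; lra.
lra.
Qed.

Lemma S_graph_hub_rel (V : finType) n k (g : 'I_k + 'I_(n - k) -> V) (L : {set V}) v :
    injective g -> (forall i, g (inl i) \in L) -> (forall j, g (inr j) \notin L) -> v \in L ->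
  forall a b, @adj (S_graph n k) a b = hub_rel L v v (g a) (g b).
Proof.
move=> ginj gl gr vL a b; rewrite S_graph_adj /hub_rel (inj_eq ginj).
case: a b => [i|i] [j|j]; rewrite ?gl ?(negPf (gr _)) //= ?andbT //.
have gv u : u \notin L -> (u == v) = false by apply: contraNF => /eqP->.
by rewrite !(gv (g (inr _))) ?gr ?andbF.
Qed.

Lemma S_plus_hub_rel (V : finType) n k (g : 'I_k + 'I_(n - k) -> V) (L : {set V}) t t' :
    injective g -> (forall i, g (inl i) \in L) -> (forall j, g (inr j) \notin L) ->
    (forall j : 'I_(n - k), (g (inr j) == t) = (j == 0 :> nat) /\ (g (inr j) == t') = (j == 1 :> nat)) ->
  forall a b, @adj (S_plus_graph n k) a b = hub_rel L t t' (g a) (g b).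
Proof.
move=> ginj gl gr gt a b.
rewrite [LHS]/(S_plus_adj a b) /S_plus_adj S_graph_adj /hub_rel (inj_eq ginj).
case: a b => [i|i] [j|j]; rewrite ?gl ?(negPf (gr _)) //= ?andbT ?orbF //.
have [-> ->] := gt i; have [-> ->] := gt j.
case: (eqVneq i j) => [->|ij]; first by rewrite eqxx; case: j => -[|[|m]] lt_m.
by rewrite (_ : inr i != inr j) //; apply: contraNneq ij => -[->].
Qed.

Lemma normalized_perron (R : realType) (G : sgraph) : (0 < #|G|)%N ->
  exists (x : G -> R) v, [/\ forall u, 0 <= x u, forall u, x u <= 1, x v = 1 &
    forall u, nsum (@adj G) x u = spectral_radius R G * x u].
Proof.
move=> G0; have [y [y0 [u yu] yA _]] := spectral_radiusP R G0.
have [v _ maxv] := @arg_maxP _ _ G u xpredT y isT.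
have yv : 0 < y v by apply: lt_le_trans (maxv u isT); rewrite lt_neqAle eq_sym yu y0.
exists (fun w => y w / y v), v; split=> [w|w||w].
- by rewrite divr_ge0 // ltW.
- by rewrite ler_pdivrMr // mul1r; exact: maxv.
- by rewrite divff // gt_eqF.
- by rewrite /nsum -big_distrl /= mulrA -yA.
Qed.

Lemma hub_rel_iso (R : realType) (G H : sgraph) (g : H -> G) (x : G -> R) (v t t' : G) (L : {set G}) :
    (0 < #|G|)%N -> bijective g -> (forall a b, adj a b = hub_rel L t t' (g a) (g b)) ->
    spectral_radius R H <= spectral_radius R G ->
    (forall u, 0 <= x u) -> (forall u, nsum (@adj G) x u = spectral_radius R G * x u) ->
    x v = 1 -> v \in L -> qform (@adj G) x <= qform (hub_rel L t t') x ->
  graph_iso G H.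
Proof.
move=> G0 bg gE le x0 eig xv vL dom.
have H0 : (0 < #|H|)%N by rewrite (bij_eq_card bg).
have [y [_ _ _ maxH]] := spectral_radiusP R H0.
have max z : qform (hub_rel L t t') z <= spectral_radius R G * sqn z.
  rewrite -(qform_transport bg gE) -(sqn_transport bg); apply: le_trans (maxH _) _.
  by rewrite ler_wpM2r // sqn_ge0.
have eE := hub_rel_rigid (@adj_sym G) (@adj_irrefl G) x0 eig xv vL dom max.
have [h gh hg] := bg; exists h; split; first by exists g.
by move=> a b; rewrite gE !hg eE.
Qed.

Lemma not_has_cycle_geq (G : sgraph) l : ~ has_cycle_geq G l.+1 ->
  forall c : seq G, uniq c -> cycle (@adj G) c -> (2 < size c)%N -> (size c <= l)%N.
Proof.
move=> no c uc cc c3; rewrite leqNgt; apply/negP=> lt; apply: no; exists c => //.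
by rewrite /is_graph_cycle c3 /ucycleb cc uc.
Qed.

Theorem theorem1p3 (R : realType) (k n : nat) (hk : (2 <= k)%N)
    (hn : (13 * k ^ 2 <= n)%N) (G : sgraph) (hG : #|G| = n) :
  ((spectral_radius R (S_graph n k) <= spectral_radius R G)%R ->
     ~ graph_iso G (S_graph n k) -> has_cycle_geq G (2 * k + 1)%N) /\
  ((spectral_radius R (S_plus_graph n k) <= spectral_radius R G)%R ->
     ~ graph_iso G (S_plus_graph n k) -> has_cycle_geq G (2 * k + 2)%N).
Proof.
have kn : (k < n)%N by apply: leq_trans hn; rewrite expnS expn1; move: hk; clear; nia.
have G0 : (0 < #|G|)%N by rewrite hG; apply: leq_trans kn.
have [x [v [x0 x1 xv eig]]] := normalized_perron R G0.
have hn' : (13 * k ^ 2 <= #|G|)%N by rewrite hG.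
have lower (e : rel ('I_k + 'I_(n - k))%type) (rho : R) : (forall a b, @adj (S_graph n k) a b -> e a b) ->
    (forall z, qform e z <= rho * sqn z) -> rho <= spectral_radius R G ->
    k%:R * (#|G|%:R - k%:R) <= spectral_radius R G * (spectral_radius R G - k%:R + 1).
  move=> sub maxq le; have [h1 h2] := S_radius_lower hk kn sub maxq.
  have k2 : 2 <= k%:R :> R by rewrite ler_nat.
  rewrite hG; apply: le_trans h1 _; apply: ler_pM => //; lra.
have W0 : (0 < #|{: 'I_k + 'I_(n - k)}|)%N by rewrite card_sum !card_ord subnKC ?(leq_ltn_trans _ kn) // ltnW.
split=> le niso; apply: contrapT; rewrite ?addn1 ?addn2 => /not_has_cycle_geq circ.
- have [_ [_ _ _ maxS]] := spectral_radiusP R (W0 : (0 < #|S_graph n k|)%N).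
  have mu_ge := lower _ _ (fun a b => id) maxS le.
  have circ1 c : uniq c -> cycle (@adj G) c -> (2 < size c)%N -> (size c <= 2 * k + 1)%N.
    by move=> uc cc c3; apply: leq_trans (circ c uc cc c3) (leq_addr _ _).
  have [L [vL cL [t [t' [tL t'L tt' _]]] /(_ circ) dom]] :=
    hub_rel_dominates (@adj_sym G) (@adj_irrefl G) hk circ1 hn' x0 x1 eig xv mu_ge.
  have [g [bg gl gr _]] := S_numbering hG cL tL t'L tt'.
  apply: niso; apply: (@hub_rel_iso R G (S_graph n k) g x v v v L) => //.
  exact: S_graph_hub_rel (bij_inj bg) gl gr vL.
- have [_ [_ _ _ maxS]] := spectral_radiusP R (W0 : (0 < #|S_plus_graph n k|)%N).
  have subS a b : @adj (S_graph n k) a b -> @adj (S_plus_graph n k) a b.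
    by move=> ab; apply/orP; left.
  have mu_ge := lower _ _ subS maxS le.
  have circ1 c : uniq c -> cycle (@adj G) c -> (2 < size c)%N -> (size c <= 2 * k + 1)%N.
    by rewrite addn1; exact: circ.
  have [L [vL cL [t [t' [tL t'L tt' dom]]] _]] :=
    hub_rel_dominates (@adj_sym G) (@adj_irrefl G) hk circ1 hn' x0 x1 eig xv mu_ge.
  have [g [bg gl gr gt]] := S_numbering hG cL tL t'L tt'.
  apply: niso; apply: (@hub_rel_iso R G (S_plus_graph n k) g x v t t' L) => //.
  exact: S_plus_hub_rel (bij_inj bg) gl gr gt.
Qed.
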